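(* Let $\mathfrak{X}_{\mathrm{ISP}}$, $\mathfrak{X}_{\mathcal{T}}$ ($\mathcal{T}$ a well-founded tree admitted by the construction) and $\mathfrak{X}_{\mathcal{U}}$ be the Argyros--Motakis spaces described in the context. The following separable hereditarily indecomposable infinite-dimensional Banach spaces with the Lotz property exist: (i) a real reflexive closed subspace of $\mathfrak{X}_{\mathrm{ISP}}$; (ii) complex reflexive examples, as closed subspaces of the spaces $\mathfrak{X}_{\mathcal{T}}$ (one in each $\mathfrak{X}_{\mathcal{T}}$); (iii) a complex example, a closed subspace of $\mathfrak{X}_{\mathcal{U}}$, with no infinite-dimensional reflexive subspace. All these spaces are weakly compactly generated. In fact, the ambient spaces $\mathfrak{X}_{\mathrm{ISP}}$, $\mathfrak{X}_{\mathcal{T}}$ and $\mathfrak{X}_{\mathcal{U}}$ are Lotz-saturated: every infinite-dimensional closed subspace contains an infinite-dimensional closed subspace with the Lotz property.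
   Context: For a Banach space $Y$ over $\mathbb{K}=\mathbb{R}$ or $\mathbb{C}$, $\mathcal{L}(Y)$, $\mathcal{K}(Y)$, $\mathcal{SS}(Y)$ denote the bounded, compact, and strictly singular operators on $Y$ ($S$ is strictly singular if no restriction of $S$ to an infinite-dimensional closed subspace is an isomorphism onto its range). A $C_0$-semigroup on $Y$ is a family $(T(t))_{t\ge 0}\subset\mathcal{L}(Y)$ with $T(0)=I_Y$, $T(t+s)=T(t)T(s)$, and $\lim_{t\downarrow 0}\|T(t)x-x\|=0$ for all $x\in Y$; it is uniformly continuous if $\lim_{t\downarrow 0}\|T(t)-I_Y\|=0$. $Y$ has the Lotz property (is a Lotz space) if every $C_0$-semigroup on $Y$ is uniformly continuous. $Y$ is weakly compactly generated (WCG) if some weakly compact subset has norm-dense linear span. $Y$ is hereditarily indecomposable (HI) if no infinite-dimensional closed subspace of $Y$ is a topological direct sum of two infinite-dimensional closed subspaces. A bounded sequence $(x_n)$ generates a basic sequence $(e_n)$ as a spreading model if for every $k\in\mathbb{N}$, $\lim_{n_1\to\infty,\ n_1<\cdots<n_k}\|\sum_{j=1}^k a_jx_{n_j}\|=\|\sum_{j=1}^k a_je_j\|$, uniformly for $(a_1,\dots,a_k)\in[-1,1]^k$. The Argyros--Motakis spaces are fixed infinite-dimensional Banach spaces with the following known properties (taken as given). $\mathfrak{X}_{\mathrm{ISP}}$ is a separable reflexive real HI Banach space with a Schauder basis such that every infinite-dimensional closed subspace $Y\subset\mathfrak{X}_{\mathrm{ISP}}$ satisfies: $Y$ admits a normalized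 weakly null sequence generating the unit vector basis of $\ell_1$ as a spreading model; $\mathcal{L}(Y)=\mathbb{R}I_Y+\mathcal{SS}(Y)$; and $QST\in\mathcal{K}(Y)$ for all $Q,S,T\in\mathcal{SS}(Y)$. For every well-founded tree $\mathcal{T}$ admitted by the Argyros--Motakis dual construction, $\mathfrak{X}_{\mathcal{T}}$ is a separable reflexive complex HI Banach space with a Schauder basis. $\mathfrak{X}_{\mathcal{U}}$ (the universal-tree space) is a separable complex HI Banach space with a shrinking Schauder basis and no infinite-dimensional reflexive subspace. Every infinite-dimensional closed subspace $Y$ of any $\mathfrak{X}_{\mathcal{T}}$ or of $\mathfrak{X}_{\mathcal{U}}$ contains a normalized sequence generating the unit vector basis of $\ell_1$ as a spreading model, and satisfies $\mathcal{L}(Y)=\mathbb{C}I_Y+\mathcal{SS}(Y)$ and $ST\in\mathcal{K}(Y)$ for all $S,T\in\mathcal{SS}(Y)$. *)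

(* Defs.v *)
From HB Require Import structures.
From mathcomp Require Import all_boot all_order all_algebra.
From mathcomp Require Import all_classical all_reals all_analysis.
From mathcomp Require Export complex.

Set Implicit Arguments.
Unset Strict Implicit.
Unset Printing Implicit Defensive.

Import Order.TTheory GRing.Theory Num.Theory.
Import numFieldNormedType.Exports.

Local Open Scope classical_set_scope.
Local Open Scope ring_scope.

(* Banach spaces over K are [completeNormedModType K]; their norm takes values
   in K.  For K = R[i] the order is the partial one in which [0 <= z] means
   "z is a nonnegative real", so the definitions below specialize correctly to
   both real (K = R) and complex (K = R[i]) scalars. *)

Record closedSubspace (K : numFieldType) (X : completeNormedModType K) :=
  ClosedSubspace {
    carrier : set X;
    carrier0 : carrier 0;
    carrierL : forall (a : K) (u v : X),
      carrier u -> carrier v -> carrier (a *: u + v);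
    carrier_closed : closed carrier }.

(* A type of its own rather than [set_type (carrier Y)], because the library
   equips the latter with an initial topology instead of the normed one. *)
Definition subspace_of (K : numFieldType) (X : completeNormedModType K)
  (Y : closedSubspace X) : Type := {x : X | x \in carrier Y}.

Section SubspaceBanach.
Variables (K : numFieldType) (X : completeNormedModType K).
Variable Y : closedSubspace X.
Local Notation U := (subspace_of Y).

Let mem_carrier := [pred x : X | x \in carrier Y].

Fact carrier_submod_closed : submod_closed mem_carrier.
Proof.
split; first exact/mem_set/carrier0.
move=> a u v /set_mem Yu /set_mem Yv; exact/mem_set/carrierL.
Qed.

Definition subspace_val (u : U) : X := sval u.

HB.instance Definition _ := [isSub of U for subspace_val].
HB.instance Definition _ := [Choice of U by <:].
HB.instance Definition _ :=
  GRing.SubChoice_isSubLmodule.Build K X mem_carrier U carrier_submod_closed.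

Let nrm (u : U) : K := `|val u|.

Fact subspace_ler_normD (u v : U) : nrm (u + v) <= nrm u + nrm v.
Proof. by rewrite /nrm raddfD ler_normD. Qed.

Fact subspace_normrZ (l : K) (u : U) : nrm (l *: u) = `|l| * nrm u.
Proof. by rewrite /nrm linearZ normrZ. Qed.

Fact subspace_normr0_eq0 (u : U) : nrm u = 0 -> u = 0.
Proof. by move=> /normr0_eq0 u0; apply: val_inj; rewrite u0 raddf0. Qed.

HB.instance Definition _ := Lmodule_isNormed.Build K U
  subspace_ler_normD subspace_normrZ subspace_normr0_eq0.

Fact subspace_complete (F : set_system U) :
  ProperFilter F -> cauchy F -> cvg F.
Proof.
move=> FF Fc.
have bE (u v : U) e : ball u e v = ball (val u) e (val v).
  rewrite -!ball_normE /ball_ /=.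
  by have -> : `|u - v| = nrm (u - v) by []; rewrite /nrm raddfB.
have Fv : ProperFilter ((val : U -> X) @ F) by exact: fmap_proper_filter.
have : cauchy ((val : U -> X) @ F).
  apply/cauchy_exP => e e0.
  have /(_ _ e0)[u Fu] := (@cauchyP K U F FF).1 Fc.
  exists (val u); rewrite /= nbhs_simpl /=.
  by apply: filterS Fu => v; rewrite bE.
move=> /cauchy_cvg/cvg_ex[l Fl].
have Yl : carrier Y l.
  apply: (@closed_cvg _ _ F FF (val : U -> X) (carrier Y) (@carrier_closed _ _ Y) _ l Fl).
  by apply: nearW => u; apply: set_mem; exact: (valP u).
apply/cvg_ex; exists (Sub l (mem_set Yl) : U).
apply/cvg_ballP => e e0.
have /cvg_ballP/(_ _ e0) := Fl.
by apply: filterS => u; rewrite bE SubK.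
Qed.

HB.instance Definition _ := Uniform_isComplete.Build U subspace_complete.

Definition subspace_banach : completeNormedModType K := U.

End SubspaceBanach.

Coercion subspace_banach : closedSubspace >-> CompleteNormedModule.type.

Definition infinite_dim (K : numFieldType) (V : lmodType K) : Prop :=
  ~ exists (n : nat) (b : 'I_n -> V),
      forall x : V, exists c : 'I_n -> K, x = \sum_(i < n) c i *: b i.

Definition linear_span (K : numFieldType) (V : lmodType K) (A : set V) :
    set V :=
  [set x | exists (n : nat) (c : 'I_n -> K) (w : 'I_n -> V),
     (forall i, A (w i)) /\ x = \sum_(i < n) c i *: w i].

Definition bounded_operator (K : numFieldType) (V W : normedModType K)
    (f : V -> W) : Prop :=
  linear f /\ exists M : K, forall x, `|f x| <= M * `|x|.

Definition separable (T : topologicalType) : Prop :=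
  exists2 D : set T, countable D & dense D.

Section BanachSpaces.
Variable K : numFieldType.
Implicit Type X : completeNormedModType K.

Definition compact_operator X (S : X -> X) : Prop :=
  linear S /\ precompact (S @` [set x | `|x| <= 1]).

(* For a bounded [S], being bounded below on [Z] says that the restriction of
   [S] to [Z] is injective with bounded inverse, defined on its range. *)
Definition iso_onto_range X (S : X -> X) (Z : closedSubspace X) : Prop :=
  exists2 c : K, 0 < c & forall z, carrier Z z -> c * `|z| <= `|S z|.

Definition strictly_singular X (S : X -> X) : Prop :=
  bounded_operator S /\
  forall Z : closedSubspace X, infinite_dim Z -> ~ iso_onto_range S Z.

(* L(X) = K I_X + SS(X) *)
Definition scalar_plus_strictly_singular X : Prop :=
  forall T : X -> X, bounded_operator T <->
    exists (l : K) (S : X -> X),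
      strictly_singular S /\ forall x, T x = l *: x + S x.

Definition dual X : set (X -> K^o) := [set f | bounded_operator f].

(* Bounded linear functionals on X^*.  The elements of X^* are the [f] in
   [dual X], and [C] ranges over the upper bounds of the norm of [f]; the
   values of [phi] outside [dual X] are irrelevant. *)
Definition bidual X : set ((X -> K^o) -> K) :=
  [set phi |
     (forall (a : K) (f g : X -> K^o), dual f -> dual g ->
        phi (a *: f + g) = a * phi f + phi g) /\
     exists M : K, forall (f : X -> K^o) (C : K), dual f -> 0 <= C ->
        (forall x, `|f x| <= C * `|x|) -> `|phi f| <= M * C].

(* The canonical embedding of X into its bidual is onto. *)
Definition reflexive_space X : Prop :=
  forall phi, bidual phi ->
    exists x : X, forall f : X -> K^o, dual f -> phi f = f x.

Definition weak_topology X : topologicalType :=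
  initial_topology
    (fun x : X => (fun f => val f x) : {ptws set_type (@dual X) -> K^o}).

Definition weakly_compact X (W : set X) : Prop :=
  compact (W : set (weak_topology X)).

Definition WCG X : Prop :=
  exists2 W : set X, weakly_compact W & dense (linear_span W).

Definition weakly_null X (x : nat -> X) : Prop :=
  forall f : X -> K^o, dual f -> f (x n) @[n --> \oo] --> (0 : K^o).

Definition normalized X (x : nat -> X) : Prop := forall n, `|x n| = 1.

Definition schauder_basis X (e : nat -> X) : Prop :=
  forall x : X, exists! a : nat -> K,
    series (fun n => a n *: e n) @ \oo --> x.

(* Every functional has norms tending to 0 on the tails of the basis. *)
Definition shrinking X (e : nat -> X) : Prop :=
  forall f : X -> K^o, dual f -> forall eps : K, 0 < eps ->
    exists N : nat, forall x, linear_span [set e n | n in [set n | (N <= n)%N]] x ->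
      `|f x| <= eps * `|x|.

(* [nrm] is the norm of the space in which the sequence [e] lives.  The
   coefficients are real even over R[i], since [-1 <= a i <= 1] forces it. *)
Definition generates_spreading_model X (x : nat -> X)
    (E : lmodType K) (nrm : E -> K) (e : nat -> E) : Prop :=
  bounded_set (range x) /\
  forall (k : nat) (eps : K), 0 < eps ->
    exists N : nat, forall n : 'I_k -> nat,
      (forall i, (N <= n i)%N) ->
      (forall i j : 'I_k, (i < j)%N -> (n i < n j)%N) ->
      forall a : 'I_k -> K, (forall i, -1 <= a i <= 1) ->
        `| `|\sum_(j < k) a j *: x (n j)| - nrm (\sum_(j < k) a j *: e j)|
          <= eps.

(* The unit vectors of l1 as plain scalar sequences, with the l1 norm as a total
   function: only finitely supported sequences are ever evaluated. *)
Definition l1_norm (a : nat -> K^o) : K^o := limn (series (fun n => `|a n|)).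

Definition l1_unit_vector (n : nat) : nat -> K^o := fun m => (m == n)%:R.

Definition l1_spreading_model X (x : nat -> X) : Prop :=
  generates_spreading_model x l1_norm l1_unit_vector.

Definition topological_direct_sum X (Z A B : closedSubspace X) : Prop :=
  [/\ carrier Z = [set a + b | a in carrier A & b in carrier B],
      carrier A `&` carrier B = [set 0]
    & exists M : K, forall a b, carrier A a -> carrier B b ->
        `|a| <= M * `|a + b|].

Definition hereditarily_indecomposable X : Prop :=
  forall Z A B : closedSubspace X,
    infinite_dim Z -> infinite_dim A -> infinite_dim B ->
    ~ topological_direct_sum Z A B.

Definition no_reflexive_subspace X : Prop :=
  forall Z : closedSubspace X, infinite_dim Z -> ~ reflexive_space Z.

End BanachSpaces.

Section Semigroups.
Variables (R : realType) (K : numFieldType).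
Implicit Type X : completeNormedModType K.

Definition C0_semigroup X (T : R -> X -> X) : Prop :=
  [/\ forall t, 0 <= t -> bounded_operator (T t),
      forall x, T 0 x = x,
      forall t s, 0 <= t -> 0 <= s -> forall x, T (t + s) x = T t (T s x)
    & forall x, T t x @[t --> 0^'+] --> x].

Definition uniformly_continuous_semigroup X (T : R -> X -> X) : Prop :=
  forall eps : K, 0 < eps ->
    \forall t \near 0^'+, forall x, `|T t x - x| <= eps * `|x|.

(* All the operators T(t) act on a space over K, but time is always real, hence
   the separate parameter R. *)
Definition lotz X : Prop :=
  forall T : R -> X -> X, C0_semigroup T -> uniformly_continuous_semigroup T.

Definition lotz_saturated X : Prop :=
  forall Y : closedSubspace X, infinite_dim Y ->
    exists Z : closedSubspace X,
      [/\ carrier Z `<=` carrier Y, infinite_dim Z & lotz Z].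

End Semigroups.

(* These records list what is assumed about the Argyros-Motakis spaces, which
   are not constructed here. *)
Record ISP_properties (R : realType) (X : completeNormedModType R) : Prop := {
  ISP_infinite_dim : infinite_dim X;
  ISP_separable : separable X;
  ISP_reflexive : reflexive_space X;
  ISP_HI : hereditarily_indecomposable X;
  ISP_basis : exists e : nat -> X, schauder_basis e;
  ISP_l1 : forall Y : closedSubspace X, infinite_dim Y ->
    exists x : nat -> Y,
      [/\ normalized x, weakly_null x & l1_spreading_model x];
  ISP_scalar_plus_SS : forall Y : closedSubspace X, infinite_dim Y ->
    scalar_plus_strictly_singular Y;
  ISP_compact : forall Y : closedSubspace X, infinite_dim Y ->
    forall Q S T : Y -> Y,
      strictly_singular Q -> strictly_singular S -> strictly_singular T ->
      compact_operator (Q \o S \o T) }.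

(* The part common to the well-founded-tree spaces and to the universal-tree
   space. *)
Record tree_space_properties (R : realType) (X : completeNormedModType R[i]) :
    Prop := {
  tree_infinite_dim : infinite_dim X;
  tree_separable : separable X;
  tree_HI : hereditarily_indecomposable X;
  tree_l1 : forall Y : closedSubspace X, infinite_dim Y ->
    exists x : nat -> Y, normalized x /\ l1_spreading_model x;
  tree_scalar_plus_SS : forall Y : closedSubspace X, infinite_dim Y ->
    scalar_plus_strictly_singular Y;
  tree_compact : forall Y : closedSubspace X, infinite_dim Y ->
    forall S T : Y -> Y, strictly_singular S -> strictly_singular T ->
      compact_operator (S \o T) }.

Record wf_tree_space_properties (R : realType)
    (X : completeNormedModType R[i]) : Prop := {
  wf_tree_space : tree_space_properties X;
  wf_tree_reflexive : reflexive_space X;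
  wf_tree_basis : exists e : nat -> X, schauder_basis e }.

Record universal_tree_space_properties (R : realType)
    (X : completeNormedModType R[i]) : Prop := {
  universal_tree_space : tree_space_properties X;
  universal_no_reflexive : no_reflexive_subspace X;
  universal_basis : exists e : nat -> X, schauder_basis e /\ shrinking e }.

Definition is_tree (A : Type) (t : set (seq A)) : Prop :=
  forall s u : seq A, t (s ++ u) -> t s.

Definition well_founded_tree (A : Type) (t : set (seq A)) : Prop :=
  is_tree t /\ ~ exists b : nat -> A, forall n, t (mkseq b n).

(* Main.v *)
Require Import Defs.
From mathcomp Require Import all_boot all_order all_algebra.
From mathcomp Require Import all_classical all_reals all_analysis.
From mathcomp Require Import ring lra.
Import Order.TTheory GRing.Theory Num.Theory.
Import numFieldNormedType.Exports.
Set Implicit Arguments.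
Unset Strict Implicit.
Unset Printing Implicit Defensive.
Local Open Scope classical_set_scope.
Local Open Scope ring_scope.

(** Separability, hereditary indecomposability, reflexivity and the absence of
    reflexive subspaces pass to closed subspaces, and separable spaces are
    weakly compactly generated ([separable_WCG]). Everything therefore reduces
    to saturation: every infinite-dimensional closed subspace [Y] must contain
    an infinite-dimensional closed subspace with the Lotz property.

    _A criterion_ ([lotz_criterion]). Let T be a C_0-semigroup on a space where
    every bounded operator is a scalar plus a strictly singular one, and where
    cubes of strictly singular operators are compact. The averages A_h of T
    over the times in [0, h] satisfy |(T(t) - I) A_h| <= 2 M t / h, because the
    integrals over [0, h] and [t, t + h] overlap. Write A_h = l + W with W
    strictly singular. If l is nonzero for some h, multiply by l^2 - l W + W^2:
    then l^3 (T(t) - I) is the difference of (T(t) - I) A_h (l^2 - l W + W^2),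
    which is of order t, and (T(t) - I) W^3, which tends to 0 in norm since W^3
    is compact. So T is uniformly continuous. If l = 0 for all h, the operators
    A_h^3 are compact, uniformly bounded and tend strongly to I as h tends
    to 0. A space on which no sequence of operators does this, one that fails
    the bounded compact approximation property in the sense of [fails_bcap],
    thus has the Lotz property.

    _Failure of approximation_ ([exists_fails_bcap]). By the spreading models
    and Mazur's construction of basic sequences, [Y] contains a sequence of
    finite-dimensional levels, each of them uniformly isomorphic to the l1
    space of a prescribed finite index set, with uniformly bounded coordinates
    ([exists_l1_levels], [levels_coordinates]). Each level is cut into blocks,
    every block being an L1 space over a set of signs, and x_k is a Rademacher
    function in the block of its index k. Signed sums of N vectors of one block
    have norm at most sqrt N ([rad_sum_le]), whereas the sum of the dual
    functionals of N vectors from distinct blocks has a norm bounded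
    independently of N ([rad_dual_sum_le]).

    From these vectors one builds, as in Szankowski's example, vectors z_i
    indexed by bit strings, with pieces in two consecutive levels. Their
    biorthogonal functionals have an expression in either level, and these
    agree on a closed subspace Z that contains all the z_i. Let beta_n(T) be
    the mean of the diagonal entries of T on Z over the z_i of level n.
    Comparing two consecutive levels through the two expressions gives
    beta_(n+1)(T) - beta_n(T) as twice the mean of the values x_k^*(T y_k),
    where y_k no longer contains x_k. The indices can be grouped into families
    for which the functionals x_k^* lie on distinct blocks while the pieces of
    the vectors y_k lie on common blocks. With N indices in each family, random signs bound
    the difference by a multiple of |T| / sqrt N ([trace_shift_le]), which
    decays geometrically in n ([average_trace_diff_le]). Now beta_n(I) = 1, and
    beta_n(T) tends to 0 when T is compact. If bounded compact T_h tended
    strongly to I, then beta_n(I - T_h) would be small for some n and h, would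
    remain so for all larger n, and would tend to 1 with n. *)

(** * Real and complex scalars *)

(** The field K is R or R[i], and [J] is the imaginary unit or 0, so that every
    argument is written once for both. Norms of spaces over K take values
    in K; [re] brings them back to R, where the order is total. *)
Record scalars (R : realType) (K : numFieldType) := Scalars {
  emb : {rmorphism R -> K};
  re : K -> R;
  im : K -> R;
  J : K;
  scal_decomp : forall a, a = emb (re a) + J * emb (im a);
  re_emb : forall u v, re (emb u + J * emb v) = u;
  emb_re_norm : forall (V : normedZmodType K) (x : V), emb (re `|x|) = `|x|;
  emb_le : {mono emb : x y / x <= y};
  norm_sqr : forall u v, re `|emb u + J * emb v| <= Num.sqrt (u ^+ 2 + v ^+ 2);
  re_le : forall a, `|re a| <= re `|a|;
  im_le : forall a, `|im a| <= re `|a|;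
  J_case : J * J = -1 \/ J = 0 }.

Arguments J {R K}.

Section Nrm.
Variables (R : realType) (K : numFieldType) (S : scalars R K).

Definition nrm (V : normedZmodType K) (x : V) : R := re S `|x|.

Lemma nrmE (V : normedZmodType K) (x : V) : emb S (nrm x) = `|x|.
Proof. exact: emb_re_norm. Qed.

Lemma emb_inj : injective (emb S).
Proof. exact: fmorph_inj. Qed.

Lemma emb_lt : {mono emb S : x y / x < y}.
Proof. by move=> x y; rewrite !lt_neqAle emb_le (inj_eq emb_inj). Qed.

Lemma emb_gt0 r : (0 < emb S r) = (0 < r).
Proof. by rewrite -(rmorph0 (emb S)) emb_lt. Qed.

Lemma re_embK r : re S (emb S r) = r.
Proof. by rewrite -[emb S r]addr0 -[X in _ + X](mulr0 (J S)) -(rmorph0 (emb S)) re_emb. Qed.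

Lemma emb_nonneg (c : K) : 0 <= c -> emb S (re S c) = c.
Proof. by move=> c0; rewrite -{1}(ger0_norm c0) emb_re_norm ger0_norm. Qed.

Section V.
Variable V : normedZmodType K.
Implicit Types x y : V.

Lemma nrm_ge0 x : 0 <= nrm x.
Proof. by rewrite -(emb_le S) rmorph0 nrmE. Qed.

Lemma nrm0 : nrm (0 : V) = 0.
Proof. by apply: emb_inj; rewrite nrmE normr0 rmorph0. Qed.

Lemma nrm_eq0 x : nrm x = 0 -> x = 0.
Proof. by move=> /(congr1 (emb S)); rewrite nrmE rmorph0 => /normr0_eq0. Qed.

Lemma nrm_gt0 x : x != 0 -> 0 < nrm x.
Proof.
by move=> x0; rewrite lt_def nrm_ge0 andbT; apply: contra x0 => /eqP/nrm_eq0/eqP.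
Qed.

Lemma nrmN x : nrm (- x) = nrm x.
Proof. by rewrite /nrm normrN. Qed.

Lemma nrmD x y : nrm (x + y) <= nrm x + nrm y.
Proof. by rewrite -(emb_le S) rmorphD !nrmE ler_normD. Qed.

Lemma nrmB x y : nrm (x - y) <= nrm x + nrm y.
Proof. by rewrite -(nrmN y) nrmD. Qed.

Lemma nrm_distC x y : nrm (x - y) = nrm (y - x).
Proof. by rewrite -nrmN opprB. Qed.

Lemma nrm_dist x y z : nrm (x - z) <= nrm (x - y) + nrm (y - z).
Proof. by apply: le_trans (nrmD _ _); rewrite addrA subrK. Qed.

Lemma nrm_subl x y : nrm x - nrm y <= nrm (x - y).
Proof. by rewrite lerBlDr; apply: le_trans (nrmD _ _); rewrite subrK. Qed.

Lemma nrm_addl x y : nrm x - nrm y <= nrm (x + y).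
Proof. by rewrite -(nrmN y) -{2}(opprK y); exact: nrm_subl. Qed.

Lemma nrm_sum (I : Type) (r : seq I) (P : pred I) (F : I -> V) :
  nrm (\sum_(i <- r | P i) F i) <= \sum_(i <- r | P i) nrm (F i).
Proof.
elim/big_ind2 : _ => [|x1 x2 y1 y2 h1 h2|//]; first by rewrite nrm0.
exact: le_trans (nrmD _ _) (lerD h1 h2).
Qed.

Lemma norm_leE (c : R) x : (`|x| <= emb S c) = (nrm x <= c).
Proof. by rewrite -nrmE emb_le. Qed.

Lemma norm_ltE (c : R) x : (`|x| < emb S c) = (nrm x < c).
Proof. by rewrite -nrmE emb_lt. Qed.

Lemma norm_le1 x : (`|x| <= 1) = (nrm x <= 1).
Proof. by rewrite -(rmorph1 (emb S)) norm_leE. Qed.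

End V.

Lemma nrmM (a b : K) : nrm (a * b) = nrm a * nrm b.
Proof. by apply: emb_inj; rewrite rmorphM !nrmE normrM. Qed.

Lemma nrm1 : nrm (1 : K) = 1.
Proof. by apply: emb_inj; rewrite nrmE normr1 rmorph1. Qed.

Lemma nrm_emb r : nrm (emb S r : K) = `|r|.
Proof.
wlog r0 : r / 0 <= r => [hw|].
  have [/hw//|/ltW r0] := leP 0 r.
  by rewrite -(opprK r) rmorphN nrmN normrN hw// oppr_ge0.
by apply: emb_inj; rewrite nrmE !ger0_norm// -(rmorph0 (emb S)) emb_le.
Qed.

Lemma nrmZ (V : normedModType K) (a : K) (x : V) : nrm (a *: x) = nrm a * nrm x.
Proof. by apply: emb_inj; rewrite rmorphM !nrmE normrZ. Qed.

Lemma nrmZr (V : normedModType K) (r : R) (x : V) : nrm (emb S r *: x) = `|r| * nrm x.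
Proof. by rewrite nrmZ nrm_emb. Qed.

(** A K-valued bound is a real number as soon as some vector is nonzero, so it
    can be replaced by its modulus. *)
Lemma bounded_operatorP (V W : normedModType K) (f : V -> W) :
  bounded_operator f <->
  linear f /\ exists2 M : R, 0 <= M & forall x, nrm (f x) <= M * nrm x.
Proof.
split=> [[lf [M hM]]|[lf [M M0 hM]]]; split=> //.
  exists (nrm M) => [|x]; first exact: nrm_ge0.
  rewrite -(emb_le S) rmorphM !nrmE; apply: le_trans (hM x) _.
  have [x0|x0] := eqVneq `|x| 0; first by rewrite x0 !mulr0.
  have xp : 0 < `|x| by rewrite lt_def x0 /=.
  have Mr : M \is Num.real.
    have := le_trans (normr_ge0 _) (hM x); rewrite pmulr_lge0// => M0.
    exact: ger0_real.
  by apply: ler_wpM2r => //; exact: real_ler_norm.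
by exists (emb S M) => x; rewrite -!nrmE -rmorphM emb_le.
Qed.

Section Lin.
Variables (V : lmodType K) (W : lmodType K) (f : V -> W).
Hypothesis lf : linear f.

Lemma linD x y : f (x + y) = f x + f y.
Proof. by have := lf 1 x y; rewrite !scale1r. Qed.

Lemma lin0 : f 0 = 0.
Proof. by apply: (addrI (f 0)); rewrite -linD !addr0. Qed.

Lemma linZ a x : f (a *: x) = a *: f x.
Proof. by have := lf a x 0; rewrite lin0 !addr0. Qed.

Lemma linN x : f (- x) = - f x.
Proof. by rewrite -scaleN1r linZ scaleN1r. Qed.

Lemma linB x y : f (x - y) = f x - f y.
Proof. by rewrite linD linN. Qed.

Lemma lin_sum (I : Type) (r : seq I) (P : pred I) (F : I -> V) :
  f (\sum_(i <- r | P i) F i) = \sum_(i <- r | P i) f (F i).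
Proof. exact: (big_morph f linD lin0). Qed.

End Lin.

Section Topology.
Variable V : normedModType K.
Implicit Types (x y l : V) (A : set V).

Lemma nbhs_nrm x A :
  nbhs x A <-> exists2 e : R, 0 < e & forall y, nrm (x - y) < e -> A y.
Proof.
split=> [/nbhs_normP[/= e e0 h]|[e e0 h]].
  exists (re S e); first by rewrite -emb_gt0 emb_nonneg ?ltW.
  move=> y xy; apply: h => /=; move: xy.
  by rewrite -norm_ltE emb_nonneg ?ltW.
apply/nbhs_normP; exists (emb S e) => /=; first by rewrite emb_gt0.
by move=> y /=; rewrite norm_ltE; exact: h.
Qed.

Lemma closure_nrm A x :
  closure A x <-> forall e : R, 0 < e -> exists2 y, A y & nrm (x - y) < e.
Proof.
split=> [h e e0|h B /nbhs_nrm[e e0 hB]].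
  have : nbhs x [set y | nrm (x - y) < e] by apply/nbhs_nrm; exists e.
  by move=> /h[y [Ay xy]]; exists y.
by have [y Ay xy] := h e e0; exists y; split=> //; exact: hB.
Qed.

Lemma closed_nrm A : closed A <->
  forall x, (forall e : R, 0 < e -> exists2 y, A y & nrm (x - y) < e) -> A x.
Proof.
by split=> [cA x /closure_nrm/cA|h x /closure_nrm/h].
Qed.

Definition tends (u : nat -> V) l :=
  forall e : R, 0 < e -> exists N, forall n, (N <= n)%N -> nrm (u n - l) < e.

Lemma tendsP u l : tends u l <-> u @ \oo --> l.
Proof.
split=> [h A /nbhs_nrm[e e0 hA]|h e e0].
  have [N hN] := h e e0; exists N => // n /= Nn; apply: hA.
  by rewrite nrm_distC; exact: hN.
have : nbhs l [set y | nrm (y - l) < e].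
  by apply/nbhs_nrm; exists e => // y; rewrite nrm_distC.
by move=> /h[N _ hN]; exists N => n Nn; exact: hN.
Qed.

Lemma tends_le u l (C : R) : tends u l -> (forall n, nrm (u n) <= C) -> nrm l <= C.
Proof.
move=> ul uC; apply/ler_addgt0Pr => e e0.
have [N /(_ N (leqnn _)) hN] := ul e e0.
have := nrm_dist l (u N) 0; rewrite !subr0 nrm_distC => h.
by have := uC N; lra.
Qed.

Lemma tends_unique u l l' : tends u l -> tends u l' -> l = l'.
Proof.
move=> ul ul'; apply/eqP; rewrite -subr_eq0; apply/eqP/nrm_eq0.
apply/eqP; rewrite eq_le nrm_ge0 andbT; apply/ler_addgt0Pr => e e0.
have [N hN] := ul _ (divr_gt0 e0 (ltr0n _ 2)).
have [N' hN'] := ul' _ (divr_gt0 e0 (ltr0n _ 2)).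
have := hN _ (leq_maxl N N'); have := hN' _ (leq_maxr N N').
set x := u _; have := nrm_dist l x l'; rewrite (nrm_distC l x); lra.
Qed.

End Topology.

Lemma tends_lin (V W : normedModType K) (f : V -> W) (u : nat -> V) l :
  bounded_operator f -> tends u l -> tends (f \o u) (f l).
Proof.
move=> /bounded_operatorP[lf [M M0 hM]] ul e e0.
have M1 : 0 < M + 1 by lra.
have [N hN] := ul _ (divr_gt0 e0 M1); exists N => n /hN; rewrite ltr_pdivlMr// => h.
rewrite /= -linB//; apply: le_lt_trans (hM _) _; apply: le_lt_trans h.
by have := nrm_ge0 (u n - l); nra.
Qed.

Lemma tendsD (V : normedModType K) (u v : nat -> V) l m :
  tends u l -> tends v m -> tends (fun n => u n + v n) (l + m).
Proof.
move=> ul vm e e0.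
have [N hN] := ul _ (divr_gt0 e0 (ltr0n _ 2)).
have [N' hN'] := vm _ (divr_gt0 e0 (ltr0n _ 2)).
exists (maxn N N') => n; rewrite geq_max => /andP[/hN h1 /hN' h2].
rewrite opprD addrACA; have := nrmD (u n - l) (v n - m); lra.
Qed.

Lemma tendsZ (V : normedModType K) (a : K) (u : nat -> V) l :
  tends u l -> tends (fun n => a *: u n) (a *: l).
Proof.
move=> ul e e0; have M1 : 0 < nrm a + 1 by have := nrm_ge0 a; lra.
have [N hN] := ul _ (divr_gt0 e0 M1); exists N => n /hN; rewrite ltr_pdivlMr// => h.
rewrite -scalerBr nrmZ; apply: le_lt_trans h.
by have := nrm_ge0 (u n - l); nra.
Qed.

Lemma tendsN (V : normedModType K) (u : nat -> V) l :
  tends u l -> tends (fun n => - u n) (- l).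
Proof.
by move=> ul e /ul[N hN]; exists N => n /hN; rewrite -opprD nrmN.
Qed.

Lemma tends_cauchy (V : completeNormedModType K) (u : nat -> V) :
  (forall e : R, 0 < e -> exists N, forall n m, (N <= n)%N -> (N <= m)%N ->
    nrm (u n - u m) < e) ->
  exists l, tends u l.
Proof.
move=> h; have : cauchy (u @ \oo).
  apply/cauchy_exP => e e0.
  have e1 : 0 < re S e by rewrite -emb_gt0 emb_nonneg ?ltW.
  have [N hN] := h (re S e) e1; exists (u N); exists N => // n /= Nn.
  rewrite -ball_normE /ball_ /= -(emb_nonneg (ltW e0)) norm_ltE.
  by apply: hN.
by move=> /cauchy_cvg/cvg_ex[l /tendsP ul]; exists l.
Qed.
End Nrm.

(** * The Hahn-Banach theorem *)

Section HahnBanach.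
Variables (R : realType) (K : numFieldType) (S : scalars R K).
Variable V : normedModType K.
Local Notation nrm := (nrm S).
Local Notation emb := (emb S).

Section Real.
Variables (C : R) (C0 : 0 <= C).

(** A partially defined real-linear functional is represented by its graph. The
    bound makes the graph functional: a value taken at 0 is at most 0, and so
    is its opposite. *)
Definition dominated_graph (G : set (V * R)) : Prop :=
  (forall (t : R) p q, G p -> G q -> G (emb t *: p.1 + q.1, t * p.2 + q.2)) /\
  (forall p, G p -> p.2 <= C * nrm p.1).

(** The value at [x0] is the supremum of r - C |x - x0| over the points (x, r)
    of the graph. It is at most C |y + x0| - s for every (y, s) in the graph,
    since r + s <= C |x + y|. By homogeneity these two families of bounds are
    what domination requires at the points x + t x0 with t < 0 and t > 0. *)
Lemma dominated_graph_extend (G : set (V * R)) (x0 : V) :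
  G (0, 0) -> dominated_graph G ->
  exists G', [/\ dominated_graph G', G `<=` G' & exists r, G' (x0, r)].
Proof.
move=> G00 [Glin Gle].
pose E := [set p.2 - C * nrm (p.1 - x0) | p in G].
have E0 : E !=set0 by exists (0 - C * nrm (0 - x0)); exists (0, 0).
have Eub p q : G p -> G q -> p.2 - C * nrm (p.1 - x0) <= C * nrm (q.1 + x0) - q.2.
  move=> Gp Gq; have := Gle _ (Glin 1 _ _ Gp Gq) => /=; rewrite mul1r rmorph1 scale1r.
  have : C * nrm (p.1 + q.1) <= C * (nrm (p.1 - x0) + nrm (q.1 + x0)).
    apply: ler_wpM2l => //; apply: le_trans (nrmD _ _ _).
    by rewrite addrACA addNr addr0.
  rewrite mulrDr; lra.
have hE : has_sup E.
  split=> //; exists (C * nrm (0 + x0) - 0) => _ [p Gp <-].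
  exact: (Eub _ _ Gp G00).
pose a := sup E.
have alow p : G p -> p.2 - C * nrm (p.1 - x0) <= a.
  by move=> Gp; apply: sup_upper_bound => //; exists p.
have aup q : G q -> a <= C * nrm (q.1 + x0) - q.2.
  by move=> Gq; apply: ge_sup => // _ [p Gp <-]; exact: Eub.
have Gscale t p : G p -> G (emb t *: p.1, t * p.2).
  by move=> Gp; have := Glin t _ _ Gp G00; rewrite !addr0.
exists [set pt | exists2 p, G p & exists t, pt = (p.1 + emb t *: x0, p.2 + t * a)].
split; last 1 first.
- exists a; exists (0, 0) => //; exists 1.
  by rewrite rmorph1 scale1r mul1r !add0r.
- split.
    move=> t _ _ [p Gp [tp ->]] [q Gq [tq ->]] /=.
    exists (emb t *: p.1 + q.1, t * p.2 + q.2); first exact: Glin.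
    exists (t * tp + tq); rewrite /= rmorphD rmorphM; congr pair; last by ring.
    by rewrite scalerDr scalerDl scalerA -!addrA; congr (_ + _); rewrite addrCA.
  move=> _ [p Gp [t ->]] /=.
  have [t0|t0|->] := ltgtP t 0; last 1 first.
  + by rewrite mul0r rmorph0 scale0r !addr0; exact: Gle.
  + have := alow _ (Gscale (- t)^-1 _ Gp) => /=.
    have t1 : 0 < - t by lra.
    have -> : emb (- t)^-1 *: p.1 - x0 = emb (- t)^-1 *: (p.1 + emb t *: x0).
      rewrite scalerDr scalerA -rmorphM invrN mulNr mulVf ?lt_eqF// rmorphN1.
      by rewrite scaleN1r.
    rewrite nrmZr ger0_norm; last by rewrite invr_ge0 ltW.
    move=> /(ler_wpM2l (ltW t1)).
    set N := nrm _; have tV : - t * (- t)^-1 = 1 by rewrite divff ?gt_eqF.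
    have -> : - t * ((- t)^-1 * p.2 - C * ((- t)^-1 * N)) =
      (- t * (- t)^-1) * (p.2 - C * N) by ring.
    rewrite tV; lra.
  + have := aup _ (Gscale t^-1 _ Gp) => /=.
    have -> : emb t^-1 *: p.1 + x0 = emb t^-1 *: (p.1 + emb t *: x0).
      by rewrite scalerDr scalerA -rmorphM mulVf ?gt_eqF// rmorph1 scale1r.
    rewrite nrmZr ger0_norm; last by rewrite invr_ge0 ltW.
    move=> /(ler_wpM2l (ltW t0)).
    set N := nrm _; have tV : t * t^-1 = 1 by rewrite divff ?gt_eqF.
    have -> : t * (C * (t^-1 * N) - t^-1 * p.2) = (t * t^-1) * (C * N - p.2) by ring.
    rewrite tV; lra.
- by move=> p Gp; exists p => //; exists 0; rewrite rmorph0 scale0r mul0r !addr0; case: p Gp.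
Qed.

Lemma dominated_graph_total (G0 : set (V * R)) :
  G0 (0, 0) -> dominated_graph G0 ->
  exists G, [/\ dominated_graph G, G0 `<=` G & forall x, exists r, G (x, r)].
Proof.
move=> G00 gG0.
(* The empty graph is included as the union of the empty chain. *)
pose P (G : set (V * R)) := G = set0 \/ G0 `<=` G /\ dominated_graph G.
have [|A [PA maxA]] := @Zorn_bigcup _ P.
  move=> F FP totF.
  have [[G FG G0G]|noG] := pselect (exists2 G, F G & G0 `<=` G).
    right; split; first by move=> p /G0G Gp; exists G.
    have gP X : F X -> X !=set0 -> dominated_graph X.
      by move=> /FP[->|[_ //]] [? []].
    split=> [t p q [X FX Xp] [Y FY Yq]|p [X FX Xp]].
      have [XY|YX] := totF _ _ FX FY.
        by exists Y => //; apply: (gP Y FY _).1 => //; [exists q|exact: XY].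
      by exists X => //; apply: (gP X FX _).1 => //; [exists p|exact: YX].
    by apply: (gP X FX _).2 => //; exists p.
  left; apply/seteqP; split=> // p [X FX Xp].
  have [X0|[G0X _]] := FP _ FX; first by rewrite X0 in Xp.
  by case: noG; exists X.
have [A0|[G0A gA]] := PA.
  exfalso; apply: (maxA G0); last by right; split.
  by rewrite A0; split=> [x //|h]; exact: (h _ G00).
exists A; split=> // x0; apply: contrapT => nx0.
have [G' [gG' AG' [r G'r]]] := dominated_graph_extend x0 (G0A _ G00) gA.
apply: (maxA G').
  by split=> [//|h]; apply: nx0; exists r; exact: h.
by right; split=> // p /G0A/AG'.
Qed.

End Real.

Lemma phase (a : K) : exists2 c : K, nrm c = 1 & c * a = emb (nrm a).
Proof.
have [->|a0] := eqVneq a 0.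
  by exists 1; rewrite ?nrm1// mulr0 nrm0 rmorph0.
exists (emb (nrm a) / a); last by rewrite divfK.
have na : nrm a != 0 by rewrite gt_eqF// nrm_gt0.
apply: (mulIf na); rewrite mul1r -[X in _ * X]/(nrm a) -nrmM divfK// nrm_emb.
by rewrite ger0_norm// nrm_ge0.
Qed.

(** The real part of [f] extends to a dominated real functional [g], and
    g x - J g (J x) is then K-linear with real part [g]. Its bound at [x] is
    the bound of [g] at the rotation of [x] which makes the value a nonnegative
    real number. *)
Theorem hahn_banach (M : set V) (f : V -> K) (C : R) : 0 <= C -> M 0 ->
  (forall a u v, M u -> M v -> M (a *: u + v)) ->
  (forall a u v, M u -> M v -> f (a *: u + v) = a * f u + f v) ->
  (forall x, M x -> nrm (f x) <= C * nrm x) ->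
  exists F : V -> K^o,
    [/\ linear F, forall x, nrm (F x) <= C * nrm x & forall x, M x -> F x = f x].
Proof.
move=> C0 M0 ML fL fC.
have reD u v : re S (u + v) = re S u + re S v.
  rewrite {1}(scal_decomp S u) {1}(scal_decomp S v).
  by rewrite addrACA -mulrDr -!rmorphD re_emb.
have reZ t u : re S (emb t * u) = t * re S u.
  by rewrite {1}(scal_decomp S u) mulrDr mulrCA -!rmorphM re_emb.
have re_nrm u : re S u <= nrm u.
  exact: le_trans (ler_norm _) (re_le S u).
have f0 : f 0 = 0.
  by have := fL 1 0 0 M0 M0; rewrite scale1r addr0 mul1r => h; apply: (addrI (f 0)); rewrite -h addr0.
have fZ a u : M u -> f (a *: u) = a * f u.
  by move=> Mu; have := fL a u 0 Mu M0; rewrite f0 !addr0.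
pose G0 := [set (x, re S (f x)) | x in M].
have [||G [[Glin Gle] G0G Gtot]] := @dominated_graph_total C C0 G0.
- by exists 0 => //; rewrite f0 -[X in re _ X](rmorph0 emb) re_embK.
- split=> [t _ _ [x Mx <-] [y My <-]|_ [x Mx <-]] /=.
    by exists (emb t *: x + y); [exact: ML|rewrite fL// reD reZ].
  exact: le_trans (re_nrm _) (fC _ Mx).
have [g gP] := choice Gtot.
have guniq x r : G (x, r) -> r = g x.
  have le s s' : G (x, s) -> G (x, s') -> s <= s'.
    move=> Gs Gs'; have := Gle _ (Glin (-1) _ _ Gs' Gs) => /=.
    by rewrite rmorphN1 scaleN1r addNr nrm0 mulr0 mulN1r addrC subr_le0.
  by move=> Gr; apply/eqP; rewrite eq_le !le.
have glin t x y : g (emb t *: x + y) = t * g x + g y.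
  by apply/esym/guniq; exact: (Glin t _ _ (gP x) (gP y)).
have gD x y : g (x + y) = g x + g y.
  by have := glin 1 x y; rewrite rmorph1 scale1r mul1r.
have g0 : g 0 = 0 by apply: (addrI (g 0)); rewrite -gD !addr0.
have gZ t x : g (emb t *: x) = t * g x.
  by have := glin t x 0; rewrite g0 !addr0.
have gM x : M x -> g x = re S (f x) by move=> Mx; apply/esym/guniq/G0G; exists x.
pose F x := emb (g x) - J S * emb (g (J S *: x)).
have reF x : re S (F x) = g x by rewrite /F -mulrN -rmorphN re_emb.
have FD x y : F (x + y) = F x + F y.
  by rewrite /F scalerDr !gD !rmorphD mulrDr opprD addrACA.
have FR t x : F (emb t *: x) = emb t * F x.
  have JE : J S *: (emb t *: x) = emb t *: (J S *: x) by rewrite !scalerA mulrC.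
  by rewrite /F JE !gZ !rmorphM mulrBr mulrCA.
have FZ a x : F (a *: x) = a * F x.
  rewrite (scal_decomp S a) scalerDl FD FR -scalerA mulrDl; congr (_ + _).
  have [JJ|J0] := J_case S; last by rewrite J0 !mul0r scale0r /F scaler0 g0 rmorph0 mulr0 subrr.
  rewrite (_ : J S *: _ = emb (im S a) *: (J S *: x)); last by rewrite !scalerA mulrC.
  rewrite FR -mulrA mulrCA; congr (_ * _).
  rewrite /F scalerA JJ scaleN1r -[- x]scaleN1r -(rmorphN1 emb) gZ mulN1r rmorphN.
  by rewrite mulrN opprK mulrBr mulrA JJ mulN1r opprK addrC.
exists F; split.
- by move=> a x y; rewrite FD FZ.
- move=> x; have [c c1 cF] := phase (F x).
  have gle y : g y <= C * nrm y by exact: (Gle _ (gP y)).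
  have := gle (c *: x); rewrite nrmZ c1 mul1r; apply: le_trans.
  by rewrite -reF FZ cF re_embK.
- move=> x Mx; rewrite /F gM//.
  have [JJ|J0] := J_case S; last first.
    by rewrite [RHS](scal_decomp S) J0 !mul0r subr0 addr0.
  have MJ : M (J S *: x) by have := ML (J S) x 0 Mx M0; rewrite addr0.
  rewrite gM// fZ// [in RHS](scal_decomp S (f x)); congr (_ + _).
  rewrite -mulrN -rmorphN; congr (_ * emb _).
  rewrite {1}(scal_decomp S (f x)) mulrDr mulrA JJ mulN1r addrC -rmorphN.
  by rewrite re_emb opprK.
Qed.
End HahnBanach.

(** * Uniform boundedness *)

Section UniformBoundedness.
Variables (R : realType) (K : numFieldType) (S : scalars R K).
Local Notation nrm := (nrm S).
Local Notation emb := (emb S).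

Lemma half_pow_small (c e : R) : 0 < e -> exists N, forall n, (N <= n)%N -> c * 2^-1 ^+ n < e.
Proof.
move=> e0; have h : `|2^-1 : R| < 1 by rewrite ger0_norm ?invr_ge0// invf_lt1 ?ltr1n.
have c1 : 0 < `|c| + 1 by have := normr_ge0 c; lra.
have /cvgrPdist_lt/(_ _ (divr_gt0 e0 c1))[N _ hN] := cvg_expr h.
exists N => n /hN; rewrite sub0r normrN ger0_norm ?exprn_ge0// ltr_pdivlMr//.
have := ler_norm c; have : 0 < (2^-1 : R) ^+ n by rewrite exprn_gt0 ?invr_gt0.
by move=> *; nra.
Qed.

(** The radius at least halves at every step, so the steps after the k-th move
    the centre by at most [2 * r k] in total. *)
Lemma nested_balls (V : completeNormedModType K) (x : nat -> V) (r : nat -> R) :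
  (forall k, 0 < r k) -> (forall k, nrm (x k.+1 - x k) <= r k) ->
  (forall k, 2 * r k.+1 <= r k) ->
  exists l, forall k, nrm (l - x k) <= 2 * r k.
Proof.
move=> r0 xr rr.
have nest d : forall k, nrm (x (k + d)%N - x k) <= 2 * r k.
  elim: d => [|d IH] k; first by rewrite addn0 subrr nrm0; have := r0 k; lra.
  have := IH k.+1; rewrite addSnnS; have := xr k; have := rr k.
  have := nrm_dist S (x (k + d.+1)%N) (x k.+1) (x k); lra.
have rpow k : r k <= r 0%N * 2^-1 ^+ k.
  elim: k => [|k IH]; first by rewrite expr0 mulr1.
  by rewrite exprS; have := rr k; lra.
have [e e0|l xl] := @tends_cauchy R K S V x.
  have [N hN] := half_pow_small (4 * r 0%N) e0; exists N => n m Nn Nm.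
  have hNN := hN N (leqnn _); have := rpow N.
  have := nest (n - N)%N N; have := nest (m - N)%N N; rewrite !subnKC//.
  have := nrm_dist S (x n) (x N) (x m); rewrite (nrm_distC S (x N)); lra.
exists l => k; apply: (@tends_le R K S V (fun n => x (k + n)%N - x k)).
  move=> e /xl[N hN]; exists N => n Nn.
  have -> : x (k + n)%N - x k - (l - x k) = x (k + n)%N - l.
    by rewrite opprB addrA subrK.
  by apply: hN; apply: leq_trans (leq_addl _ _).
by move=> n; exact: nest.
Qed.

(** Gliding hump. For an unbounded sequence there are nested balls such that
    some [T n] has norm at least [k] all over the k-th ball; a point common to
    the balls violates the pointwise bound. The next centre is found at [x + u]
    or [x - u] for a short vector [u] with a large image, because the images of
    these two points differ by [2 T u]. *)
Lemma uniform_boundedness (V : completeNormedModType K) (W : normedModType K)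
    (T : nat -> V -> W) :
  (forall n, bounded_operator (T n)) ->
  (forall x, exists C, forall n, nrm (T n x) <= C) ->
  exists2 M : R, 0 <= M & forall n x, nrm (T n x) <= M * nrm x.
Proof.
move=> bT pT; apply: contrapT => nbd.
have unb M : exists n y, M * nrm y < nrm (T n y).
  apply: contrapT => h; apply: nbd; exists (Num.max M 0).
    by rewrite le_max lexx orbT.
  move=> n x; rewrite leNgt; apply/negP => hx; apply: h.
  exists n, x; apply: le_lt_trans hx.
  by apply: ler_wpM2r; rewrite ?nrm_ge0// le_max lexx.
have step k (x : V) (r : R) : 0 < r -> exists p : V * R,
    [/\ 0 < p.2, nrm (p.1 - x) <= r, 2 * p.2 <= r &
      exists n, forall z, nrm (z - p.1) <= 2 * p.2 -> k%:R <= nrm (T n z)].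
  move=> r0; have [n [y hy]] := unb ((k%:R + 1) / r).
  have /(bounded_operatorP S)[lT [B B0 hB]] := bT n.
  have ny : nrm y != 0.
    apply/eqP => ny0; move: hy; rewrite ny0 mulr0 (nrm_eq0 ny0) lin0// nrm0.
    by rewrite ltxx.
  have nyp : 0 < nrm y by rewrite lt_def ny nrm_ge0.
  pose u := emb (r / nrm y) *: y.
  have nu : nrm u = r.
    by rewrite nrmZr ger0_norm ?divfK// divr_ge0 ?ltW.
  have nTu : k%:R + 1 <= nrm (T n u).
    rewrite linZ// nrmZr ger0_norm; last by rewrite divr_ge0 ?ltW.
    move: hy; rewrite mulrAC ltr_pdivrMr// => /ltW hy.
    by rewrite mulrAC ler_pdivlMr// mulrC [r * _]mulrC mulrC.
  have [x' xx' Tx'] : exists2 x', nrm (x' - x) <= r & k%:R + 1 <= nrm (T n x').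
    have h2 : 2 * nrm (T n u) <= nrm (T n (x + u)) + nrm (T n (x - u)).
      have -> : 2 * nrm (T n u) = nrm (T n (x + u) - T n (x - u)).
        have -> : T n (x + u) - T n (x - u) = 2%:R *: T n u.
          by rewrite -linB// opprB addrC addrA subrK scaler_nat mulr2n linD.
        by rewrite nrmZ -(rmorph_nat emb) nrm_emb ger0_norm.
      exact: nrmB.
    have [h|h] := lerP (k%:R + 1) (nrm (T n (x + u))).
      by exists (x + u) => //; rewrite addrC addKr nu.
    exists (x - u); last by lra.
    by rewrite addrC addKr nrmN nu.
  have B1 : 0 < 2 * (B + 1) by lra.
  (* Within distance 1 / (B + 1) of x' the images under T n differ by at most 1. *)
  exists (x', Num.min (r / 2) (2 * (B + 1))^-1); split => //=.
  - by rewrite lt_min divr_gt0//= invr_gt0.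
  - have := ge_min (r / 2) (r / 2) (2 * (B + 1))^-1; rewrite lexx /=; lra.
  exists n => z hz.
  have : nrm (z - x') <= 2 * (2 * (B + 1))^-1.
    apply: le_trans hz _; rewrite ler_pM2l// ge_min lexx orbT//.
  rewrite invfM mulrA divff// mul1r => {}hz.
  have : nrm (T n (z - x')) <= 1.
    apply: le_trans (hB _) _.
    have : nrm (z - x') * (B + 1) <= 1.
      by rewrite -ler_pdivlMr ?mul1r//; lra.
    have := nrm_ge0 S (z - x'); nra.
  rewrite linB//; have := nrm_subl S (T n x') (T n z); rewrite nrm_distC; lra.
pose St := {p : V * R | 0 < p.2}.
have step' k (s : St) : exists s' : St,
    [/\ nrm ((sval s').1 - (sval s).1) <= (sval s).2, 2 * (sval s').2 <= (sval s).2 &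
      exists n, forall z, nrm (z - (sval s').1) <= 2 * (sval s').2 -> k%:R <= nrm (T n z)].
  by have [p [p0 h1 h2 h3]] := step k (sval s).1 (sval s).2 (svalP s); exists (exist _ p p0).
have [g gP] := choice (fun ks : nat * St => step' ks.1 ks.2).
pose s := fix s k := if k is k'.+1 then g (k', s k') else exist (fun p : V * R => 0 < p.2) (0, 1) ltr01.
have sP k := gP (k, s k).
have [||| l hl] := @nested_balls V (fun k => (sval (s k)).1) (fun k => (sval (s k)).2).
- by move=> k; case: (s k).
- by move=> k; case: (sP k).
- by move=> k; case: (sP k).
have [C hC] := pT l.
have [_ _ [n hn]] := sP (Num.bound `|C|).
have := hn l (hl (Num.bound `|C|).+1); have := hC n; have := archi_boundP (normr_ge0 C); have := ler_norm C.
rewrite /=; lra.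
Qed.

End UniformBoundedness.

(** * Compact approximation *)

Section Compactness.
Variables (R : realType) (K : numFieldType) (S : scalars R K).
Local Notation nrm := (nrm S).

Definition totally_bounded_map (V : normedModType K) (f : V -> V) : Prop :=
  forall e : R, 0 < e -> exists D : seq V,
    forall x, nrm x <= 1 -> exists2 d, d \in D & nrm (f x - d) < e.

Lemma compact_totally_bounded (V : completeNormedModType K) (f : V -> V) :
  compact_operator f -> totally_bounded_map f.
Proof.
move=> [lf]; rewrite precompactE => + e e0.
rewrite compact_cover => /(_ _ setT (fun d : V => [set y | nrm (y - d) < e])).
case=> [d _|y _|D _ hD].
- rewrite openE => y /= yd; apply/(nbhs_nrm S); exists (e - nrm (y - d)); first by rewrite subr_gt0.
  move=> z yz /=; have := nrm_dist S z y d; rewrite nrm_distC in yz; lra.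
- by exists y => //=; rewrite subrr nrm0.
exists (finmap.enum_fset D) => x x1.
have /hD[d /= dD xd] : closure (f @` [set x | `|x| <= 1]) (f x).
  by apply: subset_closure; exists x => //=; rewrite (norm_le1 S).
by exists d.
Qed.

(** The bounded compact approximation property is negated along sequences: the
    approximations to be excluded come from averages over times that tend
    to 0. *)
Definition fails_bcap (V : normedModType K) : Prop :=
  ~ exists (T : nat -> V -> V) (M : R),
    [/\ forall n, linear (T n), forall n x, nrm (T n x) <= M * nrm x,
        forall n, totally_bounded_map (T n)
      & forall x, tends S (fun n => T n x) x].

End Compactness.

(** * Averages of a semigroup *)

Section Means.
Variables (R : realType) (K : numFieldType) (S : scalars R K).
Local Notation nrm := (nrm S).
Local Notation emb := (emb S).
Variable V : completeNormedModType K.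

(** Integrals over a time interval enter as limits of Riemann sums on dyadic
    grids; as these grids are nested, refining them is the exact identity
    [mean_mean]. *)
Definition dyadic_mean (n : nat) (v : nat -> V) : V :=
  emb (2^-1 ^+ n) *: \sum_(0 <= i < 2 ^ n) v i.

Lemma mean_le n v (e : R) : (forall i, (i < 2 ^ n)%N -> nrm (v i) <= e) ->
  nrm (dyadic_mean n v) <= e.
Proof.
move=> h; rewrite /dyadic_mean nrmZr ger0_norm ?exprn_ge0// exprVn.
rewrite mulrC ler_pdivrMr ?exprn_gt0//.
apply: le_trans (nrm_sum _ _ _ _) _.
rewrite big_seq; apply: (@le_trans _ _ (\sum_(i <- index_iota 0 (2 ^ n) | i \in index_iota 0 (2 ^ n)) e)).
  by apply: ler_sum => i; rewrite mem_index_iota => /h.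
by rewrite -big_seq big_const_nat subn0 iter_addr_0 -[leLHS]mulr_natr natrX.
Qed.

Lemma meanB n u v : dyadic_mean n u - dyadic_mean n v = dyadic_mean n (fun i => u i - v i).
Proof. by rewrite /dyadic_mean sumrB scalerBr. Qed.

Lemma mean_const n x : dyadic_mean n (fun=> x) = x.
Proof.
rewrite /dyadic_mean big_const_nat subn0 iter_addr_0 -[X in _ *: X]scaler_nat scalerA.
rewrite natrX -(rmorph_nat emb) -rmorphXn -rmorphM -exprMn mulVf ?pnatr_eq0//.
by rewrite expr1n rmorph1 scale1r.
Qed.

Lemma mean_mean n l (v : nat -> V) :
  dyadic_mean (n + l) v = dyadic_mean n (fun i => dyadic_mean l (fun r => v (i * 2 ^ l + r)%N)).
Proof.
rewrite /dyadic_mean expnD exprD rmorphM -scalerA -scaler_sumr; congr (_ *: (_ *: _)).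
rewrite big_nat_mul; apply: eq_bigr => i _.
rewrite -{1}[(i * _)%N]add0n big_addn mulSn addnK.
by apply: eq_bigr => j _; rewrite addnC.
Qed.

End Means.

Section Averages.
Variables (R : realType) (K : numFieldType) (S : scalars R K).
Local Notation nrm := (nrm S).
Local Notation emb := (emb S).
Local Notation mean := (dyadic_mean S).
Variable V : completeNormedModType K.
Variable T : R -> V -> V.
Hypothesis T_C0 : C0_semigroup T.

Let T_bounded t : 0 <= t -> bounded_operator (T t).
Proof. by case: T_C0 => h _ _ _; exact: h. Qed.

Let T_lin t : 0 <= t -> linear (T t).
Proof. by move=> /T_bounded[]. Qed.

Let T0 x : T 0 x = x.
Proof. by case: T_C0. Qed.

Let TD t s x : 0 <= t -> 0 <= s -> T (t + s) x = T t (T s x).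
Proof. by case: T_C0 => _ _ h _ *; exact: h. Qed.

Lemma C0_at0 x (e : R) : 0 < e ->
  exists2 d : R, 0 < d & forall t, 0 <= t -> t < d -> nrm (T t x - x) < e.
Proof.
move=> e0; case: T_C0 => _ _ _ /(_ x) h.
have : nbhs x [set y | nrm (y - x) < e].
  by apply/(nbhs_nrm S); exists e => // y; rewrite nrm_distC.
move=> /h [d /= d0 hd]; exists d => // t t0 td.
have [->|tn0] := eqVneq t 0; first by rewrite T0 subrr nrm0.
apply: hd => /=; last by rewrite lt_def tn0.
by rewrite sub0r normrN ger0_norm.
Qed.

(** Otherwise there are times t_n tending to 0 with |T(t_n)| > n. But T(t_n) x
    tends to x for every x, so uniform boundedness is violated. *)
Lemma C0_locally_bounded : exists d M : R,
  [/\ 0 < d, 0 <= M & forall t x, 0 <= t -> t <= d -> nrm (T t x) <= M * nrm x].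
Proof.
apply: contrapT => h.
have bad n : exists t, [/\ 0 <= t, t <= n.+1%:R^-1 &
    exists x, n%:R * nrm x < nrm (T t x)].
  apply: contrapT => hn; apply: h; exists n.+1%:R^-1, n%:R.
  rewrite invr_gt0 ltr0n ler0n; split=> // t x t0 tn; rewrite leNgt; apply/negP => hx.
  by apply: hn; exists t; split=> //; exists x.
have [t tP] := choice bad.
have t0 n : 0 <= t n by case: (tP n).
have tb n : t n <= n.+1%:R^-1 by case: (tP n).
have [|x|M M0 hM] := @uniform_boundedness R K S V V (fun n => T (t n)).
- by move=> n; exact: T_bounded.
- have [d d0 hd] := C0_at0 x (@ltr01 R).
  pose N := Num.bound d^-1.
  have hN n : (N <= n)%N -> nrm (T (t n) x) <= nrm x + 1.
    move=> Nn; have /hd : t n < d.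
      apply: le_lt_trans (tb n) _; rewrite invf_plt ?posrE//.
      have := archi_boundP (ltW (_ : 0 < d^-1)); rewrite invr_gt0 => /(_ d0) h1.
      by apply: lt_le_trans h1 _; rewrite ler_nat; exact: leqW.
    by move=> /(_ (t0 n)); have := nrm_subl S (T (t n) x) x; lra.
  exists (nrm x + 1 + \sum_(i < N) nrm (T (t i) x)) => n.
  have s0 : 0 <= \sum_(i < N) nrm (T (t i) x) by apply: sumr_ge0 => i _; exact: nrm_ge0.
  have [/hN|nN] := leqP N n; first by lra.
  rewrite (bigD1 (Ordinal nN))//=.
  have : 0 <= \sum_(i < N | i != Ordinal nN) nrm (T (t i) x).
    by apply: sumr_ge0 => i _; exact: nrm_ge0.
  by have := nrm_ge0 S x; lra.
have [_ _ [x]] := tP (Num.bound M).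
have := hM (Num.bound M) x; have := archi_boundP M0; have := nrm_ge0 S x; nra.
Qed.

Section Bounded.
Variables (d M : R).
Hypothesis (d0 : 0 < d) (M0 : 0 <= M).
Hypothesis TM : forall t x, 0 <= t -> t <= d -> nrm (T t x) <= M * nrm x.

(** A Riemann sum for (1/h) times the integral of T(s) x over [0, h]. *)
Definition average (h : R) (n : nat) (x : V) : V :=
  mean n (fun i => T (i%:R * (h * 2^-1 ^+ n)) x).

Lemma grid_le (h : R) n i : 0 <= h -> (i <= 2 ^ n)%N ->
  0 <= i%:R * (h * 2^-1 ^+ n) <= h.
Proof.
move=> h0 i2; have p0 : 0 < (2^-1 : R) ^+ n by rewrite exprn_gt0 ?invr_gt0.
apply/andP; split; first by rewrite !mulr_ge0// ltW.
rewrite mulrCA -[leRHS]mulr1 ler_wpM2l//.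
by rewrite exprVn ler_pdivrMr ?exprn_gt0// mul1r -natrX ler_nat.
Qed.

Lemma average_near h n x (e : R) : 0 <= h ->
  (forall t, 0 <= t -> t <= h -> nrm (T t x - x) <= e) ->
  nrm (average h n x - x) <= e.
Proof.
move=> h0 he; rewrite -{2}(mean_const S n x) meanB; apply: mean_le => i i2.
by have /andP[] := grid_le h0 (ltnW i2); exact: he.
Qed.

Lemma average_le h n x : 0 <= h <= d -> nrm (average h n x) <= M * nrm x.
Proof.
move=> /andP[h0 hd]; apply: mean_le => i i2.
by have /andP[ti th] := grid_le h0 (ltnW i2); apply: TM => //; exact: le_trans hd.
Qed.

Lemma average_lin h n : 0 <= h -> linear (average h n).
Proof.
move=> h0 a x y; rewrite /average /dyadic_mean.
rewrite scalerA [a * _]mulrC -scalerA -scalerDr; congr (_ *: _).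
rewrite scaler_sumr -big_split/=; apply: eq_bigr => i _.
have ti : 0 <= i%:R * (h * 2^-1 ^+ n) by rewrite !mulr_ge0// exprn_ge0.
exact: (T_lin ti).
Qed.

(** The averages over the short time h / 2^n, which occur inside, are close to
    [x] when n is large; hence all refinements of a fine grid give nearby
    values and the averages form a Cauchy sequence. *)
Lemma average_split h n l x : 0 <= h ->
  average h (n + l) x =
  mean n (fun i => T (i%:R * (h * 2^-1 ^+ n)) (average (h * 2^-1 ^+ n) l x)).
Proof.
move=> h0; rewrite /average mean_mean; congr (dyadic_mean S n _); apply/funext => i.
have p0 k : 0 <= (2^-1 : R) ^+ k by rewrite exprn_ge0.
have ti : 0 <= i%:R * (h * 2^-1 ^+ n) by rewrite !mulr_ge0.
rewrite /dyadic_mean (linZ (T_lin ti)) (lin_sum (T_lin ti)); congr (_ *: _).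
apply: eq_bigr => r _; rewrite -TD//; last by rewrite !mulr_ge0.
congr (T _ x); rewrite natrD natrM natrX mulrDl exprD; congr (_ + _); last by ring.
rewrite -!mulrA; congr (_ * _); rewrite mulrCA; congr (_ * _).
by rewrite mulrCA -exprMn divff ?expr1n ?mulr1// pnatr_eq0.
Qed.

Lemma average_cauchy h x : 0 <= h <= d -> exists l, tends S (fun n => average h n x) l.
Proof.
move=> /andP[h0 hd]; apply: tends_cauchy => e e0.
have e1 : 0 < e / (4 * (M + 1)) by rewrite divr_gt0// mulr_gt0// ltr_wpDl.
have [s s0 hs] := C0_at0 x e1.
have [N hN] := half_pow_small h s0.
have key l : nrm (average h (N + l) x - average h N x) <= e / 4.
  rewrite average_split// /average meanB; apply: mean_le => i i2.
  have /andP[ti th] := grid_le h0 (ltnW i2).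
  rewrite -(linB (T_lin ti)); apply: le_trans (TM _ ti (le_trans th hd)) _.
  have : nrm (average (h * 2^-1 ^+ N) l x - x) <= e / (4 * (M + 1)).
    apply: average_near; first by rewrite mulr_ge0// exprn_ge0.
    by move=> t t0 tN; apply/ltW/hs => //; apply: le_lt_trans tN (hN N _).
  rewrite ler_pdivlMr; last by rewrite mulr_gt0// ltr_wpDl.
  have := nrm_ge0 S (average (h * 2^-1 ^+ N) l x - x); lra.
exists N => n m Nn Nm.
have := key (n - N)%N; have := key (m - N)%N; rewrite !subnKC//.
have := nrm_dist S (average h n x) (average h N x) (average h m x).
rewrite (nrm_distC S (average h N x)); lra.
Qed.

Lemma average_limit h : 0 < h <= d ->
  exists A : V -> V, forall x, tends S (fun n => average h n x) (A x).
Proof.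
move=> /andP[h0 hd]; have h0d : 0 <= h <= d by rewrite (ltW h0).
by have /choice[A hA] := fun x => average_cauchy x h0d; exists A.
Qed.

Section Limit.
Variables (h : R) (A : V -> V).
Hypothesis h0 : 0 < h.
Hypothesis hd : 2 * h <= d.
Hypothesis AP : forall x, tends S (fun n => average h n x) (A x).

Lemma limit_lin : linear A.
Proof.
move=> a x y; apply: (tends_unique (AP _)).
have := tendsD (tendsZ a (AP x)) (AP y).
congr (tends S); apply/funext => n.
by rewrite (average_lin n (ltW h0)).
Qed.

Lemma limit_le x : nrm (A x) <= M * nrm x.
Proof. by apply: (tends_le (AP x)) => n; apply: average_le; apply/andP; split; move: h0 hd; lra. Qed.

Lemma limit_near x (e : R) :
  (forall t, 0 <= t -> t <= h -> nrm (T t x - x) <= e) -> nrm (A x - x) <= e.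
Proof.
move=> he; apply: (@tends_le R K S V (fun n => average h n x - x)).
  move=> e' /(AP x)[N hN]; exists N => n Nn.
  by rewrite opprB addrA subrK; exact: hN.
by move=> n; apply: average_near => //; exact: ltW.
Qed.

(** The shift by i steps of the grid telescopes: only [2 * i] of the terms do
    not cancel. *)
Lemma average_shift n i x : (i <= 2 ^ n)%N ->
  nrm (T (i%:R * (h * 2^-1 ^+ n)) (average h n x) - average h n x) <=
  2 * M * (i%:R * 2^-1 ^+ n) * nrm x.
Proof.
move=> i2; have /andP[ti th] := grid_le (ltW h0) i2.
pose s k := T (k%:R * (h * 2^-1 ^+ n)) x.
have p0 : 0 <= (2^-1 : R) ^+ n by rewrite exprn_ge0.
have sM k : (k < 2 ^ n + i)%N -> nrm (s k) <= M * nrm x.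
  move=> ki; apply: TM; first by rewrite !mulr_ge0// ltW.
  apply: le_trans hd; have [k2|k2] := leqP k (2 ^ n).
    by have /andP[_] := grid_le (ltW h0) k2; lra.
  have ik : (k - 2 ^ n <= 2 ^ n)%N by rewrite leq_subLR; apply: leq_trans (ltnW ki) _; rewrite leq_add2l.
  have /andP[_] := grid_le (ltW h0) ik.
  have /andP[_] := grid_le (ltW h0) (leqnn (2 ^ n)).
  by rewrite natrB ?mulrBl; [lra|exact: ltnW].
rewrite /average /dyadic_mean (linZ (T_lin ti)) (lin_sum (T_lin ti)) -scalerBr.
have -> : \sum_(0 <= k < 2 ^ n) T (i%:R * (h * 2^-1 ^+ n)) (T (k%:R * (h * 2^-1 ^+ n)) x) =
    \sum_(i <= k < i + 2 ^ n) s k.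
  have -> : \sum_(i <= k < i + 2 ^ n) s k = \sum_(0 <= k < 2 ^ n) s (k + i)%N.
    by rewrite -{1}(add0n i) big_addn addKn.
  apply: eq_bigr => k _.
  rewrite -TD//; last by rewrite !mulr_ge0// ltW.
  by rewrite /s natrD addrC mulrDl.
have -> : \sum_(i <= k < i + 2 ^ n) s k - \sum_(0 <= k < 2 ^ n) s k =
    \sum_(2 ^ n <= k < 2 ^ n + i) s k - \sum_(0 <= k < i) s k.
  rewrite (@big_cat_nat _ _ _ (2 ^ n) i) ?leq_addl//=.
  rewrite (@big_cat_nat _ _ _ i 0 (2 ^ n))//= (addnC i).
  by rewrite opprD [- _ - _]addrC addrACA subrr add0r.
rewrite nrmZr ger0_norm//.
have sum_le a b : (b <= 2 ^ n + i)%N -> nrm (\sum_(a <= k < b) s k) <= (b - a)%:R * (M * nrm x).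
  move=> bi; apply: le_trans (nrm_sum _ _ _ _) _.
  rewrite big_nat_cond; apply: (@le_trans _ _ (\sum_(a <= k < b | (a <= k < b)%N && true) (M * nrm x))).
    by apply: ler_sum => k /andP[/andP[_ kb] _]; apply: sM; apply: leq_trans bi.
  by rewrite -big_nat_cond big_const_nat iter_addr_0 -[leLHS]mulr_natl.
have := nrmB S (\sum_(2 ^ n <= k < 2 ^ n + i) s k) (\sum_(0 <= k < i) s k).
have := sum_le (2 ^ n)%N _ (leqnn _); have := sum_le 0%N i (leq_addl _ _).
rewrite addKn subn0 => h1 h2 h3.
have -> : 2 * M * (i%:R * 2^-1 ^+ n) * nrm x = 2^-1 ^+ n * (i%:R * (M * nrm x) + i%:R * (M * nrm x)) by ring.
apply: ler_wpM2l => //; lra.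
Qed.

(** The time considered belongs to all finer grids, and [average_shift] gives
    the same bound on each of them. *)
Lemma limit_shift_grid n i x : (i <= 2 ^ n)%N ->
  nrm (T (i%:R * (h * 2^-1 ^+ n)) (A x) - A x) <=
  2 * M * (i%:R * 2^-1 ^+ n) * nrm x.
Proof.
move=> i2; have /andP[ti th] := grid_le (ltW h0) i2.
apply: (@tends_le R K S V (fun l => T (i%:R * (h * 2^-1 ^+ n)) (average h (n + l) x) - average h (n + l) x)).
  have AP' : tends S (fun l => average h (n + l) x) (A x).
    move=> e /(AP x)[N hN]; exists N => l Nl; apply: hN.
    exact: leq_trans (leq_addl _ _).
  exact: (tendsD (tends_lin (T_bounded ti) AP') (tendsN AP')).
move=> l; have /(average_shift x) : (i * 2 ^ l <= 2 ^ (n + l))%N by rewrite expnD leq_mul2r i2 orbT.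
have -> : (i * 2 ^ l)%:R * (2^-1 : R) ^+ (n + l) = i%:R * 2^-1 ^+ n.
  rewrite natrM natrX exprD mulrACA -exprMn divff ?pnatr_eq0//.
  by rewrite expr1n mulr1.
have -> // : (i * 2 ^ l)%:R * (h * (2^-1 : R) ^+ (n + l)) = i%:R * (h * 2^-1 ^+ n).
rewrite natrM natrX exprD.
have -> : forall a b c e f : R, a * b * (c * (e * f)) = a * (c * e) * (b * f).
  by move=> *; ring.
by rewrite -exprMn divff ?pnatr_eq0// expr1n mulr1.
Qed.

(** Follows from grid times decreasing to [t], by strong continuity. *)
Lemma limit_shift t x : 0 <= t -> t < h ->
  nrm (T t (A x) - A x) <= 2 * M * (t / h) * nrm x.
Proof.
move=> t0 th.
(* The index of the first grid time after t. *)
pose i n := (Num.truncn (t / h * 2 ^+ n)).+1.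
have h2 n : 0 < (2 : R) ^+ n by rewrite exprn_gt0.
have th0 : 0 <= t / h by rewrite divr_ge0// ltW.
have iP n : (i n).-1%:R <= t / h * 2 ^+ n < (i n)%:R.
  by rewrite truncn_itv// mulr_ge0// ltW.
have i2 n : (i n <= 2 ^ n)%N.
  have th1 : t / h < 1 by rewrite ltr_pdivrMr// mul1r.
  rewrite /i truncn_lt_nat; last by rewrite mulr_ge0// ltW.
  by rewrite natrX gtr_pMl.
have V2 n : (2 : R) ^+ n * 2^-1 ^+ n = 1.
  by rewrite -exprMn divff ?pnatr_eq0// expr1n.
have p0 n : 0 < (2^-1 : R) ^+ n by rewrite exprn_gt0 ?invr_gt0.
pose r n : R := (i n)%:R * 2^-1 ^+ n.
have r1 n : t / h <= r n.
  have /andP[_ h1] := iP n; have := ltW h1; rewrite -(ler_pM2r (p0 n)).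
  by rewrite -(mulrA (t / h)) V2 mulr1.
have r2 n : r n <= t / h + 2^-1 ^+ n.
  have /andP[+ _] := iP n; rewrite -(ler_pM2r (p0 n)) -(mulrA (t / h)) V2 mulr1.
  have -> : r n = (i n).-1%:R * 2^-1 ^+ n + 2^-1 ^+ n.
    by rewrite -[X in _ = _ + X]mul1r -mulrDl natr1.
  by lra.
apply/ler_addgt0Pr => e e0.
have e2 : 0 < e / 2 by rewrite divr_gt0.
have [s s0 hs] := C0_at0 (T t (A x)) e2.
have [N1 hN1] := half_pow_small h s0.
have [N2 hN2] := half_pow_small (2 * M * nrm x) e2.
pose n := maxn N1 N2.
have {}hN1 := hN1 n (leq_maxl _ _); have {}hN2 := hN2 n (leq_maxr _ _).
have := limit_shift_grid x (i2 n).
rewrite (_ : (i n)%:R * (h * _) = t + (r n * h - t)); last by rewrite /r; ring.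
have rt : 0 <= r n * h - t by rewrite subr_ge0 -ler_pdivrMr.
have rs : r n * h - t < s.
  apply: le_lt_trans hN1; rewrite lerBlDr addrC -[X in X + _](divfK (lt0r_neq0 h0)).
  by rewrite [h * _]mulrC -mulrDl ler_pM2r.
rewrite (addrC t) TD// -/(r n) => h3.
have h4 := hs _ rt rs.
have := nrm_dist S (T t (A x)) (T (r n * h - t) (T t (A x))) (A x).
rewrite (nrm_distC S (T t (A x)) (T _ _)) => h5.
have : 2 * M * r n * nrm x <= 2 * M * (t / h + 2^-1 ^+ n) * nrm x.
  by rewrite ler_wpM2r ?nrm_ge0// ler_wpM2l// mulr_ge0.
have -> : 2 * M * (t / h + 2^-1 ^+ n) * nrm x =
  2 * M * (t / h) * nrm x + 2 * M * nrm x * 2^-1 ^+ n by ring.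
lra.
Qed.

End Limit.
End Bounded.
End Averages.

(** * A criterion for the Lotz property *)

Section Criterion.
Variables (R : realType) (K : numFieldType) (S : scalars R K).
Local Notation nrm := (nrm S).
Local Notation emb := (emb S).

Lemma unit_ball_bound (V W : normedModType K) (g : V -> W) (e : R) : linear g ->
  (forall x, nrm x <= 1 -> nrm (g x) <= e) -> forall x, nrm (g x) <= e * nrm x.
Proof.
move=> lg ge x; have [->|x0] := eqVneq x 0; first by rewrite lin0// !nrm0 mulr0.
have nx := nrm_gt0 S x0.
have := ge (emb (nrm x)^-1 *: x); rewrite linZ// !nrmZr ger0_norm ?invr_ge0 ?nrm_ge0//.
rewrite mulVf ?gt_eqF// => /(_ (lexx _)).
by rewrite mulrC ler_pdivrMr.
Qed.

Lemma C0_at0_seq (V : completeNormedModType K) (T : R -> V -> V) (D : seq V) (e : R) :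
  C0_semigroup T -> 0 < e ->
  exists2 s : R, 0 < s & forall t d, d \in D -> 0 <= t -> t < s -> nrm (T t d - d) < e.
Proof.
move=> TC e0; elim: D => [|d D [s s0 IH]]; first by exists 1.
have [s' s'0 h] := C0_at0 S TC d e0.
exists (Num.min s s') => [|t d']; first by rewrite lt_min s0.
rewrite inE lt_min => /orP[/eqP ->|dD] t0 /andP[ts ts']; [exact: h|exact: IH].
Qed.

Variable V : completeNormedModType K.

(** With Q = l^2 - l W + W^2 one has l^3 = A Q - W^3. The semigroup is close to
    the identity on the range of A by hypothesis, and on the image of the unit
    ball under W^3 because a finite net of that image suffices. *)
Lemma uniformly_continuous_of_average (T : R -> V -> V) (A W : V -> V) (l : K) (M h : R) :
  C0_semigroup T -> 0 < h -> 0 <= M ->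
  (forall t x, 0 <= t -> t <= h -> nrm (T t x) <= M * nrm x) ->
  (forall t x, 0 <= t -> t < h -> nrm (T t (A x) - A x) <= 2 * M * (t / h) * nrm x) ->
  l != 0 -> bounded_operator W -> (forall x, A x = l *: x + W x) ->
  totally_bounded_map S (fun x => W (W (W x))) ->
  uniformly_continuous_semigroup T.
Proof.
move=> TC h0 M0 TM TA l0 bW AE tbW eps eps0.
have Tlin t : 0 <= t -> linear (T t) by case: (TC) => hb _ _ _ /hb[].
have [lW [w w0 hw]] := (bounded_operatorP S W).1 bW.
have /= e0 : 0 < re S eps by rewrite -(emb_gt0 S) emb_nonneg ?ltW.
have epsE : eps = emb (re S eps) by rewrite emb_nonneg ?ltW.
move: e0 epsE; move: (re S eps) => e e0 -> {eps eps0}.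
pose c := nrm l ^+ 3; have c0 : 0 < c by rewrite exprn_gt0// nrm_gt0.
pose Q x := l *: (l *: x) - l *: W x + W (W x).
have AQ x : A (Q x) = l *: (l *: (l *: x)) + W (W (W x)).
  have cancel4 (a b c' d : V) : a - b + c' + (b - c' + d) = a + d.
    by rewrite addrA -[a - b + c']addrA [- b + c']addrC -(opprB c' b) addrK.
  by rewrite AE /Q !(linD lW) (linN lW) !(linZ lW) !scalerDr !scalerN cancel4.
pose q := nrm l ^+ 2 + nrm l * w + w ^+ 2.
have q0 : 0 <= q by rewrite !addr_ge0 ?exprn_ge0 ?mulr_ge0 ?nrm_ge0.
have hQ x : nrm (Q x) <= q * nrm x.
  have := nrmD S (l *: (l *: x) - l *: W x) (W (W x)).
  have := nrmB S (l *: (l *: x)) (l *: W x).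
  rewrite !nrmZ; have := hw x; have := hw (W x); have := nrm_ge0 S l.
  have := nrm_ge0 S x; have := nrm_ge0 S (W x); rewrite /q => *.
  have : nrm l * nrm (W x) <= nrm l * (w * nrm x) by rewrite ler_wpM2l.
  have : w * nrm (W x) <= w * (w * nrm x) by rewrite ler_wpM2l.
  lra.
have M1 : 0 < 4 * (M + 1) by rewrite mulr_gt0// ltr_wpDl.
have [D hD] := tbW (c * e / (4 * (M + 1))) (divr_gt0 (mulr_gt0 c0 e0) M1).
have [s1 s10 hs1] := C0_at0_seq D TC (divr_gt0 (mulr_gt0 c0 e0) (ltr0n _ 4)).
have q1 : 0 < 4 * (M * q + 1) by rewrite mulr_gt0// ltr_wpDl// mulr_ge0.
have s20 : 0 < c * e * h / (4 * (M * q + 1)).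
  by apply: divr_gt0 => //; apply: mulr_gt0 => //; apply: mulr_gt0.
near=> t => x.
have t0 : 0 < t by near: t; exact: nbhs_right_gt.
have ts1 : t < s1 by near: t; exact: nbhs_right_lt.
have ts2 : t < c * e * h / (4 * (M * q + 1)) by near: t; exact: nbhs_right_lt.
have th : t < h by near: t; exact: nbhs_right_lt.
rewrite -!(nrmE S) -rmorphM (emb_le S).
have lt := Tlin _ (ltW t0).
have k1 : nrm (T t (A (Q x)) - A (Q x)) <= c * e / 2 * nrm x.
  apply: le_trans (TA _ _ (ltW t0) th) _.
  have : t / h * (4 * (M * q + 1)) <= c * e.
    move: ts2; rewrite ltr_pdivlMr// => /ltW ts2'.
    by rewrite mulrAC ler_pdivrMr.
  have th0 : 0 <= t / h by rewrite divr_ge0 ?ltW.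
  have := nrm_ge0 S x => nx hh.
  have : 2 * M * (t / h) * nrm (Q x) <= 2 * M * (t / h) * (q * nrm x).
    by apply: ler_wpM2l => //; apply: mulr_ge0 => //; apply: mulr_ge0.
  have : (t / h * (4 * (M * q + 1))) * nrm x <= c * e * nrm x by rewrite ler_wpM2r.
  have : 0 <= t / h * nrm x by rewrite mulr_ge0.
  lra.
have k2 : nrm (T t (W (W (W x))) - W (W (W x))) <= c * e / 2 * nrm x.
  apply: (@unit_ball_bound V V (fun x => T t (W (W (W x))) - W (W (W x)))).
    by move=> a u v; rewrite !lW !lt scalerBr opprD addrACA.
  move=> y y1; have [d dD yd] := hD y y1.
  have := hs1 t d dD (ltW t0) ts1.
  have h1 := TM t (W (W (W y)) - d) (ltW t0) (ltW th); rewrite linB// in h1.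
  have := nrm_dist S (T t (W (W (W y)))) (T t d) (W (W (W y))).
  have := nrm_dist S (T t d) d (W (W (W y))); rewrite (nrm_distC S d).
  have : (M + 1) * nrm (W (W (W y)) - d) <= c * e / 4.
    by move: yd; rewrite ltr_pdivlMr// => /ltW; lra.
  lra.
have : c * nrm (T t x - x) <= c * (e * nrm x).
  have -> : c * nrm (T t x - x) = nrm (l *: (l *: (l *: (T t x - x)))).
    by rewrite !nrmZ /c; ring.
  have -> : l *: (l *: (l *: (T t x - x))) =
    (T t (A (Q x)) - A (Q x)) - (T t (W (W (W x))) - W (W (W x))).
    rewrite AQ (linD lt) !(linZ lt) !scalerBr.
    by rewrite (opprD (l *: _)) [X in _ = X - _]addrACA addrK.
  apply: le_trans (nrmB _ _ _) _; lra.
by rewrite ler_pM2l.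
Unshelve. all: by end_near. Qed.

Theorem lotz_criterion :
  scalar_plus_strictly_singular V ->
  (forall W : V -> V, strictly_singular W -> totally_bounded_map S (fun x => W (W (W x)))) ->
  fails_bcap S V -> lotz R V.
Proof.
move=> sps cubes fails T TC.
have [d [M [d0 M0 TM]]] := C0_locally_bounded S TC.
pose h n : R := d / 2 * 2^-1 ^+ n.
have p0 n : 0 < (2^-1 : R) ^+ n by rewrite exprn_gt0 ?invr_gt0.
have h0 n : 0 < h n by rewrite mulr_gt0// divr_gt0.
have hd n : 2 * h n <= d.
  rewrite /h mulrA mulrCA divff ?mulr1 ?pnatr_eq0// -[leRHS]mulr1 ler_pM2l//.
  by rewrite exprn_ile1 ?invr_ge0// invf_le1// ler1n.
have hd' n : h n <= d by have := hd n; have := h0 n; lra.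
have /choice[A AP] n : exists A : V -> V, forall x, tends S (fun k => average S T (h n) k x) (A x).
  by apply: (average_limit TC M0 TM); rewrite h0 hd'.
have Alin n : linear (A n) by apply: (limit_lin TC (h0 n) (AP n)).
have Ale n x : nrm (A n x) <= M * nrm x by exact: (limit_le TM (h0 n) (hd n) (AP n)).
have Ab n : bounded_operator (A n).
  by apply/(bounded_operatorP S); split=> //; exists M.
have /choice[l lP] n : exists l, exists W : V -> V, strictly_singular W /\ forall x, A n x = l *: x + W x.
  by have /sps[l [W hW]] := Ab n; exists l, W.
have [[n ln]|l0] := pselect (exists n, l n != 0).
  have [W [ssW AE]] := lP n.
  apply: (@uniformly_continuous_of_average T (A n) W (l n) M (h n)) => //.
  - by move=> t x t0 th; apply: TM => //; apply: le_trans (hd' n).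
  - by move=> t x t0 th; apply: (limit_shift TC M0 TM (h0 n) (hd n) (AP n)).
  - by case: ssW.
  - exact: cubes.
(* All averages are strictly singular: their cubes are compact approximations
   of the identity. *)
exfalso; apply: fails; exists (fun n x => A n (A n (A n x))), (M ^+ 3); split.
- by move=> n a x y; rewrite !Alin.
- move=> n x; rewrite !exprS expr0 mulr1 -!mulrA.
  apply: le_trans (Ale _ _) (ler_wpM2l M0 _).
  by apply: le_trans (Ale _ _) (ler_wpM2l M0 _).
- move=> n; have [W [ssW AE]] := lP n.
  have -> : A n = W; last exact: cubes.
  apply/funext => x; rewrite AE; have [->|ln] := eqVneq (l n) 0.
    by rewrite scale0r add0r.
  by case: l0; exists n.
have Aconv x (e : R) : 0 < e -> exists N, forall n, (N <= n)%N -> nrm (A n x - x) < e.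
  move=> e0; have e2 : 0 < e / 2 by rewrite divr_gt0.
  have [s s0 hs] := C0_at0 S TC x e2.
  have [N hN] := half_pow_small (d / 2) s0.
  exists N => n Nn; apply: (@le_lt_trans _ _ (e / 2)); last by lra.
  apply: (limit_near (h0 n) (AP n)) => t t0 th.
  by apply/ltW/hs => //; apply: le_lt_trans th (hN _ Nn).
move=> x e e0.
have e1 : 0 < e / (M ^+ 2 + M + 1).
  by rewrite divr_gt0// ltr_wpDl// addr_ge0// exprn_ge0.
have [N hN] := Aconv x _ e1; exists N => n /hN.
rewrite ltr_pdivlMr; last by rewrite ltr_wpDl// addr_ge0// exprn_ge0.
have h1 := Ale n (A n x - x); have h2 := Ale n (A n (A n x) - A n x).
rewrite !linB// in h1 h2.
have := nrm_dist S (A n (A n (A n x))) (A n (A n x)) x.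
have := nrm_dist S (A n (A n x)) (A n x) x.
have : M * nrm (A n (A n x) - A n x) <= M * (M * nrm (A n x - x)) by rewrite ler_wpM2l.
lra.
Qed.
End Criterion.

(** * Subspaces almost orthogonal to a finite-dimensional one *)

Section FiniteDim.
Variables (R : realType) (K : numFieldType) (S : scalars R K).
Local Notation nrm := (nrm S).
Local Notation emb := (emb S).

(** Functionals are often prescribed on vectors with several representations.
    Giving the graph instead, well-definedness follows from the bound. *)
Lemma hahn_banach_graph (V : normedModType K) (G : set (V * K)) (C : R) : 0 <= C ->
  G (0, 0) -> (forall a p q, G p -> G q -> G (a *: p.1 + q.1, a * p.2 + q.2)) ->
  (forall p, G p -> nrm p.2 <= C * nrm p.1) ->
  exists F : V -> K^o,
    [/\ linear F, forall x, nrm (F x) <= C * nrm x & forall p, G p -> F p.1 = p.2].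
Proof.
move=> C0 G0 GL GC.
pose M := [set x | exists k, G (x, k)].
pose f x := xget 0 [set k | G (x, k)].
have fP x : M x -> G (x, f x) by move=> [k Gk]; apply: (@xgetPex _ 0 [set k | G (x, k)]); exists k.
have funiq x k : G (x, k) -> f x = k.
  move=> Gk; have Gf : G (x, f x) by apply: fP; exists k.
  have := GC _ (GL (-1) _ _ Gk Gf) => /=; rewrite scaleN1r addNr nrm0 mulr0 mulN1r.
  move=> h; apply/eqP; rewrite -subr_eq0 addrC; apply/eqP/(nrm_eq0 (S := S))/eqP.
  by rewrite eq_le h nrm_ge0.
have [||||F [lF FC FM]] := @hahn_banach R K S V M f C C0.
- by exists 0.
- by move=> a u v /fP Gu /fP Gv; exists (a * f u + f v); exact: (GL a _ _ Gu Gv).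
- by move=> a u v /fP Gu /fP Gv; apply: funiq; exact: (GL a _ _ Gu Gv).
- by move=> x /fP/GC.
exists F; split=> // -[x k] /= Gxk; rewrite FM ?(funiq _ _ Gxk)//; by exists k.
Qed.

Lemma norming_functional (V : normedModType K) (d : V) :
  exists F : V -> K^o,
    [/\ linear F, forall x, nrm (F x) <= nrm x & F d = emb (nrm d)].
Proof.
have [|||F [lF FC FM]] := @hahn_banach_graph V
  [set p | exists a : K, p = (a *: d, a * emb (nrm d))] 1 ler01.
- by exists 0; rewrite scale0r mul0r.
- move=> a _ _ [b ->] [c ->] /=; exists (a * b + c).
  by rewrite scalerDl scalerA mulrDl mulrA.
- move=> _ [a ->] /=; rewrite mul1r nrmM nrm_emb nrmZ.
  by rewrite ger0_norm ?nrm_ge0.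
exists F; split=> //.
  by move=> x; rewrite -[leRHS]mul1r.
by have := FM (d, emb (nrm d)); apply; exists 1; rewrite scale1r mul1r.
Qed.

Section Subspaces.
Variable X : completeNormedModType K.
Implicit Types W Y Z : closedSubspace X.

Lemma carrierZ W a x : carrier W x -> carrier W (a *: x).
Proof. by move=> Wx; have := carrierL a Wx (carrier0 W); rewrite addr0. Qed.

Lemma carrierD W x y : carrier W x -> carrier W y -> carrier W (x + y).
Proof. by move=> Wx Wy; have := carrierL 1 Wx Wy; rewrite scale1r. Qed.

Lemma carrierB W x y : carrier W x -> carrier W y -> carrier W (x - y).
Proof. by move=> Wx Wy; rewrite -scaleN1r addrC; apply: carrierL. Qed.

Lemma carrier_sum W (I : Type) (r : seq I) (P : pred I) (F : I -> X) :
  (forall i, P i -> carrier W (F i)) -> carrier W (\sum_(i <- r | P i) F i).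
Proof.
by move=> h; elim/big_ind : _ => //; [exact: carrier0|move=> *; exact: carrierD].
Qed.

Definition incl W (u : W) : X := @subspace_val K X W u.

#[global] Arguments incl : simpl never.

Definition in_subspace W (x : X) (Wx : carrier W x) : W :=
  exist _ x (mem_set Wx) : subspace_of W.

Lemma incl_lin W : linear (@incl W).
Proof.
move=> a u v; have h := @linearP K (subspace_of W) X *:%R (val : subspace_of W -> X).
exact: h.
Qed.

Lemma carrier_incl W (u : W) : carrier W (incl u).
Proof. exact: set_mem (svalP u). Qed.

Lemma incl_inj W : injective (@incl W).
Proof. exact: val_inj. Qed.

Lemma inclK W x (Wx : carrier W x) : incl (in_subspace Wx) = x.
Proof. by []. Qed.

Lemma nrm_incl W (u : W) : nrm (incl u) = nrm u.
Proof. by []. Qed.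

Lemma infinite_dimP W : infinite_dim W <->
  ~ exists (n : nat) (b : 'I_n -> X), (forall i, carrier W (b i)) /\
      forall x, carrier W x -> exists c : 'I_n -> K, x = \sum_(i < n) c i *: b i.
Proof.
have valsum n (c : 'I_n -> K) (b : 'I_n -> W) :
    incl (\sum_(i < n) c i *: b i) = \sum_(i < n) c i *: incl (b i).
  by rewrite (lin_sum (@incl_lin W)); apply: eq_bigr => i _; rewrite (linZ (@incl_lin W)).
split=> h [n [b hb]]; apply: h.
  case: hb => Wb hb; exists n, (fun i => in_subspace (Wb i)) => x.
  have [c xE] := hb (incl x) (carrier_incl x); exists c; apply: incl_inj.
  by rewrite valsum xE.
exists n, (fun i => incl (b i)); split=> [i|x Wx]; first exact: carrier_incl.
by have [c /(congr1 (@incl W))] := hb (in_subspace Wx); rewrite valsum inclK; exists c.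
Qed.

(** If finitely many vectors spanned the kernel of [f] in [W], one more vector
    of [W] would suffice to span [W]. *)
Lemma infinite_dim_kernel W (f : X -> K^o) : bounded_operator f -> infinite_dim W ->
  exists W', [/\ carrier W' `<=` carrier W, infinite_dim W'
    & forall w, carrier W' w -> f w = 0].
Proof.
move=> bf Winf; have [lf [C C0 fC]] := (bounded_operatorP S f).1 bf.
have kL a u v : carrier W u /\ f u = 0 -> carrier W v /\ f v = 0 ->
    carrier W (a *: u + v) /\ f (a *: u + v) = 0.
  move=> [Wu fu] [Wv fv]; split; first exact: carrierL.
  by rewrite lf fu fv scaler0 addr0.
have kC : closed [set w | carrier W w /\ f w = 0].
  apply/(closed_nrm S) => x hx; split.
    apply: ((closed_nrm S _).1 (@carrier_closed _ _ W) x) => e e0.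
    by have [y [Wy _] xy] := hx e e0; exists y.
  apply: (nrm_eq0 (S := S)); apply/eqP; rewrite eq_le nrm_ge0 andbT.
  apply/ler_addgt0Pr => e e0; rewrite add0r.
  have C1 : 0 < C + 1 by rewrite ltr_wpDl.
  have [y [_ fy] xy] := hx _ (divr_gt0 e0 C1).
  have := fC (x - y); rewrite linB// fy subr0; move: xy.
  by rewrite ltr_pdivlMr//; have := nrm_ge0 S (x - y); lra.
pose W' := @ClosedSubspace K X [set w | carrier W w /\ f w = 0]
  (conj (carrier0 W) (lin0 lf)) kL kC.
exists W'; split=> [w []//||w []//].
apply/infinite_dimP => -[n [b [Wb' hb]]].
have Wb i : carrier W (b i) /\ f (b i) = 0 by exact: Wb'.
have {}hb x : carrier W x /\ f x = 0 -> exists c : 'I_n -> K, x = \sum_(i < n) c i *: b i by exact: hb.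
have /infinite_dimP := Winf; apply.
have [[w0 Ww0 fw0]|f0] := pselect (exists2 w0, carrier W w0 & f w0 != 0); last first.
  exists n, b; split=> [i|x Wx]; first by case: (Wb i).
  apply: hb; split=> //; apply/eqP/negP => /negP fx; apply: f0; by exists x.
exists n.+1, (fun i => if unlift ord0 i is Some j then b j else w0); split.
  by move=> i; case: unliftP => [j _|_ //]; case: (Wb j).
move=> x Wx; pose t : K := f x / f w0.
have [|c xE] := hb (x - t *: w0).
  split; first by apply: carrierB => //; exact: carrierZ.
  by rewrite linB// linZ// -[_ *: _]/(_ * _) divfK// subrr.
exists (fun i => if unlift ord0 i is Some j then c j else t).
rewrite big_ord_recl unlift_none -[LHS](subrK (t *: w0)) addrC xE; congr (_ + _).
by apply: eq_bigr => i _; rewrite liftK.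
Qed.

Lemma infinite_dim_kernels W (D : seq X) (f : X -> X -> K^o) :
  (forall d, bounded_operator (f d)) -> infinite_dim W ->
  exists W', [/\ carrier W' `<=` carrier W, infinite_dim W'
    & forall d w, d \in D -> carrier W' w -> f d w = 0].
Proof.
move=> bf; elim: D W => [|d D IH] W Winf; first by exists W; split.
have [W1 [W1W W1inf fW1]] := infinite_dim_kernel (bf d) Winf.
have [W2 [W2W W2inf fW2]] := IH W1 W1inf.
exists W2; split=> // [x /W2W/W1W//|d' w]; rewrite inE => /orP[/eqP ->|dD] W2w.
  exact/fW1/W2W.
exact: fW2.
Qed.

(** For the span of finitely many vectors this is the compactness of the unit
    ball, the only effect of finite dimension in Mazur's argument. *)
Definition ball_net (F : set X) : Prop :=
  forall e : R, 0 < e -> exists D : seq X,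
    forall f, F f -> nrm f <= 1 -> exists2 d, d \in D & nrm (f - d) < e.

(** [W'] is the common kernel in [W] of norming functionals of a 1/4-net of the
    unit ball of [F]. For f of norm 1 and d in the net with |f - d| < 1/4, the
    functional of d takes at f + w a value of modulus at least
    |d| - |f - d| >= 1 - 2/4. *)
Lemma mazur (F : set X) W : (forall a f, F f -> F (a *: f)) -> ball_net F ->
  infinite_dim W ->
  exists W', [/\ carrier W' `<=` carrier W, infinite_dim W'
    & forall f w, F f -> carrier W' w -> nrm f <= 2 * nrm (f + w)].
Proof.
move=> FZ Fnet Winf; have [|D hD] := Fnet 4^-1; first by rewrite invr_gt0.
have /choice[f fP] := @norming_functional X.
have bf d : bounded_operator (f d).
  apply/(bounded_operatorP S); case: (fP d) => lf fle _; split=> //; exists 1 => // x.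
  by rewrite mul1r.
have [W' [W'W W'inf fW']] := infinite_dim_kernels D bf Winf.
exists W'; split=> // x w Fx W'w.
have [->|x0] := eqVneq x 0; first by rewrite nrm0 mulr_ge0// nrm_ge0.
have nx := nrm_gt0 S x0; pose a := emb (nrm x)^-1.
have na : nrm a = (nrm x)^-1 by rewrite nrm_emb ger0_norm// invr_ge0 nrm_ge0.
have nax : nrm (a *: x) = 1 by rewrite nrmZ na mulVf// gt_eqF.
have [|d dD xd] := hD (a *: x) (FZ _ _ Fx); first by rewrite nax.
case: (fP d) => lf fle fd.
have : 2^-1 <= nrm (a *: (x + w)).
  apply: le_trans (fle _); rewrite scalerDr (linD lf) (fW' d (a *: w))//; last exact: carrierZ.
  rewrite addr0; have -> : a *: x = d + (a *: x - d) by rewrite addrC subrK.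
  rewrite (linD lf) fd; have := nrm_addl S (emb (nrm d)) (f d (a *: x - d)).
  rewrite nrm_emb ger0_norm ?nrm_ge0//; have := fle (a *: x - d).
  have := nrm_subl S (a *: x) (a *: x - d).
  by rewrite subKr nax; lra.
by rewrite nrmZ na mulrC ler_pdivlMr// => h; lra.
Qed.

End Subspaces.

Lemma real_grid (r e : R) : 0 < e -> exists L : seq R,
  forall a, `|a| <= r -> exists2 b, b \in L & `|a - b| < e.
Proof.
move=> e0; pose N := Num.bound (2 * `|r| / e).
exists [seq i%:R * e - r | i <- iota 0 N] => a ar.
have r0 : 0 <= r by apply: le_trans ar.
have /andP[a1 a2] : - r <= a <= r by rewrite -ler_norml.
have t0 : 0 <= (a + r) / e by apply: divr_ge0; [lra|exact: ltW].
have /andP[i1 i2] := truncn_itv t0.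
exists ((Num.truncn ((a + r) / e))%:R * e - r).
  apply/mapP; exists (Num.truncn ((a + r) / e)) => //; rewrite mem_iota /= add0n truncn_lt_nat//.
  apply: le_lt_trans (archi_boundP _); last by rewrite divr_ge0 ?mulr_ge0 ?(ltW e0).
  by rewrite ler_pM2r ?invr_gt0// ger0_norm//; lra.
rewrite ler_pdivlMr// in i1; rewrite ltr_pdivrMr// -natr1 in i2.
by rewrite ltr_norml; lra.
Qed.

Lemma scalar_grid (r e : R) : 0 < e -> exists L : seq K,
  forall a, nrm a <= r -> exists2 b, b \in L & nrm (a - b) < e.
Proof.
move=> e0; pose j := nrm (J S).
have j0 : 0 <= j by exact: nrm_ge0.
have e1 : 0 < e / (1 + j) by rewrite divr_gt0// ltr_pwDl.
have [L hL] := real_grid r e1.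
exists [seq emb u + J S * emb v | u <- L, v <- L] => a ar.
have [u uL au] := hL _ (le_trans (re_le S a) ar).
have [v vL av] := hL _ (le_trans (im_le S a) ar).
exists (emb u + J S * emb v); first exact: allpairs_f.
rewrite {1}(scal_decomp S a) opprD addrACA -mulrBr -!rmorphB.
apply: le_lt_trans (nrmD _ _ _) _; rewrite nrmM !nrm_emb -/j.
move: au av; rewrite !ltr_pdivlMr; [|by rewrite ltr_pwDl..].
set p := `|_|; set q := `|_| => h1 h2.
have : j * (q * (1 + j)) <= j * e by rewrite ler_wpM2l// ltW.
have : (p + j * q) * (1 + j) < e * (1 + j) -> p + j * q < e.
  by rewrite ltr_pM2r// ltr_pwDl.
lra.
Qed.

(** A vector of norm at most 1 has a component in [F] of norm at most 2, and
    coefficients of modulus at most [3 * C], which can be rounded to a finite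
    grid. *)
Lemma ball_net_extend (X : completeNormedModType K) (F : set X) (H : finType)
    (v : H -> X) (C : R) : ball_net F ->
  (forall a f, F f -> F (a *: f)) -> 0 <= C -> (forall i, nrm (v i) <= 1) ->
  (forall f c, F f -> nrm f <= 2 * nrm (f + \sum_i c i *: v i)) ->
  (forall c : H -> K, \sum_i nrm (c i) <= C * nrm (\sum_i c i *: v i)) ->
  ball_net [set f + \sum_i c i *: v i | f in F & c in [set: H -> K]].
Proof.
move=> Fnet FZ C0 v1 F2 vC e e0.
have [|D hD] := Fnet (e / 4); first by rewrite divr_gt0.
pose N := #|H|%:R : R.
have N0 : 0 <= N by rewrite ler0n.
have e1 : 0 < e / (2 * (N + 1)) by rewrite divr_gt0// mulr_gt0// ltr_wpDl.
have [L hL] := scalar_grid (3 * C) e1.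
pose E := [seq \sum_i nth 0 L (g i) *: v i | g : {ffun H -> 'I_(size L)} <- enum {ffun H -> 'I_(size L)}].
exists [seq emb 2 *: d + x | d <- D, x <- E] => _ [f Ff [c _ <-]] x1.
have nf : nrm f <= 2 by have := F2 f c Ff; lra.
have ne : nrm (\sum_i c i *: v i) <= 3.
  have := nrmB S (f + \sum_i c i *: v i) f; rewrite addrC addKr; lra.
have nc i : nrm (c i) <= 3 * C.
  have : \sum_i nrm (c i) <= C * 3 by apply: le_trans (vC c) _; rewrite ler_wpM2l.
  rewrite (bigD1 i)//=; have : 0 <= \sum_(j | j != i) nrm (c j).
    by apply: sumr_ge0 => j _; exact: nrm_ge0.
  lra.
(* Half of f lies in the unit ball of F, where the net applies. *)
have [|d dD fd] := hD (emb 2^-1 *: f) (FZ _ _ Ff).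
  by rewrite nrmZr ger0_norm ?invr_ge0//; lra.
have /choice[b bP] i : exists b, b \in L /\ nrm (c i - b) < e / (2 * (N + 1)).
  by have [b] := hL _ (nc i); exists b.
have bL i : (index (b i) L < size L)%N by rewrite index_mem; case: (bP i).
exists (emb 2 *: d + \sum_i b i *: v i).
  apply: allpairs_f => //; apply/mapP; exists [ffun i => Ordinal (bL i)].
    by rewrite mem_enum.
  by apply: eq_bigr => i _; rewrite ffunE nth_index//; case: (bP i).
have -> : f + \sum_i c i *: v i - (emb 2 *: d + \sum_i b i *: v i) =
    emb 2 *: (emb 2^-1 *: f - d) + \sum_i (c i - b i) *: v i.
  rewrite opprD addrACA scalerBr scalerA -rmorphM divff ?pnatr_eq0// rmorph1 scale1r.
  by congr (_ + _); rewrite -sumrB; apply: eq_bigr => i _; rewrite scalerBl.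
apply: le_lt_trans (nrmD _ _ _) _; rewrite nrmZr ger0_norm//.
have : nrm (\sum_i (c i - b i) *: v i) <= \sum_(i : H) e / (2 * (N + 1)).
  apply: le_trans (nrm_sum _ _ _ _) _; apply: ler_sum => i _.
  rewrite nrmZ; case: (bP i) => _ /ltW h; apply: le_trans h.
  by rewrite -[leRHS]mulr1 ler_wpM2l ?nrm_ge0.
rewrite sumr_const -[X in _ <= X]mulr_natr -/N.
have : e / (2 * (N + 1)) * N <= e / 2.
  have -> : e / (2 * (N + 1)) * N = e / 2 * (N / (N + 1)).
    by rewrite invfM !mulrA [_ * N]mulrAC.
  rewrite -[leRHS]mulr1 ler_wpM2l ?divr_ge0 ?(ltW e0)//.
  by rewrite ler_pdivrMr ?mul1r ?ltr_wpDl//; lra.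
lra.
Qed.

End FiniteDim.

(** * Spreading models and l1 estimates *)

Lemma l1_norm_comb (K : numFieldType) (k : nat) (a : 'I_k -> K) :
  l1_norm (\sum_(j < k) a j *: l1_unit_vector K j) = \sum_(j < k) `|a j|.
Proof.
pose f : nat -> K^o := \sum_(j < k) a j *: l1_unit_vector K j.
have fE (m : 'I_k) : f m = a m.
  rewrite /f fct_sumE (bigD1 m)//= big1 ?addr0.
    by rewrite /= -[LHS]/(a m * (m == m :> nat)%:R) eqxx mulr1.
  move=> j jm; rewrite -[LHS]/(a j * (m == j :> nat)%:R).
  by rewrite (_ : (_ == _) = false) ?mulr0// eq_sym; apply/negbTE.
have f0 m : (k <= m)%N -> f m = 0.
  move=> km; rewrite /f fct_sumE big1// => j _.
  rewrite -[LHS]/(a j * (m == j :> nat)%:R) gtn_eqF ?mulr0//.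
  exact: leq_trans (ltn_ord j) km.
rewrite -[LHS]/(limn (series (fun n => `|f n|))).
apply: cvg_lim => //; apply: cvg_near_cst; exists k => // n /= kn.
rewrite seriesEnat/= (@big_cat_nat _ _ _ k)//= [X in _ + X]big_nat_cond [X in _ + X]big1 ?addr0.
  by rewrite big_mkord; apply: eq_bigr => i _; rewrite fE.
by move=> i /andP[/andP[ki _] _]; rewrite f0// normr0.
Qed.

Section L1.
Variables (R : realType) (K : numFieldType) (S : scalars R K).
Local Notation nrm := (nrm S).
Local Notation emb := (emb S).

(** Spreading models control coefficients in [-1, 1] up to an additive error;
    dividing by the sum of the moduli makes the error 1/16 relative. *)
Lemma spreading_real_lower (X : completeNormedModType K) (x : nat -> X) (k : nat) :
  l1_spreading_model x -> exists N : nat, forall r : 'I_k -> R,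
    15 / 16 * \sum_j `|r j| <= nrm (\sum_j emb (r j) *: x (N + j)%N).
Proof.
move=> [_ /(_ k (emb 16^-1))]; rewrite emb_gt0 invr_gt0 => /(_ (ltr0n _ _))[N hN].
exists N => r; pose s := \sum_j `|r j|.
have s0 : 0 <= s by rewrite sumr_ge0.
have [s_eq0|sp] : s = 0 \/ 0 < s.
  by move: s0; rewrite le_eqVlt => /orP[/eqP <-|]; [left|right].
  by rewrite -/s s_eq0 mulr0 nrm_ge0.
have sn0 : s != 0 by rewrite gt_eqF.
have rs j : `|r j| <= s.
  by rewrite /s (bigD1 j)//= lerDl sumr_ge0.
have h1 (i : 'I_k) : (N <= N + i)%N by exact: leq_addr.
have h2 (i j : 'I_k) : (i < j)%N -> (N + i < N + j)%N by rewrite ltn_add2l.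
have h3 (j : 'I_k) : -1 <= emb (r j / s) <= 1.
  rewrite -(rmorph1 emb) -rmorphN !emb_le.
  by rewrite -ler_norml normrM normfV (ger0_norm s0) ler_pdivrMr// mul1r.
have := hN _ h1 h2 _ h3.
rewrite l1_norm_comb (norm_leE S).
have -> : \sum_(j < k) `|emb (r j / s)| = emb 1.
  rewrite -[RHS](congr1 emb (divff sn0)) /s mulr_suml rmorph_sum.
  apply: eq_bigr => j _; rewrite -(nrmE S) nrm_emb normrM normfV -/s.
  by rewrite (ger0_norm s0).
have -> : \sum_(j < k) emb (r j / s) *: x (N + j)%N =
    emb s^-1 *: \sum_j emb (r j) *: x (N + j)%N.
  rewrite scaler_sumr; apply: eq_bigr => j _.
  by rewrite scalerA -rmorphM mulrC.
have sV : `|s^-1| = s^-1 by rewrite ger0_norm ?invr_ge0.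
rewrite -(nrmE S) -rmorphB nrm_emb nrmZr sV.
rewrite ler_distl => /andP[h _]; move: h; rewrite mulrC ler_pdivlMr//.
by rewrite -/s; lra.
Qed.

(** Spreading models only control real coefficients. For coefficients u + J v,
    enlarge every |u| by |v| to get A with |A| >= |v|. The combinations with
    coefficients A + J v and A - J v add up to the one with coefficients 2 A,
    of norm at least (15/8) sum |A|. The second has norm at most
    sum (|A| + |v| / 2), since sqrt (A^2 + v^2) <= |A| + |v| / 2, so the first
    is large; replacing A by u in it costs at most sum |v|. This is the
    estimate [half]. Applied to the coefficients [c] and [J c], whose
    combinations have the same norm, it bounds
    (7/8 - 5/8) (sum |re c| + sum |im c|) by twice that norm. *)
Lemma real_l1_to_scalar_l1 (X : normedModType K) (H : finType) (x : H -> X) :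
  (forall i, nrm (x i) = 1) ->
  (forall r : H -> R, 15 / 16 * \sum_i `|r i| <= nrm (\sum_i emb (r i) *: x i)) ->
  forall c : H -> K, \sum_i nrm (c i) <= 8 * nrm (\sum_i c i *: x i).
Proof.
move=> x1 lower c.
have half (u v : H -> R) : 7 / 8 * \sum_i `|u i| - 5 / 8 * \sum_i `|v i| <=
    nrm (\sum_i (emb (u i) + J S * emb (v i)) *: x i).
  pose sg (t : R) : R := if 0 <= t then 1 else -1.
  have sgE t : sg t * `|t| = t.
    rewrite /sg; case: ifPn => [t0|]; first by rewrite mul1r ger0_norm.
    by rewrite -ltNge => t0; rewrite ltr0_norm// mulN1r opprK.
  have sg1 t : `|sg t| = 1 by rewrite /sg; case: ifP; rewrite ?normrN normr1.
  pose A i := sg (u i) * (`|u i| + `|v i|).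
  have nA i : `|A i| = `|u i| + `|v i|.
    by rewrite normrM sg1 mul1r ger0_norm// addr_ge0.
  have AE i : A i = u i + sg (u i) * `|v i| by rewrite /A mulrDr sgE.
  pose P := \sum_i (emb (A i) + J S * emb (v i)) *: x i.
  pose Q := \sum_i (emb (A i) + J S * emb (- v i)) *: x i.
  have nQ : nrm Q <= \sum_i (`|A i| + `|v i| / 2).
    apply: le_trans (nrm_sum _ _ _ _) _; apply: ler_sum => i _.
    rewrite nrmZ x1 mulr1; apply: le_trans (norm_sqr _ _ _) _.
    rewrite -[leRHS]ger0_norm ?addr_ge0 ?divr_ge0// -sqrtr_sqr ler_wsqrtr//.
    rewrite sqrrN -[A i ^+ 2]real_normK ?num_real//.
    rewrite -[v i ^+ 2]real_normK ?num_real// nA.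
    have := normr_ge0 (u i); have := normr_ge0 (v i); nra.
  have PQ : 15 / 16 * \sum_i `|2 * A i| <= nrm P + nrm Q.
    apply: le_trans (lower _) _; apply: le_trans (nrmD _ _ _).
    rewrite /P /Q -big_split/= le_eqVlt; apply/orP; left; apply/eqP; congr (nrm _).
    apply: eq_bigr => i _; rewrite -scalerDl; congr (_ *: _).
    by rewrite addrACA -mulrDr -!rmorphD addrN rmorph0 mulr0 addr0 mulrDl mul1r.
  have P1 : nrm P <= nrm (\sum_i (emb (u i) + J S * emb (v i)) *: x i) + \sum_i `|v i|.
    have -> : P = \sum_i (emb (u i) + J S * emb (v i)) *: x i +
        \sum_i emb (sg (u i) * `|v i|) *: x i.
      rewrite -big_split/=; apply: eq_bigr => i _; rewrite -scalerDl; congr (_ *: _).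
      by rewrite AE rmorphD addrAC.
    apply: le_trans (nrmD _ _ _) _; rewrite lerD2l.
    apply: le_trans (nrm_sum _ _ _ _) _; apply: ler_sum => i _.
    by rewrite nrmZr x1 mulr1 normrM sg1 mul1r normr_id.
  have : \sum_i `|2 * A i| = 2 * (\sum_i `|u i| + \sum_i `|v i|).
    rewrite -big_split/= mulr_sumr; apply: eq_bigr => i _.
    by rewrite normrM nA ger0_norm.
  have : \sum_i (`|A i| + `|v i| / 2) = \sum_i `|u i| + \sum_i `|v i| + \sum_i `|v i| / 2.
    by rewrite -!big_split/=; apply: eq_bigr => i _; rewrite nA.
  rewrite -mulr_suml => e1 e2; lra.
have cE : \sum_i c i *: x i = \sum_i (emb (re S (c i)) + J S * emb (im S (c i))) *: x i.
  by apply: eq_bigr => i _; rewrite -(scal_decomp S).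
have [JJ|J0] := J_case S; last first.
  have nc i : nrm (c i) = `|re S (c i)|.
    by rewrite {1}(scal_decomp S (c i)) J0 mul0r addr0 nrm_emb.
  have := lower (fun i => re S (c i)).
  have -> : \sum_i emb (re S (c i)) *: x i = \sum_i c i *: x i.
    by rewrite cE; apply: eq_bigr => i _; rewrite J0 mul0r addr0.
  have -> : \sum_i `|re S (c i)| = \sum_i nrm (c i).
    by apply: eq_bigr => i _; rewrite nc.
  have := nrm_ge0 S (\sum_i c i *: x i); lra.
have nJ : nrm (J S) = 1.
  have : nrm (J S) ^+ 2 = 1 by rewrite expr2 -nrmM JJ nrmN nrm1.
  by move=> /eqP; rewrite sqrf_eq1 => /orP[/eqP//|/eqP h]; have := nrm_ge0 S (J S); rewrite h; lra.
have h1 := half (fun i => re S (c i)) (fun i => im S (c i)); rewrite -cE in h1.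
have h2 := half (fun i => - im S (c i)) (fun i => re S (c i)).
have h3 : nrm (\sum_i (emb (- im S (c i)) + J S * emb (re S (c i))) *: x i) =
    nrm (\sum_i c i *: x i).
  rewrite -[RHS]mul1r -nJ -nrmZ cE scaler_sumr; congr (nrm _); apply: eq_bigr => i _.
  by rewrite scalerA mulrDr mulrA JJ mulN1r rmorphN addrC.
rewrite h3 in h2.
have : \sum_i nrm (c i) <= \sum_i `|re S (c i)| + \sum_i `|im S (c i)|.
  rewrite -big_split/=; apply: ler_sum => i _.
  rewrite {1}(scal_decomp S (c i)); apply: le_trans (nrmD _ _ _) _.
  by rewrite nrmM nJ mul1r !nrm_emb.
have : \sum_i `|- im S (c i)| = \sum_i `|im S (c i)|.
  by apply: eq_bigr => i _; rewrite normrN.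
lra.
Qed.

Lemma spreading_l1 (X : completeNormedModType K) (H : finType) (x : nat -> X) :
  normalized x -> l1_spreading_model x ->
  exists v : H -> X, (forall i, exists n, v i = x n) /\
    forall c : H -> K, \sum_i nrm (c i) <= 8 * nrm (\sum_i c i *: v i).
Proof.
move=> x1 hx; have [N hN] := spreading_real_lower #|H| hx.
exists (fun i => x (N + enum_rank i)%N); split=> [i|]; first by exists (N + enum_rank i)%N.
apply: real_l1_to_scalar_l1 => [i|r].
  by apply: (@emb_inj _ _ S); rewrite nrmE x1 rmorph1.
have := hN (fun j => r (enum_val j)).
rewrite [X in _ * X](reindex (@enum_rank H))/=; last first.
  by exists enum_val => j _; rewrite ?enum_rankK ?enum_valK.
rewrite [X in nrm X](reindex (@enum_rank H))/=; last first.
  by exists enum_val => j _; rewrite ?enum_rankK ?enum_valK.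
by under eq_bigr do rewrite enum_rankK; under [X in nrm X]eq_bigr do rewrite enum_rankK.
Qed.

End L1.

(** * Decompositions into l1 levels *)

Section Levels.
Variables (R : realType) (K : numFieldType) (S : scalars R K).
Local Notation nrm := (nrm S).
Local Notation emb := (emb S).
Variable X : completeNormedModType K.
Variable H : nat -> finType.

Definition level_sum (v : forall m, H m -> X) (c : forall m, H m -> K) (m : nat) : X :=
  \sum_(i : H m) c m i *: v m i.

Definition levels_sum (v : forall m, H m -> X) (c : forall m, H m -> K) (M : nat) : X :=
  \sum_(m < M) level_sum v c m.

Definition l1_levels (v : forall m, H m -> X) (C : R) : Prop :=
  forall c M m, (m < M)%N -> \sum_i nrm (c m i) <= C * nrm (levels_sum v c M).

(** The levels are chosen one after the other. The state reached after some of
    them is the span F of their vectors and an infinite-dimensional [W] with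
    |f| <= 2 |f + w| for f in F and w in [W]; the next level is taken in [W]
    from a spreading model, and Mazur's lemma gives the next state. A level is
    the difference of two initial sums, each of norm at most twice that of the
    whole, so its norm is at most 4 times that of the whole and the constant
    is 4 * 8. *)
Lemma exists_l1_levels (Y : closedSubspace X) :
  (forall W : closedSubspace X, infinite_dim W ->
    exists x : nat -> W, normalized x /\ l1_spreading_model x) ->
  infinite_dim Y ->
  exists v : forall m, H m -> X,
    [/\ forall m i, carrier Y (v m i), forall m i, nrm (v m i) = 1 & l1_levels v 32].
Proof.
move=> hl1 Yinf.
pose good (s : set X * closedSubspace X) :=
  [/\ s.1 0, forall a f, s.1 f -> s.1 (a *: f), ball_net S s.1, infinite_dim s.2
    & (forall f w, s.1 f -> carrier s.2 w -> nrm f <= 2 * nrm (f + w)) /\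
      carrier s.2 `<=` carrier Y].
have step m (s : {s | good s}) : exists p : (H m -> X) * {s | good s},
    [/\ forall i, carrier (sval s).2 (p.1 i), forall i, nrm (p.1 i) = 1,
        forall c : H m -> K, \sum_i nrm (c i) <= 8 * nrm (\sum_i c i *: p.1 i),
        carrier (sval p.2).2 `<=` carrier (sval s).2
      & forall f (c : H m -> K), (sval s).1 f -> (sval p.2).1 (f + \sum_i c i *: p.1 i)].
  case: s => [[F W] [F0 FZ Fnet Winf [FW WY]]] /=.
  have [x [x1 xl1]] := hl1 W Winf.
  have [v' [v'x v'l1]] := spreading_l1 S (H m) x1 xl1.
  pose v i := incl (v' i).
  have vW i : carrier W (v i) by exact: carrier_incl.
  have vsum (c : H m -> K) : \sum_i c i *: v i = incl (\sum_i c i *: v' i).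
    rewrite (lin_sum (@incl_lin _ _ _)).
    by apply: eq_bigr => i _; rewrite (linZ (@incl_lin _ _ _)).
  have v1 i : nrm (v i) = 1.
    have [n vn] := v'x i; rewrite /v nrm_incl vn.
    by apply: (@emb_inj _ _ S); rewrite nrmE x1 rmorph1.
  have vl1 c : \sum_i nrm (c i) <= 8 * nrm (\sum_i c i *: v i).
    by rewrite vsum nrm_incl.
  pose F' := [set f + \sum_i c i *: v i | f in F & c in [set: H m -> K]].
  have F'0 : F' 0.
    exists 0 => //; exists (fun=> 0) => //.
    by rewrite big1 ?addr0// => i _; rewrite scale0r.
  have F'Z a f : F' f -> F' (a *: f).
    move=> [g Fg [c _ <-]]; exists (a *: g); first exact: FZ.
    exists (fun i => a * c i) => //; rewrite scalerDr scaler_sumr; congr (_ + _).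
    by apply: eq_bigr => i _; rewrite scalerA.
  have F'net : ball_net S F'.
    apply: (@ball_net_extend R K S X F (H m) v 8) => // [i|f c Ff].
      by rewrite v1.
    by apply: FW => //; apply: carrier_sum => i _; exact: carrierZ.
  have [W' [W'W W'inf F'W']] := mazur F'Z F'net Winf.
  have gd : good (F', W') by split=> //; split=> // x' /W'W/WY.
  exists (v, exist _ (F', W') gd); split=> //= f c Ff.
  by exists f => //; exists c.
have good0 : good ([set 0], Y).
  split=> //=; [by move=> a f ->; rewrite scaler0| |].
    by move=> e e0; exists [:: 0] => f -> _; exists 0; rewrite ?inE// subrr nrm0.
  by split=> // f w -> _; rewrite nrm0 mulr_ge0// nrm_ge0.
pose g m s := projT1 (cid (step m s)).
have gP m s := projT2 (cid (step m s)); rewrite -/(g _ _) in gP.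
pose st := fix st m : {s | good s} :=
  if m is m'.+1 then (g m' (st m')).2 else exist _ _ good0.
pose v m := (g m (st m)).1.
have stP m := gP m (st m).
have stS m : st m.+1 = (g m (st m)).2 by [].
have Wdec m n : (m <= n)%N -> carrier (sval (st n)).2 `<=` carrier (sval (st m)).2.
  move=> mn; rewrite -(subnK mn); elim: (n - m)%N => [//|k IH].
  rewrite addSn stS; case: (stP (k + m)%N) => _ _ _ h _.
  exact: subset_trans h IH.
have gd m := svalP (st m).
exists v; split=> [m i|m i|c M m mM].
- case: (gd m) => _ _ _ _ [_]; apply; by case: (stP m) => + _ _ _ _; apply.
- by case: (stP m) => _ + _ _ _; apply.
have Fsum n : (sval (st n)).1 (levels_sum v c n).
  elim: n => [|n IH]; first by rewrite /levels_sum big_ord0; case: (gd 0%N).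
  rewrite stS /levels_sum big_ord_recr.
  by case: (stP n) => _ _ _ _; apply; exact: IH.
have tail n : (n <= M)%N -> carrier (sval (st n)).2 (levels_sum v c M - levels_sum v c n).
  move=> nM; rewrite /levels_sum -(big_mkord xpredT (level_sum v c)).
  rewrite -(big_mkord xpredT (level_sum v c)) (@big_cat_nat _ _ _ n)//= addrC addrK.
  rewrite big_nat_cond; apply: carrier_sum => i /andP[/andP[ni _] _].
  apply: carrier_sum => j _; apply: carrierZ; apply: (Wdec _ _ ni).
  by case: (stP i) => + _ _ _ _; apply.
have init n : (n <= M)%N -> nrm (levels_sum v c n) <= 2 * nrm (levels_sum v c M).
  move=> nM; case: (gd n) => _ _ _ _ [h _].
  by have := h _ _ (Fsum n) (tail n nM); rewrite addrC subrK.
have : nrm (level_sum v c m) <= 4 * nrm (levels_sum v c M).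
  have -> : level_sum v c m = levels_sum v c m.+1 - levels_sum v c m.
    by rewrite /levels_sum big_ord_recr/= addrC addrK.
  have := nrmB S (levels_sum v c m.+1) (levels_sum v c m).
  have := init _ mM; have := init _ (ltnW mM); lra.
have : \sum_i nrm (c m i) <= 8 * nrm (level_sum v c m).
  by case: (stP m) => _ _ + _ _; apply.
lra.
Qed.

Definition levels_span (v : forall m, H m -> X) : set X :=
  [set x | exists c M, x = levels_sum v c M].

Lemma levels_sum_trunc (v : forall m, H m -> X) c M N : (M <= N)%N ->
  levels_sum v c M = levels_sum v (fun m i => if (m < M)%N then c m i else 0) N.
Proof.
move=> MN; rewrite /levels_sum (big_ord_widen _ (fun m => level_sum v c m) MN).
rewrite big_mkcond; apply: eq_bigr => m _; case: ifP => mM.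
  by apply: eq_bigr => i _; rewrite mM.
by rewrite /level_sum big1// => i _; rewrite mM scale0r.
Qed.

Lemma levels_spanL (v : forall m, H m -> X) a x y :
  levels_span v x -> levels_span v y -> levels_span v (a *: x + y).
Proof.
move=> [c [M ->]] [d [N ->]].
rewrite (levels_sum_trunc v c (leq_maxl M N)) (levels_sum_trunc v d (leq_maxr M N)).
set c' := fun m i => _; set d' := fun m i => _.
exists (fun m i => a * c' m i + d' m i), (maxn M N).
rewrite /levels_sum scaler_sumr -big_split/=; apply: eq_bigr => m _.
rewrite /level_sum scaler_sumr -big_split/=; apply: eq_bigr => i _.
by rewrite scalerA scalerDl.
Qed.

Variables (v : forall m, H m -> X) (C : R).
Hypothesis C0 : 0 <= C.
Hypothesis vC : l1_levels v C.

Lemma levels_coordinate m0 (i0 : H m0) :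
  exists F : X -> K^o,
    [/\ linear F, forall x, nrm (F x) <= C * nrm x
      & forall c M, F (levels_sum v c M) = if (m0 < M)%N then c m0 i0 else 0].
Proof.
pose G := [set p : X * K | exists c M, (m0 < M)%N /\ p = (levels_sum v c M, c m0 i0)].
have [|||F [lF FC FG]] := @hahn_banach_graph R K S X G C C0.
- exists (fun _ _ => 0), m0.+1; split=> //.
  by rewrite /levels_sum big1// => m _; rewrite /level_sum big1// => i _; rewrite scale0r.
- move=> a _ _ [c [M [mM ->]]] [d [N [mN ->]]] /=.
  rewrite (levels_sum_trunc v c (leq_maxl M N)) (levels_sum_trunc v d (leq_maxr M N)).
  exists (fun m i => a * (if (m < M)%N then c m i else 0) + (if (m < N)%N then d m i else 0)), (maxn M N).
  rewrite mM mN; split; first by rewrite leq_max mM.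
  congr pair; rewrite /levels_sum scaler_sumr -big_split/=; apply: eq_bigr => m _.
  rewrite /level_sum scaler_sumr -big_split/=; apply: eq_bigr => i _.
  by rewrite scalerA scalerDl.
- move=> _ [c [M [mM ->]]] /=; apply: le_trans (vC c mM).
  by rewrite (bigD1 i0)//= lerDl sumr_ge0// => i _; exact: nrm_ge0.
exists F; split=> // c M; case: ifPn => [mM|].
  by apply: (FG (levels_sum v c M, c m0 i0)); exists c, M.
rewrite -leqNgt => Mm.
rewrite (levels_sum_trunc v c (leqW Mm)).
set d := fun m i => _.
have -> : (0 : K) = d m0 i0 by rewrite /d ltnNge Mm.
by apply: (FG (levels_sum v d m0.+1, d m0 i0)); exists d, m0.+1.
Qed.

(** Separate extensions of the coordinates only bound each of them. The joint
    bound over a level still holds on the closed span of the levels, as a limit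
    of the bound on finite sums. *)
Lemma levels_coordinates : exists U : forall m, H m -> X -> K^o,
  [/\ forall m i, linear (U m i),
      forall m i x, nrm (U m i x) <= C * nrm x,
      forall m i c M, U m i (levels_sum v c M) = if (m < M)%N then c m i else 0
    & forall m x, closure (levels_span v) x -> \sum_i nrm (U m i x) <= C * nrm x].
Proof.
pose U m i := projT1 (cid (@levels_coordinate m i)).
have lU m i : linear (U m i) by rewrite /U; case: cid => F [].
have leU m i x : nrm (U m i x) <= C * nrm x by rewrite /U; case: cid => F [].
have UE m i c M : U m i (levels_sum v c M) = if (m < M)%N then c m i else 0.
  by rewrite /U; case: cid => F [].
exists U; split=> // m x.
move=> /(closure_nrm S) xcl; apply/ler_addgt0Pr => e e0.
pose N := #|H m|%:R : R.
have N0 : 0 <= N by rewrite ler0n.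
have D0 : 0 < C * (1 + N) + 1 by rewrite ltr_wpDl// mulr_ge0// addr_ge0.
have [y [c [M yE]] xy] := xcl _ (divr_gt0 e0 D0).
have hy : \sum_i nrm (U m i y) <= C * nrm y.
  rewrite yE; have [mM|Mm] := ltnP m M.
    apply: le_trans (vC c mM); apply: ler_sum => i _.
    by rewrite UE mM.
  rewrite big1 ?mulr_ge0 ?nrm_ge0// => i _.
  by rewrite UE ltnNge Mm /= nrm0.
have : \sum_i nrm (U m i x) <= \sum_i (nrm (U m i y) + C * nrm (x - y)).
  apply: ler_sum => i _.
  have := nrm_subl S (U m i x) (U m i y); rewrite -(linB (lU m i)).
  have := leU m i (x - y); lra.
rewrite big_split/= sumr_const -[X in _ + X]mulr_natr -/N.
have := nrm_subl S y x; rewrite nrm_distC.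
move: xy; rewrite ltr_pdivlMr//.
set d := nrm (x - y); move=> h1 h2 h3.
have : C * nrm y <= C * (nrm x + d) by rewrite ler_wpM2l//; lra.
have : 0 <= d by exact: nrm_ge0.
lra.
Qed.

(** A finite sum has zero coordinates on all later levels, and the joint bound
    over a level controls the error of approximation by finite sums. *)
Lemma levels_coordinate_vanish (U : forall m, H m -> X -> K^o) (x : X) (e : R) :
  (forall m i, linear (U m i)) ->
  (forall m i c M, U m i (levels_sum v c M) = if (m < M)%N then c m i else 0) ->
  (forall m x, closure (levels_span v) x -> \sum_i nrm (U m i x) <= C * nrm x) ->
  closure (levels_span v) x -> 0 < e ->
  exists N, forall m, (N <= m)%N -> \sum_i nrm (U m i x) <= e.
Proof.
move=> lU UE Uj xcl e0; have D0 : 0 < C + 1 by rewrite ltr_wpDl.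
have [y [c [M yE]] xy] := (closure_nrm S _ _).1 xcl _ (divr_gt0 e0 D0).
exists M => m Mm.
have cl : closure (levels_span v) (x - y).
  apply/(closure_nrm S) => d d0; have [z zs xz] := (closure_nrm S _ _).1 xcl d d0.
  exists (z - y); last by rewrite opprB addrA subrK.
  by rewrite addrC -scaleN1r; apply: levels_spanL => //; exists c, M.
have := Uj m _ cl.
have -> : \sum_i nrm (U m i (x - y)) = \sum_i nrm (U m i x).
  apply: eq_bigr => i _; rewrite (linB (lU m i)) [in U m i y]yE UE.
  by rewrite ltnNge Mm /= subr0.
move: xy; rewrite ltr_pdivlMr//; have := nrm_ge0 S (x - y); lra.
Qed.

End Levels.

(** * Random signs *)

Section Signs.
Variables (F : numFieldType) (I : finType).
Implicit Types (eta : {ffun I -> bool}) (k l : I).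

Definition sign_count : nat := #|{ffun I -> bool}|.

Lemma sign_count_gt0 : (0 < sign_count)%N.
Proof. by apply/card_gt0P; exists [ffun=> true]. Qed.

(** For [k] and [l] distinct, flipping the sign at [k] changes the sign of the
    whole sum. *)
Lemma sign_orthogonal k l :
  \sum_(eta : {ffun I -> bool}) (-1) ^+ eta k * (-1) ^+ eta l = (sign_count%:R *+ (k == l) : F).
Proof.
have [<-|kl] := eqVneq k l.
  under eq_bigr do rewrite -signr_addb addbb expr0.
  by rewrite sumr_const mulr1n.
pose flip eta : {ffun I -> bool} := [ffun i => (i == k) (+) eta i].
have flipK : involutive flip.
  by move=> eta; apply/ffunP => i; rewrite !ffunE addKb.
set s := LHS; have : s = - s.
  rewrite {1}/s (reindex_inj (inv_inj flipK))/= -sumrN; apply: eq_bigr => eta _.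
  have -> : flip eta k = ~~ eta k by rewrite ffunE eqxx addTb.
  have -> : flip eta l = eta l by rewrite ffunE eq_sym (negbTE kl) addFb.
  by rewrite signrN mulNr.
move=> /eqP; rewrite -addr_eq0 -mulr2n mulrn_eq0 /= => /eqP ->.
by rewrite mulr0n.
Qed.

End Signs.

(** Off the diagonal the signs cancel on average. When [B] is bilinear in two
    families, this replaces a sum of diagonal values by an average of values
    of [B] at signed sums of the families. *)
Lemma sign_decoupling (F : numFieldType) (I L : finType) (phi : L -> I) (A : {set L})
    (B : L -> L -> F) : {in A &, injective phi} ->
  (sign_count I)%:R * \sum_(s in A) B s s =
  \sum_(eta : {ffun I -> bool}) \sum_(s in A) \sum_(t in A)
    (-1) ^+ eta (phi s) * (-1) ^+ eta (phi t) * B s t.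
Proof.
move=> phi_inj; rewrite exchange_big/= mulr_sumr; apply: eq_bigr => s sA.
rewrite exchange_big/= (bigD1 s)//= -mulr_suml sign_orthogonal eqxx mulr1n.
rewrite big1 ?addr0// => t /andP[tA ts].
rewrite -mulr_suml sign_orthogonal [_ == _](_ : _ = false) ?mulr0n ?mul0r//.
by apply/eqP => /(phi_inj _ _ sA tA) st; rewrite st eqxx in ts.
Qed.

(** The mean of the squares is |A| by orthogonality. With q = sqrt |A|, the
    inequality |r| <= (r^2 / q + q) / 2 passes from this to the mean of the
    moduli. *)
Lemma rademacher_l1_le (R : realType) (I L : finType) (phi : L -> I) (A : {set L})
    (c : L -> bool) : {in A &, injective phi} ->
  \sum_(eta : {ffun I -> bool}) `|\sum_(s in A) (-1) ^+ c s * (-1) ^+ eta (phi s)| <=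
  (sign_count I)%:R * Num.sqrt #|A|%:R :> R.
Proof.
move=> phi_inj; have [->|A0] := eqVneq A finset.set0.
  by rewrite big1 ?mulr_ge0// => eta _; rewrite big_set0 normr0.
set q := Num.sqrt _; have qq : q ^+ 2 = #|A|%:R by rewrite sqr_sqrtr.
have q0 : 0 < q by rewrite sqrtr_gt0 ltr0n card_gt0.
pose r (eta : {ffun I -> bool}) : R := \sum_(s in A) (-1) ^+ c s * (-1) ^+ eta (phi s).
have r2 : \sum_(eta : {ffun I -> bool}) r eta ^+ 2 = (sign_count I)%:R * #|A|%:R.
  rewrite -[X in _ = _ * X]sumr_const.
  have -> : \sum_(s in A) (1 : R) = \sum_(s in A) ((-1) ^+ c s * (-1) ^+ c s).
    by apply: eq_bigr => s _; rewrite -signr_addb addbb expr0.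
  rewrite (sign_decoupling (fun s t => (-1) ^+ c s * (-1) ^+ c t) phi_inj).
  apply: eq_bigr => eta _; rewrite expr2 mulr_suml; apply: eq_bigr => s _.
  by rewrite mulr_sumr; apply: eq_bigr => t _; ring.
have amgm eta : `|r eta| <= (r eta ^+ 2 / q + q) / 2.
  rewrite -[r eta ^+ 2]real_normK ?num_real// ler_pdivlMr// -lerBlDr.
  rewrite ler_pdivlMr//; have := sqr_ge0 (`|r eta| - q); rewrite sqrrB mulr2n; lra.
apply: le_trans (ler_sum _ (fun eta _ => amgm eta)) _.
rewrite -mulr_suml big_split/= -mulr_suml r2 sumr_const -[X in _ + X]mulr_natl.
rewrite -/(sign_count I) -qq expr2 -mulrA -(mulrA q) divff ?gt_eqF// mulr1; lra.
Qed.

(** * Bit strings *)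

(** An iterated product with the last bit outermost: going to the next level
    appends a bit. *)
Fixpoint bits (n : nat) : finType :=
  if n is m.+1 then (bits m * bool)%type else unit.

Fixpoint bxor n : bits n -> bits n -> bits n :=
  match n return bits n -> bits n -> bits n with
  | 0 => fun _ _ => tt
  | m.+1 => fun j s => (bxor j.1 s.1, j.2 (+) s.2)
  end.

Fixpoint brestr (G : pred nat) n : bits n -> bits n :=
  match n return bits n -> bits n with
  | 0 => id
  | m.+1 => fun j => (brestr G j.1, G m && j.2)
  end.

Arguments bxor {n}.
Arguments brestr G {n}.

Definition supported (G : pred nat) n : {set bits n} := [set s | brestr G s == s].

Lemma bxorK n (s : bits n) : involutive (bxor^~ s).
Proof.
elim: n s => [|n IH] /=; first by move=> [] [].
by move=> [s b] [j c] /=; rewrite addbK; congr pair; exact: IH.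
Qed.

Lemma bxor_injr n (j : bits n) : injective (bxor j).
Proof.
elim: n j => [|n IH] j /=; first by move=> [] [].
by move=> [s b] [s' b'] /= [/IH -> /addbI ->].
Qed.

Lemma brestr_xor (G : pred nat) n (j s : bits n) :
  brestr G (bxor j s) = bxor (brestr G j) (brestr G s).
Proof. by elim: n j s => //= n IH j s; rewrite IH; case: (G n). Qed.

Lemma brestr_inj_supported (G : pred nat) n (j : bits n) :
  {in supported G n &, injective (fun s => brestr G (bxor j s))}.
Proof.
move=> s t; rewrite !inE => /eqP sG /eqP tG.
by rewrite !brestr_xor sG tG => /bxor_injr.
Qed.

Lemma brestr_disjoint (G G' : pred nat) n (j s : bits n) :
  (forall p, ~~ (G p && G' p)) -> s \in supported G n ->
  brestr G' (bxor j s) = brestr G' j.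
Proof.
move=> GG'; rewrite inE; elim: n j s => [|n IH] /=; first by move=> [] [].
move=> j [s b] /= /eqP[/eqP sG bG].
rewrite IH//; congr pair; have := GG' n; case: (G' n) => //=; rewrite andbT => /negbTE Gn.
by move: bG; rewrite Gn /= => <-; rewrite addbF.
Qed.

Lemma card_supported (G : pred nat) n :
  #|supported G n| = (\prod_(p < n) (if G p then 2 else 1))%N.
Proof.
elim: n => [|n IH].
  rewrite big_ord0 (_ : supported G 0 = finset.setT) ?cardsT ?card_unit//.
rewrite big_ord_recr -IH /=.
have -> : supported G n.+1 = finset.setX (supported G n) [set b | G n && b == b]%SET.
  by apply/finset.setP => -[s b]; rewrite !inE /= xpair_eqE.
rewrite cardsX; congr (_ * _)%N; case: (G n).
  by rewrite (_ : [set b | _]%SET = finset.setT) ?cardsT ?card_bool//; apply/finset.setP => b; rewrite !inE eqxx.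
rewrite (_ : [set b | _]%SET = [set false]%SET) ?cards1//.
by apply/finset.setP => -[]; rewrite !inE.
Qed.

Lemma supported_gt0 (G : pred nat) n : (0 < #|supported G n|)%N.
Proof. by rewrite card_supported prodn_gt0// => p; case: ifP. Qed.

Lemma card_bits n : #|bits n| = (2 ^ n)%N.
Proof. by elim: n => [|n IH]; rewrite ?card_unit// card_prod IH card_bool expnSr. Qed.

Lemma sum_shift (V : nmodType) n (A : {set bits n}) (f : bits n -> V) :
  \sum_j \sum_(s in A) f (bxor j s) = (\sum_j f j) *+ #|A|.
Proof.
rewrite exchange_big/= -sumr_const; apply: eq_bigr => s _.
by rewrite [RHS](reindex_inj (inv_inj (@bxorK n s))).
Qed.

(** The classes of two pairs [(m, g)] are disjoint as soon as the parities of
    the levels or the types [g] differ. The bits of one class can then be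
    changed without affecting what depends on the other types of the same
    level, or on the neighbouring levels. *)
Definition bit_class (m : nat) (g : bool * bool) : pred nat :=
  [pred p : nat | (p %% 8 == 4 * odd m + 2 * g.1 + g.2)%N].

Lemma bit_class_disjoint m m' g g' p : odd m != odd m' \/ g != g' ->
  ~~ (bit_class m g p && bit_class m' g' p).
Proof.
move=> h; rewrite /bit_class /=; apply/negP => /andP[/eqP-> /eqP].
by case: g g' h => [[] []] [[] []] [] /=; case: (odd m); case: (odd m').
Qed.

Lemma prod_block8 (r q : nat) : (r < 8)%N ->
  (\prod_(p < 8 * q) (if p %% 8 == r then 2 else 1) = 2 ^ q)%N.
Proof.
move=> r8; elim: q => [|q IH]; first by rewrite muln0 big_ord0.
rewrite -(big_mkord xpredT (fun p => if (p %% 8 == r)%N then 2 else 1)%N).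
rewrite mulnS addnC (@big_cat_nat _ _ _ (8 * q)%N) ?leq_addr//= big_mkord IH expnSr.
congr (_ * _)%N; rewrite -{1}[(8 * q)%N]add0n big_addn addKn.
rewrite (eq_bigr (fun i => if (i %% 8 == r)%N then 2 else 1)%N); last first.
  by move=> i _; rewrite addnC mulnC modnMDl.
by clear IH; case: r r8 => [|[|[|[|[|[|[|[|r]]]]]]]] // _; rewrite !big_nat_recl// big_geq.
Qed.

Lemma card_bit_class_ge n m g : (2 ^ (n %/ 8) <= #|supported (bit_class m g) n|)%N.
Proof.
have r8 : (4 * odd m + 2 * g.1 + g.2 < 8)%N by case: g => [[] []]; case: (odd m).
rewrite card_supported -(prod_block8 (n %/ 8) r8).
have le : (8 * (n %/ 8) <= n)%N by rewrite mulnC leq_trunc_div.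
rewrite -(big_mkord xpredT (fun p => if (p %% 8 == 4 * odd m + 2 * g.1 + g.2)%N then 2 else 1)%N).
rewrite -[leqRHS](big_mkord xpredT (fun p => if (p %% 8 == 4 * odd m + 2 * g.1 + g.2)%N then 2 else 1)%N).
rewrite [leqRHS](@big_cat_nat _ _ _ (8 * (n %/ 8)))//= leq_pmulr// prodn_gt0// => p.
by case: ifP.
Qed.

(** A class contains about n / 8 of n positions, so the strings supported in it
    have a number with square root about 2^(n/16). A decay rate with 16th power
    at least 1/2 accommodates the inverse of this. *)
Definition rho {R : realType} : R := 1 - 32^-1.

Lemma bit_class_sqrt_decay (R : realType) n m g :
  (Num.sqrt #|supported (bit_class m g) n|%:R)^-1 <= rho ^- 16 * rho ^+ n :> R.
Proof.
have rho0 : 0 < rho :> R by rewrite /rho; lra.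
have rho1 : rho <= 1 :> R by rewrite /rho; lra.
pose q := (n %/ 16)%N.
have c4 : (4 ^ q <= #|supported (bit_class m g) n|)%N.
  apply: leq_trans (card_bit_class_ge n m g); rewrite -[4%N]/(2 ^ 2)%N -expnM leq_exp2l//.
  by rewrite leq_divRL// [(2 * q)%N]mulnC -mulnA; exact: leq_trunc_div.
have le : (2 : R) ^+ q <= Num.sqrt #|supported (bit_class m g) n|%:R.
  rewrite -[leLHS]ger0_norm ?exprn_ge0// -sqrtr_sqr ler_wsqrtr//.
  by rewrite -exprM mulnC exprM -natrX -natrX ler_nat.
(* Bernoulli's inequality, with 1 - 16 / 32 = 1 / 2. *)
have half16 : 2^-1 <= rho ^+ 16 :> R.
  have h (x : R) k : 0 <= x -> x <= 1 -> 1 - k%:R * x <= (1 - x) ^+ k.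
    move=> x0 x1; elim: k => [|k IH]; first by rewrite mul0r subr0 expr0.
    rewrite exprS -natr1; have x1' : 0 <= 1 - x by lra.
    have := ler_wpM2l x1' IH; have : 0 <= k%:R * x * x by rewrite !mulr_ge0.
    lra.
  have := h 32^-1 16%N; rewrite /rho => /(_ _ _); lra.
rewrite (le_trans (y := (2 ^+ q)^-1))//.
  by rewrite lef_pV2// posrE ?exprn_gt0// (lt_le_trans _ le)// exprn_gt0.
rewrite -exprVn mulrC ler_pdivlMr ?exprn_gt0//.
apply: (@le_trans _ _ ((rho ^+ 16) ^+ q * rho ^+ 16)).
  by rewrite ler_wpM2r ?exprn_ge0 ?(ltW rho0)// lerXn2r ?nnegrE ?invr_ge0 ?exprn_ge0 ?(ltW rho0).
rewrite -exprM -exprD; apply: ler_wiXn2l; rewrite ?(ltW rho0)//.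
by rewrite {1}(divn_eq n 16) -/q [(q * 16)%N]mulnC leq_add2l ltnW// ltn_mod.
Qed.

(** * Rademacher vectors in blocks *)

Definition cell (n : nat) : finType := (bits n * (bool * bool))%type.

(** Only the bits in the class attached to the type of the cell are kept.
    Changing bits of that class moves the cell to another block, and changing
    bits of a disjoint class leaves it in its block. *)
Definition block n (k : cell n) : cell n := (brestr (bit_class n k.2) k.1, k.2).

Definition rad_index (n : nat) : finType := (cell n * {ffun cell n -> bool})%type.

Lemma sum_rad_index (V : nmodType) n (F : rad_index n -> V) :
  \sum_i F i = \sum_(b : cell n) \sum_(eta : {ffun cell n -> bool}) F (b, eta).
Proof. by rewrite pair_bigA; apply: eq_bigr => -[]. Qed.

Section Rademacher.
Variables (R : realType) (K : numFieldType) (S : scalars R K).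
Local Notation nrm := (nrm S).
Local Notation emb := (emb S).
Variable X : completeNormedModType K.
Variable v : forall m, rad_index m -> X.
Variable U : forall m, rad_index m -> X -> K^o.
Arguments v {m}.
Arguments U {m}.
Hypothesis v1 : forall m (i : rad_index m), nrm (v i) = 1.
Hypothesis lU : forall m (i : rad_index m), linear (U i).
Hypothesis UE : forall m (i : rad_index m) c M,
  U i (levels_sum (@v) c M) = if (m < M)%N then c m i else 0.

Lemma nrm_sign (b : bool) : nrm ((-1) ^+ b : K) = 1.
Proof. by case: b; rewrite ?expr1 ?expr0 ?nrmN nrm1. Qed.

Lemma extend_level n (d : rad_index n -> K) :
  exists c : forall m, rad_index m -> K, c n = d.
Proof.
exists (fun m => if pselect (n = m) is left e then eq_rect n (fun m => rad_index m -> K) d m e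
  else fun=> 0).
by case: pselect => // e; rewrite (Prop_irrelevance e erefl).
Qed.

Lemma coordinate_level n (d : rad_index n -> K) (i : rad_index n) :
  U i (\sum_i' d i' *: v i') = d i.
Proof.
have [c cd] := extend_level d.
have -> : \sum_i' d i' *: v i' = levels_sum (@v) c n.+1 - levels_sum (@v) c n.
  by rewrite /levels_sum big_ord_recr/= addrC addrK /level_sum cd.
by rewrite (linB (lU _)) !UE ltnSn ltnn subr0 cd.
Qed.

Lemma coordinate_other_level m n (d : rad_index n -> K) (i : rad_index m) : m != n ->
  U i (\sum_i' d i' *: v i') = 0.
Proof.
move=> mn; have [c cd] := extend_level d.
have -> : \sum_i' d i' *: v i' = levels_sum (@v) c n.+1 - levels_sum (@v) c n.
  by rewrite /levels_sum big_ord_recr/= addrC addrK /level_sum cd.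
rewrite (linB (lU _)) !UE ltnS leq_eqVlt (negbTE mn) /=.
by case: ifP => _; rewrite subrr.
Qed.

(** With these coefficients [rad k] is the normalized sum, over all choices of
    signs eta, of eta(k) times the vector of index (block k, eta): a Rademacher
    function in the L1 space carried by the block of [k]. *)
Definition rad_coef n (k : cell n) (i : rad_index n) : K :=
  if i.1 == block k then (-1) ^+ i.2 k / (sign_count (cell n))%:R else 0.

Definition rad n (k : cell n) : X := \sum_i rad_coef k i *: v i.

Definition rad_dual n (k : cell n) (w : X) : K :=
  \sum_(eta : {ffun cell n -> bool}) (-1) ^+ eta k * U (block k, eta) w.

Definition level_mass n (w : X) : R := \sum_(i : rad_index n) nrm (U i w).

Let count0 n : (sign_count (cell n))%:R != 0 :> K.
Proof. by rewrite pnatr_eq0 -lt0n sign_count_gt0. Qed.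

Lemma rad_dual_lin n (k : cell n) : linear (rad_dual k : X -> K^o).
Proof.
move=> a u w; rewrite /rad_dual scaler_sumr -big_split/=; apply: eq_bigr => eta _.
rewrite (lU _ a u w) mulrDr; congr (_ + _); exact: mulrCA.
Qed.

Lemma rad_dual_rad n (k l : cell n) : rad_dual k (rad l) = (k == l)%:R.
Proof.
rewrite /rad_dual; under eq_bigr do rewrite coordinate_level /rad_coef /=.
have [bkl|bkl] := eqVneq (block k) (block l); last first.
  under eq_bigr do rewrite mulr0.
  rewrite big1//; have [kl|//] := eqVneq k l; by rewrite kl eqxx in bkl.
under eq_bigr do rewrite mulrA.
rewrite -mulr_suml sign_orthogonal -mulr_natl.
by case: eqVneq => _; rewrite ?mulr1n ?mulr0n ?mulr1 ?mul1r ?mulr0 ?mul0r// divff.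
Qed.

Lemma rad_dual_other m n (k : cell m) (l : cell n) : m != n -> rad_dual k (rad l) = 0.
Proof.
move=> mn; rewrite /rad_dual big1// => eta _.
by rewrite coordinate_other_level// mulr0.
Qed.

(** In the l1 norm of a single block a signed sum of such vectors is the mean
    modulus of a Rademacher sum. *)
Lemma rad_sum_le n (L : finType) (phi : L -> cell n) (A : {set L}) (c : L -> bool) (b : cell n) :
  {in A &, injective phi} -> (forall s, s \in A -> block (phi s) = b) ->
  nrm (\sum_(s in A) (-1) ^+ c s *: rad (phi s)) <= Num.sqrt #|A|%:R.
Proof.
move=> phi_inj phib; pose N : R := (sign_count (cell n))%:R.
have N0 : 0 < N by rewrite ltr0n sign_count_gt0.
pose r (eta : {ffun cell n -> bool}) : R := \sum_(s in A) (-1) ^+ c s * (-1) ^+ eta (phi s).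
have -> : \sum_(s in A) (-1) ^+ c s *: rad (phi s) =
    \sum_eta emb (r eta / N) *: v (b, eta).
  rewrite /rad; under eq_bigr do rewrite scaler_sumr.
  rewrite exchange_big/=.
  rewrite sum_rad_index.
  rewrite (bigD1 b)//= [X in _ + X]big1 ?addr0 => [|b' b'b]; last first.
    rewrite big1// => eta _; rewrite big1// => s sA.
    by rewrite /rad_coef /= (phib s sA) (negbTE b'b) scale0r scaler0.
  apply: eq_bigr => eta _; rewrite rmorphM rmorph_sum mulr_suml scaler_suml.
  apply: eq_bigr => s sA; rewrite scalerA /rad_coef /= (phib s sA) eqxx.
  by rewrite fmorphV rmorph_nat rmorphM !rmorph_sign mulrA.
apply: le_trans (nrm_sum _ _ _ _) _.
apply: (@le_trans _ _ (\sum_eta `|r eta| / N)).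
  apply: ler_sum => eta _; rewrite nrmZr v1 mulr1 normrM normfV.
  by rewrite (ger0_norm (ltW N0)).
rewrite -mulr_suml ler_pdivrMr// mulrC; exact: rademacher_l1_le.
Qed.

Lemma nrm_rad n (k : cell n) : nrm (rad k) <= 1.
Proof.
have := @rad_sum_le n unit (fun=> k) [set tt]%SET (fun=> false) (block k).
rewrite cards1 sqrtr1 big_set1 expr0 scale1r; apply=> //.
by move=> [] [].
Qed.

(** Functionals attached to distinct blocks read disjoint sets of coordinates,
    so any number of them is bounded by the l1 norm of the level. *)
Lemma rad_dual_sum_le n (L : finType) (phi : L -> cell n) (A : {set L}) (c : L -> bool) (w : X) :
  {in A &, injective (fun s => block (phi s))} ->
  nrm (\sum_(s in A) (-1) ^+ c s * rad_dual (phi s) w) <= level_mass n w.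
Proof.
move=> inj; apply: le_trans (nrm_sum _ _ _ _) _.
apply: (@le_trans _ _ (\sum_(s in A) \sum_eta nrm (U (block (phi s), eta) w))).
  apply: ler_sum => s _; rewrite nrmM nrm_sign mul1r.
  apply: le_trans (nrm_sum _ _ _ _) _; apply: ler_sum => eta _.
  by rewrite nrmM nrm_sign mul1r.
rewrite -(@big_imset _ _ _ _ _ (fun s => block (phi s)) (mem A) (fun b => \sum_eta nrm (U (b, eta) w)))//=.
rewrite /level_mass sum_rad_index.
rewrite [leRHS](bigID (mem [set block (phi s) | s in A]%SET))/= lerDl.
by apply: sumr_ge0 => b _; apply: sumr_ge0 => eta _; exact: nrm_ge0.
Qed.

Lemma rad_dual_le n (k : cell n) (w : X) : nrm (rad_dual k w) <= level_mass n w.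
Proof.
have := @rad_dual_sum_le n unit (fun=> k) [set tt]%SET (fun=> false) w.
by rewrite big_set1 expr0 mul1r; apply=> -[] [].
Qed.

(** * Two expressions of the same functionals *)

(** The two pieces lie in consecutive levels, so that the coefficient of this
    vector can be read in either of them: in the first by [upper_dual], in the
    second by [lower_dual]. *)
Definition szankowski_vec n (i : bits n.+1) : X :=
  rad (i.1, (i.2, false)) - rad (i.1, (i.2, true)) + \sum_h rad ((i, h) : cell n.+1).

Definition upper_dual n (i : bits n.+1) (w : X) : K :=
  2^-1 * (rad_dual (i.1, (i.2, false)) w - rad_dual (i.1, (i.2, true)) w).

Definition lower_dual n (j : bits n) (w : X) : K :=
  4^-1 * \sum_h rad_dual ((j, h) : cell n) w.

Lemma half_emb : 2^-1 = emb 2^-1 :> K.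
Proof. by rewrite fmorphV rmorph_nat. Qed.

Lemma nrm_half : nrm (2^-1 : K) = 2^-1.
Proof. by rewrite half_emb nrm_emb ger0_norm ?invr_ge0. Qed.

Lemma upper_dual_lin n (i : bits n.+1) : linear (upper_dual i : X -> K^o).
Proof.
move=> a x y; rewrite /upper_dual !(rad_dual_lin _ a x y) -!/(_ *: _).
by rewrite opprD addrACA mulrDr -scalerBr; congr (_ + _); exact: mulrCA.
Qed.

Lemma lower_dual_lin n (j : bits n) : linear (lower_dual j : X -> K^o).
Proof.
move=> a x y; rewrite /lower_dual; under eq_bigr do rewrite (rad_dual_lin _ a x y).
by rewrite big_split/= -scaler_sumr mulrDr; congr (_ + _); exact: mulrCA.
Qed.

Lemma upper_dual_le n (i : bits n.+1) w : nrm (upper_dual i w) <= level_mass n w.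
Proof.
rewrite /upper_dual nrmM nrm_half; apply: (@le_trans _ _ (2^-1 * (level_mass n w + level_mass n w))); last by lra.
rewrite ler_pM2l ?invr_gt0//; apply: le_trans (nrmB _ _ _) _.
by apply: lerD; exact: rad_dual_le.
Qed.

Lemma sum4 (V : nmodType) (F : bool * bool -> V) : \sum_h F h =
  F (false, false) + F (false, true) + (F (true, false) + F (true, true)).
Proof.
rewrite -(eq_bigr _ (fun h _ => congr1 F (esym (surjective_pairing h)))).
by rewrite -(pair_bigA _ (fun a b => F (a, b)))/= !big_bool /= addrC [X in _ + X = _]addrC [X in X + _ = _]addrC.
Qed.

Lemma rad_dual_szankowski p (k : cell p) m (i : bits m.+1) :
  rad_dual k (szankowski_vec i) =
  rad_dual k (rad (i.1, (i.2, false))) - rad_dual k (rad (i.1, (i.2, true))) +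
  \sum_h rad_dual k (rad ((i, h) : cell m.+1)).
Proof.
have l := rad_dual_lin k.
by rewrite /szankowski_vec (linD l) (linB l) (lin_sum l _ _ (fun h => rad ((i, h) : cell m.+1))).
Qed.

Lemma rad_dual_szankowski_same n (k : cell n) (i : bits n.+1) :
  rad_dual k (szankowski_vec i) = (k == (i.1, (i.2, false)))%:R - (k == (i.1, (i.2, true)))%:R.
Proof.
rewrite rad_dual_szankowski !rad_dual_rad big1 ?addr0// => h _.
by rewrite rad_dual_other// neq_ltn ltnSn.
Qed.

Lemma rad_dual_szankowski_next n (k : cell n.+1) (i : bits n.+1) :
  rad_dual k (szankowski_vec i) = (k.1 == i)%:R.
Proof.
rewrite rad_dual_szankowski !rad_dual_other ?neq_ltn ?ltnSn ?orbT// subr0 add0r.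
rewrite (bigD1 k.2)//= rad_dual_rad big1 ?addr0 => [|h hk].
  by rewrite -pair_eqE /= eqxx andbT.
by rewrite rad_dual_rad -pair_eqE /= [k.2 == h]eq_sym (negbTE hk) andbF.
Qed.

Lemma rad_dual_szankowski_other p (k : cell p) m (i : bits m.+1) : p != m -> p != m.+1 ->
  rad_dual k (szankowski_vec i) = 0.
Proof.
move=> pm pm1; rewrite rad_dual_szankowski !rad_dual_other// subr0 add0r big1// => h _.
exact: rad_dual_other.
Qed.

Lemma upper_dual_szankowski_same n (i i' : bits n.+1) : upper_dual i (szankowski_vec i') = (i == i')%:R.
Proof.
rewrite /upper_dual !rad_dual_szankowski_same -!pair_eqE /= -!pair_eqE /= !andbT !andbF.
rewrite subr0 sub0r opprK.
have -> : (i.1 == i'.1) && (i.2 == i'.2) = (i == i') by rewrite -pair_eqE.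
by case: (i == i'); rewrite ?addr0 ?mulr0// -mulr2n mulVf// pnatr_eq0.
Qed.

(** At the same level both sides read the coefficient. One level apart, either
    a difference of two functionals meets a sum of vectors with equal
    coefficients, or a sum of functionals meets a difference of vectors; both
    give 0. *)
Lemma upper_lower_szankowski n (i : bits n.+1) m (i' : bits m.+1) :
  upper_dual i (szankowski_vec i') = lower_dual i (szankowski_vec i').
Proof.
have [mn|mn] := eqVneq m n.
  rewrite mn in i' *.
  rewrite upper_dual_szankowski_same /lower_dual sum4 !rad_dual_szankowski_next /=.
  set c : K := (i == i')%:R.
  by rewrite (_ : c + c + (c + c) = 4 * c) ?mulKf ?pnatr_eq0//; ring.
have [mn1|mn1] := eqVneq m n.+1.
  rewrite mn1 in i' *.
  rewrite /upper_dual !rad_dual_szankowski_other ?neq_ltn ?ltnSn ?ltnS ?leqnSn//.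
  rewrite /lower_dual sum4 !rad_dual_szankowski_same -!pair_eqE /= -!pair_eqE /=.
  by case: (i'.2) => /=; rewrite ?andbT ?andbF ?subr0 ?sub0r ?addr0 ?add0r ?addrN ?addNr ?mulr0.
rewrite /lower_dual big1 ?mulr0 => [|h _]; last first.
  by apply: rad_dual_szankowski_other; rewrite eq_sym// eqSS.
rewrite /upper_dual; have [mn2|mn2] := eqVneq n m.+1.
  rewrite mn2 in i *.
  by rewrite !rad_dual_szankowski_next /= subrr mulr0.
by rewrite !rad_dual_szankowski_other ?subrr ?mulr0// eq_sym.
Qed.

Lemma nrm_szankowski n (i : bits n.+1) : nrm (szankowski_vec i) <= 6.
Proof.
rewrite /szankowski_vec; apply: le_trans (nrmD _ _ _) _.
have := nrmB S (rad (i.1, (i.2, false))) (rad (i.1, (i.2, true))).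
have : nrm (\sum_h rad ((i, h) : cell n.+1)) <= \sum_(h : bool * bool) 1.
  by apply: le_trans (nrm_sum _ _ _ _) _; apply: ler_sum => h _; exact: nrm_rad.
have := nrm_rad (i.1, (i.2, false)); have := nrm_rad (i.1, (i.2, true)).
rewrite sumr_const card_prod card_bool; lra.
Qed.

(** * Differences of consecutive levels *)

(** The vectors that [average_trace_diff] pairs with the functionals
    [rad_dual k]. *)
Definition szankowski_step n (k : cell n.+1) : X :=
  2^-1 *: ((-1) ^+ k.2.2 *: szankowski_vec ((k.1, k.2.1) : bits n.+2) - szankowski_vec k.1).

(** The last bit stays fixed because at the level below it is part of the type
    of a cell, which shifts should not change. *)
Definition shifts n (g : bool * bool) : {set bits n.+1} :=
  finset.setX (supported (bit_class n.+1 g) n) [set false]%SET.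

Lemma card_shifts n g : #|shifts n g| = #|supported (bit_class n.+1 g) n|.
Proof. by rewrite cardsX cards1 muln1. Qed.

(** Both terms of the step contain [rad k] with the same coefficient. After this
    cancellation the pieces that remain at the level of [k] have types other
    than that of [k], which is what makes [szankowski_step_sqrt] possible. *)
Lemma szankowski_step_expand n (j : bits n.+1) (q e : bool) :
  szankowski_step (j, (q, e)) = 2^-1 *:
    (- (rad (j, (q, ~~ e)) + rad (j, (q, ~~ e)) + rad (j, (~~ q, false)) + rad (j, (~~ q, true)))
     + (-1) ^+ e *: \sum_h rad (((j, q), h) : cell n.+2)
     - (rad (j.1, (j.2, false)) - rad (j.1, (j.2, true)))).
Proof.
rewrite /szankowski_step /szankowski_vec /=; congr (_ *: _).
have key (a b c : X) : a - b - (a + b + c) = - (b + b + c).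
  by rewrite !opprD addrA addrACA subrr add0r.
have flip4 : (-1) ^+ e *: (rad (j, (q, false)) - rad (j, (q, true))) - \sum_h rad (j, h) =
    - (rad (j, (q, ~~ e)) + rad (j, (q, ~~ e)) + rad (j, (~~ q, false)) + rad (j, (~~ q, true))).
  have k4 (a b c d t : X) : t = a + b + (c + d) -> a - b - t = - (b + b + c + d).
    by move=> ->; rewrite key addrA.
  rewrite sum4; case: q; case: e; rewrite ?expr1 ?expr0 ?scaleN1r ?scale1r ?opprB /=;
    apply: k4.
  - by rewrite addrC; congr (_ + _); exact: addrC.
  - by rewrite addrC.
  - by congr (_ + _); exact: addrC.
  - by [].
by rewrite -flip4 scalerDr opprD [X in _ + X = _]addrC addrACA addrA.
Qed.

(** Square-root growth of signed sums is stable under linear operations, so the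
    pieces of the steps can be estimated one by one. *)
Definition sqrt_bounded (L : finType) (A : {set L}) (c : L -> bool) (f : L -> X) (C : R) : Prop :=
  nrm (\sum_(t in A) (-1) ^+ c t *: f t) <= C * Num.sqrt #|A|%:R.

Lemma sqrt_boundedD (L : finType) (A : {set L}) c (f g : L -> X) C D :
  sqrt_bounded A c f C -> sqrt_bounded A c g D ->
  sqrt_bounded A c (fun t => f t + g t) (C + D).
Proof.
rewrite /sqrt_bounded => hf hg; under eq_bigr do rewrite scalerDr.
by rewrite big_split/= mulrDl; apply: le_trans (nrmD _ _ _) (lerD hf hg).
Qed.

Lemma sqrt_boundedZ (L : finType) (A : {set L}) c (f : L -> X) C (a : K) :
  sqrt_bounded A c f C -> sqrt_bounded A c (fun t => a *: f t) (nrm a * C).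
Proof.
rewrite /sqrt_bounded => hf.
under eq_bigr do rewrite scalerA mulrC -scalerA.
by rewrite -scaler_sumr nrmZ -mulrA ler_wpM2l// nrm_ge0.
Qed.

Lemma sqrt_boundedN (L : finType) (A : {set L}) c (f : L -> X) C :
  sqrt_bounded A c f C -> sqrt_bounded A c (fun t => - f t) C.
Proof.
rewrite /sqrt_bounded => hf; under eq_bigr do rewrite scalerN.
by rewrite sumrN nrmN.
Qed.

Lemma sqrt_bounded_eq (L : finType) (A : {set L}) c (f g : L -> X) C :
  {in A, f =1 g} -> sqrt_bounded A c g C -> sqrt_bounded A c f C.
Proof.
move=> fg; rewrite /sqrt_bounded; congr (nrm _ <= _).
by apply: eq_bigr => t tA; rewrite fg.
Qed.

Lemma sqrt_bounded_rad n (L : finType) (A : {set L}) c (phi : L -> cell n) (b : cell n) :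
  {in A &, injective phi} -> (forall s, s \in A -> block (phi s) = b) ->
  sqrt_bounded A c (fun t => rad (phi t)) 1.
Proof. by move=> inj hb; rewrite /sqrt_bounded mul1r; exact: rad_sum_le hb. Qed.

(** Shifts in the class of [g] keep every piece of the steps in its block: at the
    level of the shifts the types of the pieces differ from [g], and at the two
    neighbouring levels the parity differs. *)
Lemma szankowski_step_sqrt n (j : bits n.+1) g (c : bits n.+1 -> bool) :
  sqrt_bounded (shifts n g) c (fun s => szankowski_step (bxor j s, g)) 5.
Proof.
have sh s : s \in shifts n g -> s.2 = false /\ s.1 \in supported (bit_class n.+1 g) n.
  by rewrite !inE => /andP[sG /eqP ->]; rewrite sG.
case: g sh => q e sh.
have x1 h : h != (q, e) -> sqrt_bounded (shifts n (q, e)) c (fun s => rad ((bxor j s, h) : cell n.+1)) 1.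
  move=> hg; apply: (@sqrt_bounded_rad _ _ _ _ _ (brestr (bit_class n.+1 h) j, h)).
    by move=> s t _ _ /(congr1 fst)/(@bxor_injr n.+1 j).
  move=> s /sh[s2 s1]; rewrite /block /=; congr pair; congr pair.
    apply: brestr_disjoint s1 => p; apply: bit_class_disjoint; right; by rewrite eq_sym.
  by rewrite s2 addbF.
have x2 h : sqrt_bounded (shifts n (q, e)) c (fun s => rad (((bxor j s, q), h) : cell n.+2)) 1.
  apply: (@sqrt_bounded_rad _ _ _ _ _ (brestr (bit_class n.+2 h) ((j, q) : bits n.+2), h)).
    by move=> s t _ _ /(congr1 (fst \o fst))/(@bxor_injr n.+1 j).
  move=> s /sh[s2 s1]; rewrite /block /=; congr pair; congr pair; congr pair.
    apply: brestr_disjoint s1 => p; apply: bit_class_disjoint; left; by rewrite /=; case: odd.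
  by rewrite s2 addbF.
have x0 h : sqrt_bounded (shifts n (q, e)) c
    (fun s => rad (((bxor j s).1, ((bxor j s).2, h)) : cell n)) 1.
  apply: (@sqrt_bounded_rad _ _ _ _ _ (brestr (bit_class n (j.2, h)) j.1, (j.2, h))).
    move=> s t /sh[s2 _] /sh[t2 _] /= [/bxor_injr st _].
    by rewrite (surjective_pairing s) (surjective_pairing t) s2 t2 st.
  move=> s /sh[s2 s1]; rewrite /block /= s2 addbF; congr pair.
  apply: brestr_disjoint s1 => p; apply: bit_class_disjoint; left; by rewrite /=; case: odd.
have qe1 : (q, ~~ e) != (q, e) by rewrite -pair_eqE /= eqxx; case: (e).
have qe2 e' : (~~ q, e') != (q, e) by rewrite -pair_eqE /=; case: (q).
(* Half of ten pieces: four of the level of the shifts, four of the next level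
   and two of the level below. *)
have -> : 5 = nrm (2^-1 : K) *
    ((1 + 1 + 1 + 1) + nrm ((-1) ^+ e : K) * (1 + 1 + (1 + 1)) + (1 + 1)).
  by rewrite nrm_half nrm_sign; lra.
apply: sqrt_bounded_eq (fun s _ => szankowski_step_expand (bxor j s) q e) _.
apply/sqrt_boundedZ/sqrt_boundedD; last first.
  by apply/sqrt_boundedN/sqrt_boundedD => //; exact: sqrt_boundedN.
apply: sqrt_boundedD.
  apply: sqrt_boundedN; apply: sqrt_boundedD; last exact: x1.
  by apply: sqrt_boundedD; [apply: sqrt_boundedD; exact: x1|exact: x1].
apply: sqrt_boundedZ; apply: sqrt_bounded_eq (fun s _ => sum4 _) _.
by apply: sqrt_boundedD; apply: sqrt_boundedD; exact: x2.
Qed.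

(** Unlike the pieces of the steps, the cells of type [g] themselves are moved to
    distinct blocks, because their blocks record the bits that are shifted. *)
Lemma shifts_inj n (j : bits n.+1) g :
  {in shifts n g &, injective (fun s => block ((bxor j s, g) : cell n.+1))}.
Proof.
move=> s t; rewrite !inE => /andP[sG /eqP s2] /andP[tG /eqP t2] /= [].
move=> h _; rewrite (surjective_pairing s) (surjective_pairing t) s2 t2; congr pair.
by apply: (brestr_inj_supported (j := j.1)) h; rewrite inE.
Qed.

Lemma sum_shifts (V : nmodType) n g (f : bits n.+1 -> V) :
  \sum_j \sum_(s in shifts n g) f (bxor j s) = (\sum_j f j) *+ #|shifts n g|.
Proof. exact: sum_shift. Qed.

End Rademacher.

(** * A subspace without compact approximation *)

Lemma sum_bits (V : nmodType) n (F : bits n.+1 -> V) :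
  \sum_i F i = \sum_(j : bits n) (F (j, false) + F (j, true)).
Proof.
transitivity (\sum_(j : bits n) \sum_(q : bool) F (j, q)).
  by rewrite pair_bigA; apply: eq_bigr => -[].
by apply: eq_bigr => j _; rewrite big_bool addrC.
Qed.

Section Szankowski.
Variables (R : realType) (K : numFieldType) (S : scalars R K).
Local Notation nrm := (nrm S).
Local Notation emb := (emb S).
Variable X : completeNormedModType K.
Variable Y : closedSubspace X.
Variable v : forall m, rad_index m -> X.
Variable U : forall m, rad_index m -> X -> K^o.
Arguments v {m}.
Arguments U {m}.
Variable C : R.
Hypothesis C0 : 0 <= C.
Hypothesis vY : forall m (i : rad_index m), carrier Y (v i).
Hypothesis v1 : forall m (i : rad_index m), nrm (v i) = 1.
Hypothesis lU : forall m (i : rad_index m), linear (U i).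
Hypothesis leU : forall m (i : rad_index m) x, nrm (U i x) <= C * nrm x.
Hypothesis UE : forall m (i : rad_index m) c M,
  U i (levels_sum (@v) c M) = if (m < M)%N then c m i else 0.
Hypothesis Uj : forall m x, closure (levels_span (@v)) x ->
  \sum_(i : rad_index m) nrm (U i x) <= C * nrm x.
Hypothesis U0 : forall x (e : R), closure (levels_span (@v)) x -> 0 < e ->
  exists N, forall m, (N <= m)%N -> \sum_(i : rad_index m) nrm (U i x) <= e.

Local Notation rad := (rad (@v)).
Local Notation rad_dual := (rad_dual (@U)).
Local Notation mass := (level_mass S (@U)).
Local Notation szankowski_vec := (szankowski_vec (@v)).
Local Notation upper := (upper_dual (@U)).
Local Notation lower := (lower_dual (@U)).

Lemma lower_dual_le n (j : bits n) w : nrm (lower j w) <= mass n w.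
Proof.
rewrite /lower_dual nrmM.
have -> : nrm (4^-1 : K) = 4^-1.
  have -> : 4^-1 = emb 4^-1 :> K by rewrite fmorphV rmorph_nat.
  by rewrite nrm_emb ger0_norm ?invr_ge0.
rewrite mulrC ler_pdivrMr//; apply: le_trans (nrm_sum _ _ _ _) _.
apply: (@le_trans _ _ (\sum_(h : bool * bool) mass n w)).
  by apply: ler_sum => h _; exact: rad_dual_le.
by rewrite sumr_const card_prod card_bool -[leLHS]mulr_natr.
Qed.

Lemma level_mass_le n w : mass n w <= #|rad_index n|%:R * C * nrm w.
Proof.
apply: (@le_trans _ _ (\sum_(i : rad_index n) C * nrm w)).
  by apply: ler_sum => i _; exact: leU.
by rewrite sumr_const -[leLHS]mulr_natl mulrA.
Qed.

(** Defined by the equality of the two expressions instead of as a closed span: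
    that equality is then available on all its vectors. *)
Definition szankowski_set : set X := [set w | [/\ carrier Y w, closure (levels_span (@v)) w &
  forall n (i : bits n.+1), upper i w = lower i w]].

Lemma szankowski_set0 : szankowski_set 0.
Proof.
split; first exact: carrier0.
  apply: subset_closure; exists (fun _ _ => 0), 0%N.
  by rewrite /levels_sum big_ord0.
by move=> n i; rewrite (lin0 (upper_dual_lin lU i)) (lin0 (lower_dual_lin lU i)).
Qed.

Lemma closure_levelsL a x y : closure (levels_span (@v)) x ->
  closure (levels_span (@v)) y -> closure (levels_span (@v)) (a *: x + y).
Proof.
move=> /(closure_nrm S) hx /(closure_nrm S) hy; apply/(closure_nrm S) => e e0.
have na : 0 < nrm a + 1 by rewrite ltr_wpDl// nrm_ge0.
have [x' x's xx'] := hx (e / 2 / (nrm a + 1)) (divr_gt0 (divr_gt0 e0 (ltr0n _ 2)) na).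
have [y' y's yy'] := hy (e / 2) (divr_gt0 e0 (ltr0n _ 2)).
exists (a *: x' + y'); first exact: levels_spanL.
rewrite opprD addrACA -scalerBr; apply: le_lt_trans (nrmD _ _ _) _.
move: xx'; rewrite nrmZ ltr_pdivlMr//; have := nrm_ge0 S (x - x'); lra.
Qed.

Lemma szankowski_setL a x y : szankowski_set x -> szankowski_set y -> szankowski_set (a *: x + y).
Proof.
move=> [Yx clx ex] [Yy cly ey]; split; first exact: carrierL.
  exact: closure_levelsL.
move=> n i; rewrite (upper_dual_lin lU i a x y) (lower_dual_lin lU i a x y).
by rewrite ex ey.
Qed.

Lemma szankowski_closed : closed szankowski_set.
Proof.
apply/(closed_nrm S) => x hx; split.
- apply: ((closed_nrm S _).1 (@carrier_closed _ _ Y) x) => e e0.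
  by have [y [Yy _ _] xy] := hx e e0; exists y.
- apply: ((closed_nrm S _).1 (@closed_closure _ (levels_span (@v))) x) => e e0.
  by have [y [_ cly _] xy] := hx e e0; exists y.
move=> n i; apply/eqP; rewrite -subr_eq0; apply/eqP/(nrm_eq0 (S := S))/eqP.
rewrite eq_le nrm_ge0 andbT; apply/ler_addgt0Pr => e e0; rewrite add0r.
pose B := #|rad_index n|%:R * C + #|rad_index n.+1|%:R * C.
have B0 : 0 <= B by rewrite addr_ge0// mulr_ge0.
have B1 : 0 < B + 1 by rewrite ltr_wpDl.
have [y [_ _ ye] xy] := hx _ (divr_gt0 e0 B1).
have -> : upper i x - lower i x = upper i (x - y) - lower i (x - y).
  rewrite (linB (upper_dual_lin lU i)) (linB (lower_dual_lin lU i)) ye.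
  by rewrite opprB addrA subrK.
apply: le_trans (nrmB _ _ _) _.
have := upper_dual_le S (@U) i (x - y); have := lower_dual_le i (x - y).
have := level_mass_le n (x - y); have := level_mass_le n.+1 (x - y).
move: xy; rewrite ltr_pdivlMr// /B; have := nrm_ge0 S (x - y); lra.
Qed.

Definition szankowski_space : closedSubspace X :=
  ClosedSubspace szankowski_set0 szankowski_setL szankowski_closed.

Lemma rad_levels n (k : cell n) : carrier Y (rad k) /\ levels_span (@v) (rad k).
Proof.
split; first by apply: carrier_sum => i _; apply: carrierZ; exact: vY.
have [c cE] := extend_level (rad_coef K k).
have -> : rad k = (-1) *: levels_sum (@v) c n + levels_sum (@v) c n.+1.
  by rewrite scaleN1r addrC /levels_sum big_ord_recr/= [X in X - _]addrC addrK /level_sum cE.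
by apply: levels_spanL; [exists c, n|exists c, n.+1].
Qed.

Lemma szankowski_vec_in n (i : bits n.+1) : carrier szankowski_space (szankowski_vec i).
Proof.
have spanD x y : levels_span (@v) x -> levels_span (@v) y -> levels_span (@v) (x + y).
  by move=> hx hy; rewrite -[x]scale1r; exact: levels_spanL.
have spanN x : levels_span (@v) x -> levels_span (@v) (- x).
  move=> hx; rewrite -[- x]addr0 -scaleN1r; apply: levels_spanL => //.
  by exists (fun _ _ => 0), 0%N; rewrite /levels_sum big_ord0.
split=> [||m i']; last exact: upper_lower_szankowski.
  apply: carrierD; last by apply: carrier_sum => h _; exact: (rad_levels _).1.
  by apply: carrierB; exact: (rad_levels _).1.
apply: subset_closure; apply: (spanD).
  by apply: spanD; [|apply: spanN]; exact: (rad_levels _).2.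
elim/big_ind : _ => [|//|h _]; last exact: (rad_levels _).2.
by exists (fun _ _ => 0), 0%N; rewrite /levels_sum big_ord0.
Qed.

(** If [n] vectors spanned the space, biorthogonality would factor an identity
    matrix of size 2^(n+1) through dimension [n]. *)
Lemma szankowski_infinite_dim : infinite_dim szankowski_space.
Proof.
apply/infinite_dimP => -[n [b [_ hb]]].
have /choice[c cE] (i : bits n.+1) : exists c : 'I_n -> K, szankowski_vec i = \sum_(l < n) c l *: b l.
  exact: hb (szankowski_vec_in i).
pose N := #|bits n.+1|.
pose A : 'M[K]_(N, n) := \matrix_(i, l) c (enum_val i) l.
pose B : 'M[K]_(n, N) := \matrix_(l, k) upper (enum_val k) (b l).
have AB : A *m B = 1%:M.
  apply/matrixP => i k; rewrite !mxE.
  have := upper_dual_szankowski_same (v := @v) lU UE (enum_val k) (enum_val i).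
  have lu := upper_dual_lin lU (enum_val k : bits n.+1).
  rewrite cE (lin_sum lu) => h.
  rewrite (inj_eq enum_val_inj) eq_sym in h; rewrite -h; apply: eq_bigr => l _.
  by rewrite !mxE (linZ lu).
have : (N <= n)%N.
  by rewrite -(mxrank1 K N) -AB (leq_trans (mxrankM_maxl _ _))// rank_leq_col.
by rewrite leqNgt /N card_bits (leq_trans _ (ltn_expl n.+1 (ltnSn 1)))// .
Qed.

Local Notation Z := szankowski_space.

Definition szankowskiZ n (i : bits n.+1) : Z := in_subspace (szankowski_vec_in i).

(** The mean beta_n(T) of the diagonal entries of T over one level of the
    biorthogonal system. *)
Definition average_trace n (T : Z -> Z) : K :=
  2^-1 ^+ n.+1 * \sum_(i : bits n.+1) upper i (incl (T (szankowskiZ i))).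

Lemma mass_incl n (w : Z) : mass n (incl w) <= C * nrm w.
Proof. by apply: Uj; case: (carrier_incl w). Qed.

Lemma szankowski_upper_lower n (i : bits n.+1) (w : Z) :
  upper i (incl w) = lower i (incl w).
Proof. by case: (carrier_incl w). Qed.

Definition stepZ n (k : cell n.+1) : Z :=
  2^-1 *: ((-1) ^+ k.2.2 *: szankowskiZ ((k.1, k.2.1) : bits n.+2) - szankowskiZ k.1).

Lemma incl_stepZ n (k : cell n.+1) : incl (stepZ k) = szankowski_step (@v) k.
Proof.
have l := @incl_lin K X Z.
by rewrite /stepZ (linZ l) (linB l) (linZ l).
Qed.

Section Trace.
Variables (T : Z -> Z) (B : R).
Hypothesis (lT : linear T) (B0 : 0 <= B) (TB : forall x, nrm (T x) <= B * nrm x).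

(** The first trace is taken with the upper functionals of level n + 1 and the
    second with the lower ones of level n. Both are combinations of the
    functionals [rad_dual] of level n + 1, so the difference can be collected
    cell by cell. *)
Lemma average_trace_diff n : average_trace n.+1 T - average_trace n T =
  2^-1 ^+ n.+2 * \sum_(g : bool * bool) \sum_(j : bits n.+1)
     rad_dual ((j, g) : cell n.+1) (incl (T (stepZ (j, g)))).
Proof.
rewrite /average_trace.
have -> : 2^-1 ^+ n.+1 * \sum_(i : bits n.+1) upper i (incl (T (szankowskiZ i))) =
    2^-1 ^+ n.+2 * \sum_(i : bits n.+1) 2 * lower i (incl (T (szankowskiZ i))) :> K.
  have -> : (2^-1 : K) ^+ n.+1 = 2^-1 ^+ n.+2 * 2 by rewrite [in RHS]exprSr mulfVK// pnatr_eq0.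
  rewrite -mulrA mulr_sumr; congr (_ * _); apply: eq_bigr => i _.
  by rewrite szankowski_upper_lower.
rewrite -mulrBr; congr (_ * _).
rewrite [RHS]exchange_big sum_bits -sumrB; apply: eq_bigr => j _.
rewrite sum4 /upper_dual /lower_dual sum4 [(_, _).1]/= [(_, _).2]/=.
have li := @incl_lin K X Z.
have E (q e : bool) : rad_dual (j, (q, e)) (incl (T (stepZ (j, (q, e))))) =
    2^-1 * ((-1) ^+ e * rad_dual (j, (q, e)) (incl (T (szankowskiZ ((j, q) : bits n.+2)))) -
            rad_dual (j, (q, e)) (incl (T (szankowskiZ j)))).
  have l := rad_dual_lin lU ((j, (q, e)) : cell n.+1).
  by rewrite /stepZ (linZ lT) (linB lT) (linZ lT) (linZ li) (linB li) (linZ li) (linZ l) (linB l) (linZ l).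
rewrite !E !expr0 !expr1.
have -> : 4^-1 = 2^-1 * 2^-1 :> K by rewrite -invfM -natrM.
have h2 : 2 * 2^-1 = 1 :> K by rewrite divff ?pnatr_eq0.
set h := 2^-1 in h2 *.
have -> : forall x, 2 * (h * h * x) = (2 * h) * h * x :> K by move=> x; ring.
by rewrite h2; ring.
Qed.

(** Decoupled by signs, the diagonal sum becomes a mean of sums of functionals
    applied to T of one signed sum of steps. The functionals lie on distinct
    blocks and are jointly bounded, and the signed sum is of the order of the
    square root of the number of shifts. *)
Lemma trace_shift_le n (g : bool * bool) (j : bits n.+1) :
  nrm (\sum_(s in shifts n g) rad_dual ((bxor j s, g) : cell n.+1)
         (incl (T (stepZ (bxor j s, g))))) <=
  C * (B * (5 * Num.sqrt #|shifts n g|%:R)).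
Proof.
set Q := C * _; pose A := shifts n g.
pose N := sign_count (bits n.+1).
have N0 : 0 < N%:R :> R by rewrite ltr0n sign_count_gt0.
have idA : {in A &, injective (@id (bits n.+1))} by move=> s t _ _.
have nrmN (x : K) : N%:R * nrm x = nrm (N%:R * x).
  by rewrite nrmM -(rmorph_nat emb) nrm_emb ger0_norm ?ler0n.
rewrite -(ler_pM2l N0) nrmN.
rewrite (@sign_decoupling K (bits n.+1) (bits n.+1) id A
  (fun s t => rad_dual ((bxor j s, g) : cell n.+1) (incl (T (stepZ (bxor j t, g))))) idA).
have -> : \sum_(eta : {ffun bits n.+1 -> bool}) \sum_(s in A) \sum_(t in A)
    (-1) ^+ eta s * (-1) ^+ eta t * rad_dual ((bxor j s, g) : cell n.+1) (incl (T (stepZ (bxor j t, g)))) =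
  \sum_(eta : {ffun bits n.+1 -> bool}) \sum_(s in A)
    (-1) ^+ eta s * rad_dual ((bxor j s, g) : cell n.+1)
      (incl (T (\sum_(t in A) (-1) ^+ eta t *: stepZ (bxor j t, g)))).
  apply: eq_bigr => eta _; apply: eq_bigr => s _.
  have l := rad_dual_lin lU ((bxor j s, g) : cell n.+1).
  rewrite (lin_sum lT) (lin_sum (@incl_lin K X Z)) (lin_sum l) mulr_sumr.
  apply: eq_bigr => t _.
  rewrite (linZ lT _ (stepZ _)) (linZ (@incl_lin K X Z) _ (T (stepZ _))) (linZ l _ (incl (T (stepZ _)))).
  exact: (esym (mulrA _ _ _)).
apply: le_trans (nrm_sum _ _ _ _) _.
apply: (@le_trans _ _ (\sum_(eta : {ffun bits n.+1 -> bool}) Q)); last first.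
  by rewrite sumr_const -[leLHS]mulr_natl.
apply: ler_sum => eta _.
apply: le_trans (rad_dual_sum_le S (@U) (fun s => eta s) _ (@shifts_inj n j g)) _.
apply: le_trans (mass_incl _ _) _; rewrite ler_wpM2l//.
apply: le_trans (TB _) _; rewrite ler_wpM2l// -nrm_incl (lin_sum (@incl_lin K X Z)).
under eq_bigr do rewrite (linZ (@incl_lin K X Z)) incl_stepZ.
exact: (szankowski_step_sqrt v1).
Qed.

(** Every string lies in as many translates of the set of shifts as there are
    shifts. Adding the previous estimates over all translates and dividing by
    that number leaves the inverse of its square root. *)
Lemma average_trace_diff_le n :
  nrm (average_trace n.+1 T - average_trace n T) <= B * (10 * C * rho ^- 16) * rho ^+ n.
Proof.
rewrite average_trace_diff nrmM.
have -> : nrm (2^-1 ^+ n.+2 : K) = 2^-1 ^+ n.+2.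
  by rewrite (half_emb S) -rmorphXn nrm_emb ger0_norm// exprn_ge0.
have key g : nrm (\sum_(j : bits n.+1) rad_dual ((j, g) : cell n.+1) (incl (T (stepZ (j, g))))) <=
    2 ^+ n.+1 * (5 * C * B * (rho ^- 16 * rho ^+ n)).
  pose q : R := #|shifts n g|%:R.
  have q0 : 0 < q by rewrite ltr0n card_shifts supported_gt0.
  have E (x : K) : q * nrm x = nrm (x *+ #|shifts n g|).
    by rewrite -mulr_natl nrmM -(rmorph_nat emb) nrm_emb ger0_norm ?ler0n.
  have sq : Num.sqrt q * Num.sqrt q = q by rewrite -expr2 sqr_sqrtr// ltW.
  have sq0 : 0 < Num.sqrt q by rewrite sqrtr_gt0.
  have dec : (Num.sqrt q)^-1 <= rho ^- 16 * rho ^+ n by rewrite /q card_shifts; exact: bit_class_sqrt_decay.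
  rewrite -(ler_pM2l q0) E -(sum_shifts g (fun j => rad_dual ((j, g) : cell n.+1) (incl (T (stepZ (j, g)))))).
  apply: le_trans (nrm_sum _ _ _ _) _.
  apply: (@le_trans _ _ (\sum_(j : bits n.+1) C * (B * (5 * Num.sqrt q)))).
    by apply: ler_sum => j _; exact: trace_shift_le.
  rewrite sumr_const card_bits -[leLHS]mulr_natl natrX [leRHS]mulrCA ler_pM2l ?exprn_gt0//.
  have d1 := ler_wpM2l (ltW sq0) dec; rewrite divff ?gt_eqF// in d1.
  have d2 := ler_wpM2l (ltW sq0) d1; rewrite mulr1 (mulrA (Num.sqrt q) (Num.sqrt q)) sq in d2.
  have := ler_wpM2l (mulr_ge0 (mulr_ge0 (ler0n R 5) C0) B0) d2; lra.
have : nrm (\sum_(g : bool * bool) \sum_(j : bits n.+1)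
     rad_dual ((j, g) : cell n.+1) (incl (T (stepZ (j, g))))) <=
     4 * (2 ^+ n.+1 * (5 * C * B * (rho ^- 16 * rho ^+ n))).
  apply: le_trans (nrm_sum _ _ _ _) _.
  apply: le_trans (ler_sum _ (fun g _ => key g)) _.
  by rewrite sumr_const card_prod card_bool -[leLHS]mulr_natl.
have p0 : 0 <= (2^-1 : R) ^+ n.+2 by rewrite exprn_ge0.
move=> /(ler_wpM2l p0) h; apply: le_trans h _.
have -> : (2^-1 : R) ^+ n.+2 = 2^-1 * 2^-1 ^+ n.+1 by rewrite exprS.
have h2 : (2^-1 : R) ^+ n.+1 * 2 ^+ n.+1 = 1 by rewrite -exprMn mulVf ?expr1n// pnatr_eq0.
have -> : forall a b c d : R, 2^-1 * a * (4 * (b * (5 * c * B * d))) = a * b * (2^-1 * 20 * c * B * d).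
  by move=> *; ring.
by rewrite h2; lra.
Qed.

(** Summation of a geometric series, with 32 = 1 / (1 - rho). *)
Lemma average_trace_tail n d :
  nrm (average_trace (n + d) T - average_trace n T) <=
  B * (10 * C * rho ^- 16) * 32 * (rho ^+ n - rho ^+ (n + d)).
Proof.
elim: d => [|d IH]; first by rewrite addn0 !subrr nrm0 mulr0.
have := average_trace_diff_le (n + d).
have := nrm_dist S (average_trace (n + d).+1 T) (average_trace (n + d) T) (average_trace n T).
have e1 : rho ^+ (n + d).+1 = (1 - 32^-1) * rho ^+ (n + d) :> R by rewrite exprS.
rewrite addnS e1; move: IH.
set Q := B * _; set r := _ ^+ n; set r' := _ ^+ (n + d).
lra.
Qed.

End Trace.

Lemma average_traceB n (T T' : Z -> Z) :
  average_trace n (fun x => T x - T' x) = average_trace n T - average_trace n T'.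
Proof.
rewrite /average_trace -mulrBr -sumrB; congr (_ * _); apply: eq_bigr => i _.
by rewrite (linB (@incl_lin K X Z)) (linB (upper_dual_lin lU i)).
Qed.

Lemma average_trace_id n : average_trace n id = 1.
Proof.
rewrite /average_trace; under eq_bigr do rewrite (upper_dual_szankowski_same lU UE) eqxx.
rewrite sumr_const card_bits -[_ *+ (_ ^ _)]mulr_natl mulr1 natrX -exprMn.
by rewrite mulVf ?expr1n// pnatr_eq0.
Qed.

Lemma average_trace_le n (T : Z -> Z) (e : R) :
  (forall i : bits n.+1, mass n (incl (T (szankowskiZ i))) <= e) ->
  nrm (average_trace n T) <= e.
Proof.
move=> h; rewrite /average_trace nrmM.
have -> : nrm (2^-1 ^+ n.+1 : K) = 2^-1 ^+ n.+1.
  by rewrite (half_emb S) -rmorphXn nrm_emb ger0_norm// exprn_ge0.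
rewrite exprVn mulrC ler_pdivrMr ?exprn_gt0//.
apply: le_trans (nrm_sum _ _ _ _) _.
apply: (@le_trans _ _ (\sum_(i : bits n.+1) e)).
  by apply: ler_sum => i _; apply: le_trans (h i); exact: upper_dual_le.
by rewrite sumr_const card_bits -[leLHS]mulr_natr natrX.
Qed.

(** Far levels carry little of the finitely many points of a net of the image of
    the unit ball. *)
Lemma average_trace_compact (T : Z -> Z) (e : R) : linear T ->
  totally_bounded_map S T -> 0 < e ->
  exists N, forall n, (N <= n)%N -> nrm (average_trace n T) <= e.
Proof.
move=> lT tbT e0.
have C1 : 0 < 12 * (C + 1) by rewrite mulr_gt0// ltr_wpDl.
have [D hD] := tbT _ (divr_gt0 e0 C1).
have e12 : 0 < e / 12 by rewrite divr_gt0.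
have [N hN] : exists N, forall n d, (N <= n)%N -> d \in D -> mass n (incl d) <= e / 12.
  elim: (D) => [|d D' [N IH]]; first by exists 0%N.
  have cl : closure (levels_span (@v)) (incl d) by case: (carrier_incl d).
  have [N' hN'] := U0 cl e12.
  exists (maxn N N') => n d'; rewrite geq_max => /andP[Nn N'n].
  by rewrite inE => /orP[/eqP ->|/IH]; [exact: hN'|apply].
exists N => n Nn; apply: average_trace_le => i.
(* The vectors have norm at most 6. *)
have [|d dD xd] := hD (emb 6^-1 *: szankowskiZ i).
  rewrite nrmZr ger0_norm ?invr_ge0// mulrC ler_pdivrMr// mul1r.
  exact: (nrm_szankowski v1 i).
have -> : szankowskiZ i = emb 6 *: (emb 6^-1 *: szankowskiZ i).
  by rewrite scalerA -rmorphM divff ?pnatr_eq0// rmorph1 scale1r.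
move: (emb 6^-1 *: szankowskiZ i) xd => x xd.
have -> : T (emb 6 *: x) = emb 6 *: ((T x - d) + d) by rewrite subrK (linZ lT).
have li := @incl_lin K X Z.
apply: (@le_trans _ _ (6 * (mass n (incl (T x - d)) + mass n (incl d)))).
  rewrite /level_mass -big_split mulr_sumr; apply: ler_sum => i' _.
  rewrite (linZ li) (linD li) (linZ (lU i')) (linD (lU i')).
  have -> : emb 6 *: (U i' (incl (T x - d)) + U i' (incl d)) =
    emb 6 * (U i' (incl (T x - d)) + U i' (incl d)) by [].
  by rewrite nrmM nrm_emb ger0_norm// ler_pM2l// nrmD.
have := hN n d Nn dD; have := mass_incl n (T x - d).
move: xd; rewrite ltr_pdivlMr//; have := nrm_ge0 S (T x - d); lra.
Qed.

Lemma rho_pow_small (c e : R) : 0 < e -> exists n, c * rho ^+ n < e.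
Proof.
move=> e0; have h : `|rho : R| < 1 by rewrite /rho ger0_norm; lra.
have c1 : 0 < `|c| + 1 by have := normr_ge0 c; lra.
have /cvgrPdist_lt/(_ _ (divr_gt0 e0 c1))[N _ hN] := cvg_expr h.
exists N; have := hN N (leqnn N); rewrite sub0r normrN.
have r0 : 0 <= (rho : R) ^+ N by rewrite exprn_ge0// /rho; lra.
rewrite ger0_norm// ltr_pdivlMr//; have := ler_norm c; nra.
Qed.

(** Let D = I - T_h. At a fixed level n0 only finitely many vectors enter the
    average trace, so that of D is small when h is large. The tail estimate
    keeps it small at all later levels, where it tends to 1 because T_h is
    compact. *)
Theorem szankowski_fails_bcap : fails_bcap S szankowski_space.
Proof.
move=> [T [M [lT TM tbT Tid]]].
have TM' n x : nrm (T n x) <= `|M| * nrm x.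
  by apply: le_trans (TM n x) _; rewrite ler_wpM2r ?nrm_ge0// ler_norm.
pose D n (x : Z) := x - T n x.
have lD n : linear (D n).
  by move=> a x y; rewrite /D (lT n a x y) scalerBr opprD addrACA.
pose B := 1 + `|M|; have B0 : 0 <= B by rewrite addr_ge0.
have DB n x : nrm (D n x) <= B * nrm x.
  by apply: le_trans (nrmB _ _ _) _; have := TM' n x; rewrite /B; lra.
(* The level n0 depends only on the bound of the operators: it has to be fixed
   before h, which depends on the vectors of that level. *)
have [n0 hn0] := rho_pow_small (B * (10 * C * rho ^- 16) * 32) (divr_gt0 ltr01 (ltr0n R 4)).
have e1 : 0 < (1 : R) / (4 * (C + 1)) by rewrite divr_gt0// mulr_gt0// ltr_wpDl.
have [h hh] : exists h, forall i : bits n0.+1, nrm (D h (szankowskiZ i)) < 1 / (4 * (C + 1)).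
  have /choice[N hN] (i : bits n0.+1) : exists N, forall n, (N <= n)%N ->
      nrm (D n (szankowskiZ i)) < 1 / (4 * (C + 1)).
    by have [N hN] := Tid (szankowskiZ i) _ e1; exists N => n Nn; rewrite nrm_distC hN.
  by exists (\max_i N i) => i; apply: hN; exact: leq_bigmax.
have a0 : nrm (average_trace n0 (D h)) <= 4^-1.
  apply: average_trace_le => i; apply: le_trans (mass_incl _ _) _.
  have := hh i; rewrite ltr_pdivlMr; last by rewrite mulr_gt0// ltr_wpDl.
  have := nrm_ge0 S (D h (szankowskiZ i)); lra.
have [N hN] := average_trace_compact (lT h) (tbT h) (divr_gt0 ltr01 (ltr0n R 4)).
have := hN (n0 + N)%N (leq_addl _ _).
have := average_trace_tail (lD h) B0 (DB h) n0 N.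
have : average_trace (n0 + N) (D h) = 1 - average_trace (n0 + N) (T h).
  by rewrite (average_traceB _ id (T h)) average_trace_id.
move=> ->.
have := nrm_dist S 1 (average_trace (n0 + N) (T h)) 0.
have := nrm_dist S (1 - average_trace (n0 + N) (T h)) (average_trace n0 (D h)) 0.
rewrite !subr0 nrm1.
have : 0 <= B * (10 * C * rho ^- 16) * 32 * rho ^+ (n0 + N).
  have r0 : 0 <= rho :> R by rewrite /rho; lra.
  by rewrite !mulr_ge0// ?invr_ge0 exprn_ge0.
rewrite mulrBr; lra.
Qed.

End Szankowski.

Theorem exists_fails_bcap (R : realType) (K : numFieldType) (S : scalars R K)
    (X : completeNormedModType K) (Y : closedSubspace X) :
  (forall W : closedSubspace X, infinite_dim W ->
    exists x : nat -> W, normalized x /\ l1_spreading_model x) ->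
  infinite_dim Y ->
  exists Z : closedSubspace X,
    [/\ carrier Z `<=` carrier Y, infinite_dim Z & fails_bcap S Z].
Proof.
move=> hl1 Yinf.
have [v [vY v1 vl1]] := exists_l1_levels S rad_index hl1 Yinf.
have C0 : 0 <= 32 :> R by [].
have [U [lU leU UE Uj]] := levels_coordinates C0 vl1.
have U0 x e := levels_coordinate_vanish (x := x) (e := e) C0 lU UE Uj.
exists (szankowski_space Y v C0 lU leU); split.
- by move=> x [].
- exact: szankowski_infinite_dim.
- exact: szankowski_fails_bcap.
Qed.

(** * Separability and weak compact generation *)

Section Separability.
Variables (R : realType) (K : numFieldType) (S : scalars R K).
Local Notation nrm := (nrm S).
Local Notation emb := (emb S).

Lemma dense_nrm (V : normedModType K) (D : set V) : dense D <->
  forall x (e : R), 0 < e -> exists2 d, D d & nrm (x - d) < e.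
Proof.
split=> [hD x e e0|hD O [x Ox] oO].
  have ne : [set y | nrm (x - y) < e] !=set0 by exists x; rewrite /= subrr nrm0.
  have op : open [set y | nrm (x - y) < e].
    rewrite openE => y /= xy; apply/(nbhs_nrm S); exists (e - nrm (x - y)).
      by rewrite subr_gt0.
    by move=> z yz /=; have := nrm_dist S x y z; lra.
  by have [d [/= xd Dd]] := hD _ ne op; exists d.
have /(nbhs_nrm S)[e e0 hO] : nbhs x O by apply: open_nbhs_nbhs.
by have [d Dd /hO Od] := hD x e e0; exists d.
Qed.

Lemma separable_seq (V : normedModType K) : separable V <->
  exists d : nat -> V, forall x (e : R), 0 < e -> exists n, nrm (x - d n) < e.
Proof.
split=> [[D cD /dense_nrm hD]|[d hd]].
  have /countable_injP[f finj] := cD.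
  exists (fun n => xget 0 [set d | D d /\ f d = n]) => x e e0.
  have [d Dd xd] := hD x e e0; exists (f d).
  have [|Dd' fd'] := @xgetPex _ 0 [set d' | D d' /\ f d' = f d]; first by exists d.
  by rewrite (finj _ _ _ _ fd')// ?mem_set.
exists (range d); first exact: card_image_le.
by apply/dense_nrm => x e /(hd x)[n xn]; exists (d n) => //; exists n.
Qed.

Lemma inv_succ_small (e : R) : 0 < e -> exists n, n.+1%:R^-1 < e.
Proof.
move=> e0; exists (Num.bound e^-1); rewrite invf_plt ?posrE//.
have h : 0 <= e^-1 by rewrite invr_ge0 ltW.
by apply: lt_le_trans (archi_boundP h) _; rewrite ler_nat.
Qed.

Lemma separable_subspace (X : completeNormedModType K) (Z : closedSubspace X) :
  separable X -> separable Z.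
Proof.
move=> /separable_seq[d hd].
pose g (p : nat * nat) : Z := xget 0 [set z : Z | nrm (d p.1 - incl z) < p.2.+1%:R^-1].
have cD : countable (range g) by exact: card_le_trans (card_image_le _ _) (countableP _).
exists (range g) => //; apply/dense_nrm => z e e0.
have [k hk] := inv_succ_small (divr_gt0 e0 (ltr0n R 2)).
have k0 : 0 < k.+1%:R^-1 :> R by rewrite invr_gt0.
have [n hn] := hd (incl z) _ k0.
exists (g (n, k)); first by exists (n, k).
have ex : exists z' : Z, [set z' : Z | nrm (d n - incl z') < k.+1%:R^-1] z'.
  by exists z; rewrite /= nrm_distC.
have h : nrm (d n - incl (g (n, k))) < k.+1%:R^-1 := xgetPex 0 ex.
rewrite -nrm_incl (linB (@incl_lin _ _ _)).
apply: le_lt_trans (nrm_dist S _ (d n) _) _; rewrite (splitr e).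
by apply: ltrD; [exact: lt_trans hn hk|exact: lt_trans h hk].
Qed.

Lemma null_sequence_compact (X : completeNormedModType K) (w : nat -> X) :
  tends S w 0 -> compact ([set 0] `|` range w).
Proof.
move=> w0 F PF FW; have [h|h] := pselect (cluster F 0); first by exists 0; split=> //; left.
have [A [B [FA B0 AB]]] : exists A B, [/\ F A, nbhs (0 : X) B & A `&` B = set0].
  apply: contrapT => hn; apply: h => A B FA B0; apply/set0P/eqP => AB.
  by apply: hn; exists A, B.
have /(nbhs_nrm S)[e e0 hB] := B0; have [N hN] := w0 e e0.
pose G := [set w i | i in `I_N].
have Gfin : finite_set G by apply: finite_image; exact: finite_II.
have FG : F G.
  apply: filterS (filterI FA FW) => x [Ax [x0|[n _ wn]]].
    exfalso; have : (A `&` B) x; last by rewrite AB.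
    by split=> //; apply: hB; rewrite x0 subrr nrm0.
  have [nN|Nn] := ltnP n N; first by exists n.
  exfalso; have : (A `&` B) x; last by rewrite AB.
  split=> //; apply: hB; rewrite -wn sub0r nrmN -[w n]subr0; exact: hN.
have [p [[n _ wn] clp]] := finite_compact Gfin PF FG.
by exists p; split=> //; right; exists n.
Qed.

Lemma compact_weakly_compact (X : completeNormedModType K) (W : set X) :
  compact W -> weakly_compact W.
Proof.
move=> cW; rewrite /weakly_compact.
pose j (x : X) : weak_topology X := x.
have jc : continuous j.
  apply: continuous_comp_initial => x; apply/cvg_sup => f U [V] [[B] oB <-] Bfx BU.
  apply: (filterS BU).
  have bf : bounded_operator (val f : X -> K^o) by exact: set_mem (valP f).
  have /(nbhs_nrm S)[e e0 hO] : nbhs (val f x : K^o) B by exact: open_nbhs_nbhs.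
  have [lf [C C0 fC]] := (bounded_operatorP S _).1 bf.
  have C1 : 0 < C + 1 by rewrite ltr_wpDl.
  apply/(nbhs_nrm S); exists (e / (C + 1)); first by rewrite divr_gt0.
  move=> y; rewrite ltr_pdivlMr// => xy; apply: hO.
  rewrite -(linB lf); apply: le_lt_trans (fC _) _.
  by have := nrm_ge0 S (x - y); lra.
have -> : W = j @` W by apply/seteqP; split=> [x Wx|_ [x Wx <-]//]; exists x.
by apply: continuous_compact => //; exact: continuous_subspaceT.
Qed.

(** A dense sequence, scaled so as to tend to 0, is norm compact together with
    its limit, hence weakly compact; scaling preserves the span. *)
Lemma separable_WCG (X : completeNormedModType K) : separable X -> WCG X.
Proof.
move=> /separable_seq[d hd].
pose c n : R := (n.+1%:R * (1 + nrm (d n)))^-1.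
have c0 n : 0 < n.+1%:R * (1 + nrm (d n)).
  by rewrite mulr_gt0// ltr_pwDl// nrm_ge0.
pose w n := emb (c n) *: d n.
exists ([set 0] `|` range w).
  apply/compact_weakly_compact/null_sequence_compact => e e0.
  have [N hN] := inv_succ_small e0; exists N => n Nn; rewrite subr0 /w nrmZr.
  rewrite ger0_norm; last by rewrite invr_ge0 ltW.
  apply: le_lt_trans hN; rewrite /c invfM -mulrA -[leRHS]mulr1.
  apply: ler_pM; rewrite ?invr_ge0//.
  - by rewrite mulr_ge0 ?invr_ge0 ?addr_ge0 ?nrm_ge0.
  - by rewrite lef_pV2 ?posrE// ler_nat.
  - by rewrite mulrC ler_pdivrMr ?mul1r ?ltr_pwDl ?nrm_ge0//; lra.
apply/dense_nrm => x e /(hd x)[n xn]; exists (d n) => //.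
exists 1%N, (fun=> (emb (c n))^-1), (fun=> w n); split=> [_|]; first by right; exists n.
rewrite big_ord1 /w scalerA mulVf ?scale1r// fmorph_eq0 invr_eq0 gt_eqF//.
Qed.

End Separability.

(** * Properties inherited by closed subspaces *)

Section Inheritance.
Variables (R : realType) (K : numFieldType) (S : scalars R K).
Local Notation nrm := (nrm S).
Local Notation emb := (emb S).
Variable X : completeNormedModType K.

Lemma full_closed : closed [set: X]. Proof. exact: closedT. Qed.

Definition full_subspace : closedSubspace X :=
  @ClosedSubspace K X [set: X] Logic.I (fun _ _ _ _ _ => Logic.I) full_closed.

Lemma full_infinite_dim : infinite_dim X -> infinite_dim full_subspace.
Proof.
move=> h; apply/infinite_dimP => -[n [b [_ hb]]]; apply: h; exists n, b => x.
exact: hb.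
Qed.

Section Sub.
Variable Z : closedSubspace X.
Let li := @incl_lin K X Z.

Section Push.
Variable A : closedSubspace Z.

Definition push_set : set X := [set incl z | z in carrier A].

Lemma push_set0 : push_set 0.
Proof. by exists 0; [exact: carrier0|exact: lin0 li]. Qed.

Lemma push_setL a u v : push_set u -> push_set v -> push_set (a *: u + v).
Proof.
move=> [x Ax <-] [y Ay <-]; exists (a *: x + y); first exact: carrierL.
exact: li.
Qed.

Lemma push_closed : closed push_set.
Proof.
apply/(closed_nrm S) => x hx.
have Zx : carrier Z x.
  apply: ((closed_nrm S _).1 (@carrier_closed _ _ Z) x) => e e0.
  by have [_ [z Az <-] xz] := hx e e0; exists (incl z) => //; exact: carrier_incl.
exists (in_subspace Zx) => //; apply: ((closed_nrm S _).1 (@carrier_closed _ _ A)) => e e0.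
by have [_ [z Az <-] xz] := hx e e0; exists z.
Qed.

(** A subspace of a subspace seen in the ambient space, where hypotheses on all
    subspaces apply to it. *)
Definition push : closedSubspace X := ClosedSubspace push_set0 push_setL push_closed.

Lemma push_incl z : carrier push (incl z) <-> carrier A z.
Proof. by split=> [[y Ay /incl_inj <-]//|Az]; exists z. Qed.

Lemma push_infinite_dim : infinite_dim A -> infinite_dim push.
Proof.
move=> /infinite_dimP h; apply/infinite_dimP => -[n [b [Ab hb]]]; apply: h.
have /choice[z zP] i : exists z, carrier A z /\ incl z = b i.
  by have [z Az zb] := Ab i; exists z.
exists n, z; split=> [i|x Ax]; first by case: (zP i).
have [c xE] := hb (incl x) ((push_incl x).2 Ax); exists c; apply: incl_inj.
rewrite xE (lin_sum li); apply: eq_bigr => i _.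
by rewrite (linZ li); case: (zP i) => _ ->.
Qed.

End Push.

Lemma hereditarily_indecomposable_subspace :
  hereditarily_indecomposable X -> hereditarily_indecomposable Z.
Proof.
move=> hX Z' A B Z'inf Ainf Binf [ZAB AB0 [M hM]].
apply: (hX (push Z') (push A) (push B)); try exact: push_infinite_dim.
split.
- apply/seteqP; split=> [_ [z Zz <-]|_ [_ [a Aa <-] [_ [b Bb <-] <-]]].
    move: Zz; rewrite ZAB => -[a Aa [b Bb <-]].
    exists (incl a); first by exists a.
    by exists (incl b); [exists b|rewrite (linD li)].
  exists (a + b); last exact: linD li _ _.
  by rewrite ZAB; exists a => //; exists b.
- apply/seteqP; split=> [_ [[a Aa <-] [b Bb ab]]|_ ->]; last first.
    by split; exact: push_set0.
  have ab' := incl_inj ab; subst b.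
  have : (carrier A `&` carrier B) a by split.
  by rewrite AB0 => ->; exact: lin0 li.
- exists M => _ _ [a Aa <-] [b Bb <-].
  by have := hM a b Aa Bb; rewrite -(linD li).
Qed.

Lemma bidual0 (V : completeNormedModType K) (phi : (V -> K^o) -> K) : bidual phi -> phi 0 = 0.
Proof.
move=> [pL _]; have d0 : dual (0 : V -> K^o).
  split; first by move=> a x y; rewrite /= scaler0 addr0.
  by exists 0 => x; rewrite normr0 mul0r.
by have := pL (-1) 0 0 d0 d0; rewrite scaler0 addr0 mulN1r addNr.
Qed.

(** Through restriction of functionals, an element of the bidual of [Z] acts on
    the dual of [X] and is represented by a point of [X]. This point lies in
    [Z]: otherwise a functional vanishing on [Z] but not at the point would be
    mapped to 0 and to 1. Every functional on [Z] is a restriction, so the point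
    represents the given element. *)
Lemma reflexive_subspace : reflexive_space X -> reflexive_space Z.
Proof.
move=> rX phi bphi; have [pL [M pM]] := bphi.
have dual_incl (F : X -> K^o) : dual F -> dual (F \o @incl K X Z).
  move=> [lF [C FC]]; split; last by exists C => z; exact: FC.
  by move=> a x y; rewrite /= li lF.
have [|x xP] := rX (fun F => phi (F \o @incl K X Z)).
  split=> [a f g df dg|]; first by have := pL a _ _ (dual_incl _ df) (dual_incl _ dg).
  exists M => F C dF C0 FC; apply: pM => //; first exact: dual_incl.
  by move=> z; exact: FC.
have Zx : carrier Z x.
  apply: contrapT => nZx.
  have [e e0 he] : exists2 e : R, 0 < e & forall z, carrier Z z -> e <= nrm (x - z).
    apply: contrapT => h; apply: nZx; apply: ((closed_nrm S _).1 (@carrier_closed _ _ Z)) => e e0.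
    apply: contrapT => h'; apply: h; exists e => // z Zz; rewrite leNgt; apply/negP => xz.
    by apply: h'; exists z.
  have eV : 0 <= e^-1 by rewrite invr_ge0 ltW.
  have [|||F [lF FC FG]] := @hahn_banach_graph R K S X
    [set p | exists a z, carrier Z z /\ p = (a *: x + z, a)] e^-1 eV.
  - by exists 0, 0; rewrite scale0r addr0; split=> //; exact: carrier0.
  - move=> a _ _ [b [z [Zz ->]]] [c [z' [Zz' ->]]] /=.
    exists (a * b + c), (a *: z + z'); split; first exact: carrierL.
    by rewrite scalerDr scalerA scalerDl addrACA.
  - move=> _ [a [z [Zz ->]]] /=; have [->|a0] := eqVneq a 0.
      by rewrite nrm0 mulr_ge0// nrm_ge0.
    have -> : a *: x + z = a *: (x - (- a^-1) *: z).
      by rewrite scalerBr scalerA mulrN divff// scaleN1r opprK.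
    rewrite nrmZ mulrCA -[leLHS]mulr1 ler_wpM2l ?nrm_ge0//.
    by rewrite mulrC ler_pdivlMr// mul1r; apply: he; exact: carrierZ.
  have bF : dual F by apply/(bounded_operatorP S); split=> //; exists e^-1.
  have Fx : F x = 1.
    by apply: (FG (x, 1)); exists 1, 0; rewrite scale1r addr0; split=> //; exact: carrier0.
  have F0 : F \o @incl K X Z = 0.
    apply/funext => z /=; apply: (FG (incl z, 0)); exists 0, (incl z).
    by rewrite scale0r add0r; split=> //; exact: carrier_incl.
  have := xP F bF; rewrite F0 Fx (bidual0 bphi) => /eqP.
  by rewrite eq_sym oner_eq0.
exists (in_subspace Zx) => f df.
have [lf [C C0 fC]] := (bounded_operatorP S f).1 df.
have [|||F [lF FC FG]] := @hahn_banach_graph R K S X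
  [set p | exists z : Z, p = (incl z, f z)] C C0.
- by exists 0; rewrite (lin0 li) (lin0 lf).
- move=> a _ _ [z ->] [z' ->] /=; exists (a *: z + z').
  by rewrite li lf.
- by move=> _ [z ->] /=; exact: fC.
have bF : dual F by apply/(bounded_operatorP S); split=> //; exists C.
have Ff z : F (incl z) = f z by apply: (FG (incl z, f z)); exists z.
have -> : f = F \o @incl K X Z by apply/funext => z /=; rewrite Ff.
exact: xP.
Qed.

(** A subspace [A] of [Z] is isometric to [push A], and reflexivity is carried
    over by the isometry. *)
Lemma no_reflexive_subspace_inherited :
  no_reflexive_subspace X -> no_reflexive_subspace Z.
Proof.
move=> nX A Ainf rA; apply: (nX (push A) (push_infinite_dim Ainf)) => phi [pL [M pM]].
pose f (a : A) : push A := in_subspace ((push_incl A (incl a)).2 (carrier_incl a)).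
pose lA := @incl_lin K Z A; pose lP := @incl_lin K X (push A).
have fE a : incl (f a) = incl (incl a) by [].
have f_lin : linear f.
  by move=> c a b; apply: incl_inj; rewrite lP !fE lA li.
have /choice[g gP] (y : push A) : exists a, f a = y.
  have [z Az zy] := carrier_incl y.
  by exists (in_subspace Az); apply: incl_inj; rewrite fE zy.
have f_nrm a : `|f a| = `|a| by [].
have f_inj : injective f.
  move=> a b /(congr1 (@incl K X (push A))); rewrite !fE => /incl_inj/incl_inj.
  exact.
have g_lin : linear g by move=> c a b; apply: f_inj; rewrite f_lin !gP.
have g_nrm y : `|g y| = `|y| by rewrite -f_nrm gP.
have dual_g (h : A -> K^o) : dual h -> dual (h \o g).
  move=> [lh [C hC]]; split; first by move=> c a b; rewrite /= g_lin lh.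
  by exists C => y; rewrite /= -(g_nrm y).
have [|x xP] := rA (fun h => phi (h \o g)).
  split=> [c h k dh dk|]; first by have := pL c _ _ (dual_g _ dh) (dual_g _ dk).
  exists M => h C dh C0 hC; apply: pM => //; first exact: dual_g.
  by move=> y; rewrite /= -(g_nrm y).
exists (f x) => k [lk [C kC]].
have := xP (k \o f); rewrite /= => <-; last first.
  split; first by move=> c a b; rewrite /= f_lin lk.
  by exists C => a; rewrite /= -f_nrm.
by congr phi; apply/funext => y /=; rewrite gP.
Qed.

End Sub.
End Inheritance.

(** * The Argyros-Motakis spaces *)

Section Instances.
Variable R : realType.

Definition real_scalars : scalars R R.
Proof.
refine (@Scalars R R (idfun : {rmorphism R -> R}) id (fun=> 0) 0 _ _ _ _ _ _ _ _).
- by move=> a; rewrite mul0r addr0.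
- by move=> u v; rewrite mul0r addr0.
- by [].
- by [].
- move=> u v; rewrite mul0r addr0 -sqrtr_sqr ler_wsqrtr//.
  by rewrite lerDl sqr_ge0.
- by [].
- by move=> a; rewrite normr0.
- by right.
Defined.

Definition complex_scalars : scalars R R[i].
Proof.
have normE (z : R[i]) : complex.Re `|z| = Num.sqrt (complex.Re z ^+ 2 + complex.Im z ^+ 2).
  by case: z.
have le0 (V : normedZmodType R[i]) (x : V) : real_complex R (complex.Re `|x|) = `|x|.
  have := normr_ge0 x; case: (`|x|) => a b /=; rewrite lecE /= => /andP[/eqP b0 _].
  by rewrite b0.
refine (@Scalars R R[i] (real_complex R : {rmorphism R -> R[i]})
  (@complex.Re R) (@complex.Im R) 'i%C _ _ _ _ _ _ _ _).
- case=> a b; rewrite /real_complex_def /=; apply/eqP; rewrite eq_complex /=.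
  by rewrite !mul0r !mulr0 mul1r !subr0 !addr0 !add0r !eqxx.
- by move=> u v /=; rewrite !mul0r mulr0 subr0 addr0.
- exact: le0.
- by move=> x y; rewrite lecR.
- by move=> u v; rewrite normE /= !mul0r !mulr0 !mul1r !subr0 !addr0 !add0r.
- move=> z; rewrite normE -sqrtr_sqr ler_wsqrtr//.
  by rewrite lerDl sqr_ge0.
- move=> z; rewrite normE -sqrtr_sqr ler_wsqrtr//.
  by rewrite lerDr sqr_ge0.
- by left; apply/eqP; rewrite eq_complex /= !mul0r !mulr0 mul1r sub0r addr0 oppr0 !eqxx.
Defined.

End Instances.

Section Saturation.
Variables (R : realType) (K : numFieldType) (S : scalars R K).

Lemma lotz_saturated_of (X : completeNormedModType K) :
  (forall Y : closedSubspace X, infinite_dim Y ->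
    exists x : nat -> Y, normalized x /\ l1_spreading_model x) ->
  (forall Y : closedSubspace X, infinite_dim Y -> scalar_plus_strictly_singular Y) ->
  (forall Y : closedSubspace X, infinite_dim Y -> forall W : Y -> Y,
    strictly_singular W -> totally_bounded_map S (fun x => W (W (W x)))) ->
  lotz_saturated R X.
Proof.
move=> hl1 hsps hcomp Y Yinf.
have [Z [ZY Zinf Zfails]] := exists_fails_bcap S hl1 Yinf.
exists Z; split=> //; apply: (lotz_criterion (S := S)) => //.
  exact: hsps.
exact: hcomp.
Qed.

Lemma lotz_subspace (X : completeNormedModType K) :
  infinite_dim X -> separable X -> hereditarily_indecomposable X -> lotz_saturated R X ->
  exists Z : closedSubspace X,
    [/\ infinite_dim Z, separable Z, hereditarily_indecomposable Z & lotz R Z] /\ WCG Z.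
Proof.
move=> Xinf Xsep XHI /(_ _ (full_infinite_dim Xinf))[Z [_ Zinf Zlotz]].
have Zsep : separable Z := separable_subspace S Z Xsep.
exists Z; split; last exact: (separable_WCG S Zsep).
by split=> //; exact: (hereditarily_indecomposable_subspace S XHI).
Qed.

(** Brings the complex spaces, where products of two strictly singular operators
    are compact, under the same criterion as the real one. *)
Lemma square_to_cube (V : completeNormedModType K) (W : V -> V) :
  bounded_operator W -> totally_bounded_map S (W \o W) ->
  totally_bounded_map S (fun x => W (W (W x))).
Proof.
move=> /(bounded_operatorP S)[lW [M M0 hM]] tb e e0.
have M1 : 0 < M + 1 by rewrite ltr_wpDl.
have [D hD] := tb _ (divr_gt0 e0 M1).
exists (map W D) => x /hD[d dD]; rewrite ltr_pdivlMr// => xd.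
exists (W d); first exact: map_f.
rewrite -(linB lW); apply: le_lt_trans (hM _) _.
by apply: le_lt_trans xd; rewrite mulrC ler_wpM2l ?nrm_ge0//; lra.
Qed.

End Saturation.

Lemma ISP_lotz_saturated (R : realType) (X : completeNormedModType R) :
  ISP_properties X -> lotz_saturated R X.
Proof.
move=> hX; apply: (lotz_saturated_of (S := real_scalars R)).
- by move=> Y /(ISP_l1 hX)[x [x1 _ xl1]]; exists x.
- exact: ISP_scalar_plus_SS hX.
- move=> Y Yinf W ssW; apply: compact_totally_bounded.
  exact: (ISP_compact hX Yinf ssW ssW ssW).
Qed.

Lemma tree_lotz_saturated (R : realType) (X : completeNormedModType R[i]) :
  tree_space_properties X -> lotz_saturated R X.
Proof.
move=> hX; apply: (lotz_saturated_of (S := complex_scalars R)).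
- exact: tree_l1 hX.
- exact: tree_scalar_plus_SS hX.
- move=> Y Yinf W ssW; apply: square_to_cube; first by case: ssW.
  exact/compact_totally_bounded/(tree_compact hX Yinf ssW ssW).
Qed.

Theorem theorem1p3 (R : realType)
    (X_ISP : completeNormedModType R)
    (A : Type) (admitted : set (set (seq A)))
    (X_T : set (seq A) -> completeNormedModType R[i])
    (X_U : completeNormedModType R[i])
    (h_ISP : ISP_properties X_ISP)
    (h_wf : forall T, admitted T -> well_founded_tree T)
    (h_T : forall T, admitted T -> wf_tree_space_properties (X_T T))
    (h_U : universal_tree_space_properties X_U) :
  (exists Y : closedSubspace X_ISP,
     [/\ infinite_dim Y, separable Y, hereditarily_indecomposable Y & lotz R Y]
     /\ reflexive_space Y /\ WCG Y) /\
  (forall T, admitted T -> exists Y : closedSubspace (X_T T),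
     [/\ infinite_dim Y, separable Y, hereditarily_indecomposable Y & lotz R Y]
     /\ reflexive_space Y /\ WCG Y) /\
  (exists Y : closedSubspace X_U,
     [/\ infinite_dim Y, separable Y, hereditarily_indecomposable Y & lotz R Y]
     /\ no_reflexive_subspace Y /\ WCG Y) /\
  lotz_saturated R X_ISP /\
  (forall T, admitted T -> lotz_saturated R (X_T T)) /\
  lotz_saturated R X_U.
Proof.
have sat_ISP := ISP_lotz_saturated h_ISP.
have sat_T T (aT : admitted T) := tree_lotz_saturated (wf_tree_space (h_T T aT)).
have sat_U := tree_lotz_saturated (universal_tree_space h_U).
split; [|split; [|split; [|by split]]].
- have [Z [hZ wZ]] := lotz_subspace (real_scalars R) (ISP_infinite_dim h_ISP)
    (ISP_separable h_ISP) (ISP_HI h_ISP) sat_ISP.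
  exists Z; do 2! split=> //.
  exact: (reflexive_subspace (real_scalars R) (ISP_reflexive h_ISP)).
- move=> T aT; have hT := wf_tree_space (h_T T aT).
  have [Z [hZ wZ]] := lotz_subspace (complex_scalars R) (tree_infinite_dim hT)
    (tree_separable hT) (tree_HI hT) (sat_T T aT).
  exists Z; do 2! split=> //.
  exact: (reflexive_subspace (complex_scalars R) (wf_tree_reflexive (h_T T aT))).
- have hU := universal_tree_space h_U.
  have [Z [hZ wZ]] := lotz_subspace (complex_scalars R) (tree_infinite_dim hU)
    (tree_separable hU) (tree_HI hU) sat_U.
  exists Z; do 2! split=> //.
  exact: (no_reflexive_subspace_inherited (complex_scalars R) (universal_no_reflexive h_U)).
Qed.
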